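(* Let $(\Gamma(t),u^1,u^2)$, with pressure $p$ and fluid domain $\Omega(t)$, be a $C^1$ solution of the 2D free-surface incompressible irrotational Euler problem with fixed endpoints (as specified in the context), with $C^1$ initial data $\Gamma(0)$ and $(u^1_0,u^2_0)$. If $$A=\int_{\Omega(0)}u^1_0(x)\,x_1\,dx+\int_0^1 x_2\,u^2_0(1,x_2)\,dx_2>0,$$ then $\Gamma(t)$ must develop a singularity in finite time; that is, a $C^1$ solution with these initial data cannot exist for all times $0\le t<\infty$.
   Context: Points of the plane are written $x=(x_1,x_2)$, and $\partial_i=\partial/\partial x_i$. For each time $t$, the fluid occupies a bounded planar domain $\Omega(t)$ bounded by the lines $x_1=0$, $x_1=1$, $x_2=0$ and a free surface $$\Gamma(t)=\{(x_1(t,\alpha),x_2(t,\alpha)):0\le\alpha\le 1\},$$ whose endpoints are fixed on the lateral walls at height $1$: $x_1(t,0)=0$, $x_1(t,1)=1$, $x_2(t,0)=x_2(t,1)=1$; moreover $0\le x_1(t,\alpha)\le 1$ for all $0\le\alpha\le1$ and all times $t\ge 0$ at which the solution exists. The 2D free-surface incompressible irrotational Euler problem (without gravity or surface tension) with fixed endpoints, for the unknowns $\Gamma(t)$, velocity $(u^1,u^2)(t,x)$ and pressure $p(t,x)$, consists of the following. (i) Euler equations in $\Omega(t)$: $$\partial_t u^1+u^1\partial_1u^1+u^2\partial_2u^1+\partial_1p=0,\qquad \partial_t u^2+u^1\partial_1u^2+u^2\partial_2u^2+\partial_2p=0.$$ (ii) Incompressibility and irrotationality in $\Omega(t)$: $$\partial_1u^1+\partial_2u^2=0,\qquad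 \partial_2u^1-\partial_1u^2=0.$$ (iii) Impermeability on the fixed boundary: $u^1=0$ on the parts of the boundary of $\Omega(t)$ where $x_1=0$ or $x_1=1$; $u^2=0$ on the part where $x_2=0$. (iv) Fixed endpoints: $u^2(t,0,1)=u^2(t,1,1)=0$. (v) Kinematic condition: for $0\le\alpha\le1$, $$\frac{d x_1(t,\alpha)}{dt}=u^1(t,x_1(t,\alpha),x_2(t,\alpha)),\qquad \frac{d x_2(t,\alpha)}{dt}=u^2(t,x_1(t,\alpha),x_2(t,\alpha)).$$ (vi) Dynamic condition: $p=0$ on $\Gamma(t)$. (vii) Initial condition: at $t=0$, $u^1=u^1_0$ and $u^2=u^2_0$ on $\Omega(0)$, where the initial data satisfy, at $t=0$, the conditions in (ii), (iii), (iv) and the following conditions on the surface $\Gamma(0)$: $x_1(0,0)=0$, $x_1(0,1)=1$, $x_2(0,0)=x_2(0,1)=1$, and $0\le x_1(0,\alpha)\le 1$ for all $0\le\alpha\le 1$. A $C^1$ solution means that $\Gamma(t)$ and $u^1,u^2$ are $C^1$, with $u^1,u^2$ being $C^1$ up to the boundary of $\Omega(t)$. *)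

(* Defs.v *)
From HB Require Import structures.
From mathcomp Require Import all_boot all_order all_algebra.
From mathcomp Require Import all_classical all_reals all_analysis.
Set Implicit Arguments.
Unset Strict Implicit.
Unset Printing Implicit Defensive.
Import Order.TTheory GRing.Theory Num.Theory.
Import numFieldNormedType.Exports.
Local Open Scope classical_set_scope.
Local Open Scope ring_scope.

(* [C1_up_to D K f]: f is C^1 in D, and f and its derivatives extend
   continuously to K; K is D together with (part of) its boundary. The value of
   f itself on K is its continuous extension, while the derivatives are only
   taken at points of D. *)
Definition C1_up_to (R : realType) (V : normedModType R) (D K : set V)
    (f : V -> R) : Prop :=
  {within K, continuous f} /\
  forall v : V, exists g : V -> R,
    {within K, continuous g} /\ forall x, D x -> is_derive x v f (g x).

Section Plane.
Variable R : realType.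
Local Notation plane := (R * R)%type.

Definition d1 (f : plane -> R) (x : plane) : R := 'D_(1, 0) f x.
Definition d2 (f : plane -> R) (x : plane) : R := 'D_(0, 1) f x.

Definition bdry (D : set plane) : set plane := closure D `\` interior D.

(* The bottom and the two lateral walls up to height 1, where the free surface
   is attached. *)
Definition walls : set plane :=
  [set x | [/\ 0 <= x.1 <= 1, 0 <= x.2 <= 1 & [\/ x.1 = 0, x.1 = 1 | x.2 = 0]]].

Definition surface_conditions (c : R -> plane) : Prop :=
  [/\ c 0 = (0, 1), c 1 = (1, 1) &
      forall a : R, 0 <= a <= 1 -> 0 <= (c a).1 <= 1].

(* D is a bounded domain (open and connected) of the half-strip above the
   bottom, bounded exactly by the walls and the curve c, and the two parts of
   its boundary meet only at the endpoints of c. If c is simple, this last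
   condition follows from the others; it is weaker than asking c to be simple.
   The curve may touch the vertical lines above height 1. *)
Definition fluid_domain (c : R -> plane) (D : set plane) : Prop :=
  [/\ open D, connected D, bounded_set D,
      D `<=` [set x | 0 < x.1 < 1 /\ 0 < x.2] &
      bdry D = walls `|` c @` `[0, 1]] /\
  (forall a : R, 0 < a < 1 -> ~ walls (c a)).

Definition div_curl_free (D : set plane) (v1 v2 : plane -> R) : Prop :=
  forall x, D x -> d1 v1 x + d2 v2 x = 0 /\ d2 v1 x - d1 v2 x = 0.

Definition impermeable (D : set plane) (v1 v2 : plane -> R) : Prop :=
  forall x, bdry D x ->
    (x.1 = 0 \/ x.1 = 1 -> v1 x = 0) /\ (x.2 = 0 -> v2 x = 0).

Definition endpoints_at_rest (v2 : plane -> R) : Prop :=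
  v2 (0, 1) = 0 /\ v2 (1, 1) = 0.

Definition C1_initial_data (c0 : R -> plane) (D0 : set plane)
    (v1 v2 : plane -> R) : Prop :=
  [/\ C1_up_to (`]0, 1[ : set R) `[0, 1] (fun a : R => (c0 a).1),
      C1_up_to (`]0, 1[ : set R) `[0, 1] (fun a : R => (c0 a).2),
      C1_up_to D0 (closure D0) v1 &
      C1_up_to D0 (closure D0) v2] /\
  [/\ surface_conditions c0, fluid_domain c0 D0,
      div_curl_free D0 v1 v2, impermeable D0 v1 v2 & endpoints_at_rest v2].

Definition material_derivative (v1 v2 f : R -> plane -> R) (t : R) (x : plane) : R :=
  derive1 (fun s : R => f s x) t + v1 t x * d1 (f t) x + v2 t x * d2 (f t) x.

(* A C^1 solution on the time interval [0, T), T possibly infinite. Equations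
   with a time derivative are imposed for t > 0, where this derivative is
   two-sided; at t = 0 they follow by continuity. The pressure only enters for t > 0. *)
Record C1_solution (T : \bar R) (c : R -> R -> plane) (D : R -> set plane)
    (u1 u2 p : R -> plane -> R) : Prop := {
  sol_surface_C1 :
    let I := [set z : R * R | 0 < z.1 /\ (z.1%:E < T)%E /\ 0 < z.2 < 1] in
    let K := [set z : R * R | 0 <= z.1 /\ (z.1%:E < T)%E /\ 0 <= z.2 <= 1] in
    C1_up_to I K (fun z => (c z.1 z.2).1) /\
    C1_up_to I K (fun z => (c z.1 z.2).2) ;
  sol_velocity_C1 :
    let I := [set z : R * plane | 0 < z.1 /\ (z.1%:E < T)%E /\ D z.1 z.2] in
    let K := [set z : R * plane |
               0 <= z.1 /\ (z.1%:E < T)%E /\ closure (D z.1) z.2] in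
    C1_up_to I K (fun z => u1 z.1 z.2) /\ C1_up_to I K (fun z => u2 z.1 z.2) ;
  sol_pressure_regular : forall t : R, 0 < t -> (t%:E < T)%E ->
    {within closure (D t), continuous (p t)} /\
    forall x, D t x -> derivable (p t) x (1, 0) /\ derivable (p t) x (0, 1) ;
  sol_surface : forall t : R, 0 <= t -> (t%:E < T)%E -> surface_conditions (c t) ;
  sol_domain : forall t : R, 0 <= t -> (t%:E < T)%E -> fluid_domain (c t) (D t) ;
  sol_euler : forall (t : R) (x : plane), 0 < t -> (t%:E < T)%E -> D t x ->
    material_derivative u1 u2 u1 t x + d1 (p t) x = 0 /\
    material_derivative u1 u2 u2 t x + d2 (p t) x = 0 ;
  sol_div_curl : forall t : R, 0 <= t -> (t%:E < T)%E ->
    div_curl_free (D t) (u1 t) (u2 t) ;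
  sol_impermeable : forall t : R, 0 <= t -> (t%:E < T)%E ->
    impermeable (D t) (u1 t) (u2 t) ;
  sol_endpoints : forall t : R, 0 <= t -> (t%:E < T)%E -> endpoints_at_rest (u2 t) ;
  sol_kinematic : forall t a : R, 0 < t -> (t%:E < T)%E -> 0 <= a <= 1 ->
    is_derive t (1 : R) (fun s => (c s a).1) (u1 t (c t a)) /\
    is_derive t (1 : R) (fun s => (c s a).2) (u2 t (c t a)) ;
  sol_dynamic : forall t a : R, 0 < t -> (t%:E < T)%E -> 0 <= a <= 1 ->
    p t (c t a) = 0
}.

Definition has_initial_data (c : R -> R -> plane) (D : R -> set plane)
    (u1 u2 : R -> plane -> R) (c0 : R -> plane) (D0 : set plane)
    (v1 v2 : plane -> R) : Prop :=
  [/\ forall a : R, 0 <= a <= 1 -> c 0 a = c0 a, D 0 = D0 &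
      forall x, D0 x -> u1 0 x = v1 x /\ u2 0 x = v2 x].

Definition functional_A (D0 : set plane) (v1 v2 : plane -> R) : R :=
  (\int[(@lebesgue_measure R \x @lebesgue_measure R)%E]_(x in D0) (v1 x * x.1))
  + \int[@lebesgue_measure R]_(y in `[0, 1]) (y * v2 (1, y)).

End Plane.

(* Main.v *)
(* Let A(t) be the integral of x1 u1 over D(t) plus the integral of y u2(t, 1, y)
   over [0, 1]. Transport and Bernoulli's law on the wall x1 = 1 give
     A' >= int u1^2 + (1/2) int u2(t, 1, y)^2 dy,
   because the pressure contributes int p(t, 1, y) dy - int x1 d1 p >= 0: this is
   an integration by parts in x1 together with p >= 0. Completing squares,
   s^2 A' >= 2 s A - (m + 2) for s = T - t, where m bounds the area, so that
   (T - t)^2 A + (m + 3) t is nondecreasing; at t = T this forces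
   T A(0) <= m + 3, which fails for large T.

   The velocity is only C^1 up to a boundary which is only C^1, D(t) is merely
   given for each t, and the pressure has only one derivative. Transport is
   therefore proved for integrals cut off near the boundary, as one-sided
   estimates on difference quotients, the layer of width eps costing O(eps); and
   p >= 0 follows from a weak maximum principle in which difference quotients of
   the velocity, which are divergence free, replace second derivatives of p. *)

Require Import Defs.
From mathcomp Require Import all_boot all_order all_algebra.
From mathcomp Require Import all_classical all_reals all_analysis.
From mathcomp Require Import measurable_realfun ring lra.
Set Implicit Arguments.
Unset Strict Implicit.
Unset Printing Implicit Defensive.
Import Order.TTheory GRing.Theory Num.Theory.
Import numFieldNormedType.Exports.
Local Open Scope classical_set_scope.
Local Open Scope ring_scope.

(** * Continuity on sets and Dini derivatives *)

Section Basics.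
Variable R : realType.

(** Since the domain is given separately for each time, nothing says a priori that [D t] varies
    continuously: a component of the complement of a continuously moving boundary can lose a whole
    pocket when a neck closes. What is compact from the start is the boundary, a continuous image of
    rectangles. Estimates are therefore proved near the boundary, and they show that a point well
    inside the fluid stays in it for a short time; only then is the fluid region over a bounded time
    interval compact, and are the fields bounded and uniformly continuous.

    Differential inequalities are read as lower bounds on forward difference quotients, so neither
    the area nor A(t) is ever differentiated. The width of the cut-off is fixed in terms of T and
    its error is absorbed by slack: the area is bounded by its initial value plus 1 rather than
    shown to be constant, and the unit between m + 2 and m + 3 pays for the error in A'. *)

Definition cont_on (V W : normedModType R) (K : set V) (f : V -> W) : Prop :=
  forall z, K z -> forall e : R, 0 < e -> exists2 r : R, 0 < r &
    forall z', K z' -> `|z - z'| < r -> `|f z - f z'| < e.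

Lemma within_cont_on (V W : normedModType R) (K : set V) (f : V -> W) :
  {within K, continuous f} <-> cont_on K f.
Proof.
split=> [cf z Kz e e0|cf].
  have /subspace_continuousP/(_ z Kz) := cf.
  move=> /cvgrPdist_lt/(_ e e0); rewrite near_withinE => /nbhs_normP[r /= r0 H].
  by exists r => // z' Kz' zz'; apply: H.
apply/subspace_continuousP => z Kz; apply/cvgrPdist_lt => e e0.
have [r r0 H] := cf z Kz e e0.
rewrite near_withinE; apply/nbhs_normP; exists r => //= z' zz' Kz'.
exact: H.
Qed.

(** Heine-Cantor in which only one of the two points is confined to the compact set. It is applied
    to the lateral boundary, against arbitrary nearby fluid points, before the fluid region itself
    is known to be compact. *)
Lemma cont_on_compact_unif (V W : normedModType R) (C K : set V) (f : V -> W) :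
  compact C -> C `<=` K -> cont_on K f ->
  forall e : R, 0 < e -> exists2 r : R, 0 < r &
    forall z z', C z -> K z' -> `|z - z'| < r -> `|f z - f z'| < e.
Proof.
move=> /compact_near_coveringP cC CK cf e e0.
have := cC R (0^'+) (fun r z => forall z', C z -> K z' -> `|z - z'| < r -> `|f z - f z'| < e).
case.
- move=> z Cz; have e20 : 0 < e / 2 by rewrite divr_gt0.
  have [r r0 H] := cf z (CK _ Cz) (e / 2) e20.
  exists (ball z (r / 2), [set s : R | s < r / 2]).
    split; first by apply: nbhsx_ballx; rewrite divr_gt0.
    by apply: nbhs_right_lt; rewrite divr_gt0.
  move=> [w s] /= [zw sr] z' Cw Kz' wz'.
  move: zw; rewrite -ball_normE /= => zw.
  have h1 : `|f z - f w| < e / 2.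
    by apply: H; [exact: CK|apply: lt_trans zw _; rewrite gtr_pMr// invf_lt1// ltr1n].
  have h2 : `|f z - f z'| < e / 2.
    apply: H => //.
    have -> : z - z' = (z - w) + (w - z') by rewrite addrA subrK.
    apply: le_lt_trans (ler_normD _ _) _; rewrite [r]splitr.
    by apply: ltrD => //; apply: lt_trans wz' _.
  have -> : f w - f z' = - (f z - f w) + (f z - f z').
    by rewrite opprB addrA subrK.
  apply: le_lt_trans (ler_normD _ _) _; rewrite normrN [e]splitr.
  by apply: ltrD.
- move=> r /= r0 H; exists (r / 2); first by rewrite divr_gt0.
  move=> z z' Cz; apply: (H (r / 2)) => //=; last by rewrite divr_gt0.
  rewrite sub0r normrN gtr0_norm ?divr_gt0//.
  by rewrite gtr_pMr// invf_lt1// ltr1n.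
Qed.

Lemma cont_on_bounded (V : normedModType R) (K : set V) (f : V -> R) :
  compact K -> cont_on K f -> exists2 M : R, 0 < M & forall z, K z -> `|f z| <= M.
Proof.
move=> cK /within_cont_on cf.
have /compact_bounded/ex_strict_bound_gt0[M M0 H] := continuous_compact cf cK.
by exists M => // z Kz; apply/ltW/H; exists z.
Qed.

(** The segment is described by distances to its two ends, so that one statement serves for both
    orders of a and b; time steps of both signs occur. *)
Lemma mean_value (f df : R -> R) (a b : R) :
  (forall x, `|x - a| <= `|b - a| -> `|x - b| <= `|b - a| ->
     is_derive x 1 f (df x)) ->
  exists x, [/\ `|x - a| <= `|b - a|, `|x - b| <= `|b - a| &
                f b - f a = df x * (b - a)].
Proof.
wlog ab : a b / a <= b => [H|].
  case: (leP a b) => [/H//|/ltW ba] fd.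
  case: (H b a ba) => [x xb xa|x []].
    by apply: fd; rewrite (distrC b a).
  move=> xb xa e; exists x; split; rewrite ?(distrC b a)//.
  by rewrite -[LHS]opprB e -mulrN opprB.
move=> fd.
have hab x : x \in `[a, b] -> `|x - a| <= `|b - a| /\ `|x - b| <= `|b - a|.
  rewrite in_itv /= => /andP[ax xb].
  by rewrite (ler0_norm (_ : x - b <= 0)) ?subr_le0// !ger0_norm ?subr_ge0//; split; lra.
case: (@MVT_segment R f df a b ab).
- move=> x xab; have [] := hab x (subset_itv_oo_cc xab); exact: fd.
- apply: derivable_within_continuous => x xab.
  by have [h1 h2] := hab x xab; have [] := fd x h1 h2.
- by move=> x /hab[h1 h2] e; exists x.
Qed.

(** If phi dropped, consider the last time at which it lies above a line of small negative slope:
    the forward estimate there produces a later such time. *)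
Lemma dini_nondecreasing (phi : R -> R) (a b : R) : a <= b ->
  cont_on [set t | a <= t <= b] phi ->
  (forall t : R, a < t < b -> forall e : R, 0 < e ->
     exists2 h0 : R, 0 < h0 &
       forall h : R, 0 < h < h0 -> phi t - e * h <= phi (t + h)) ->
  phi a <= phi b.
Proof.
rewrite le_eqVlt => /predU1P[->//|ab] cphi H.
rewrite leNgt; apply/negP => ba.
have d0 : 0 < (phi a - phi b) / 2 by lra.
have aI : a <= a <= b by rewrite lexx ltW.
have [r r0 Hr] := cphi a aI _ d0.
(* The estimate is assumed inside the interval only, so the start moves to a nearby interior point
   at which phi still exceeds [phi b]. *)
pose a' := Num.min (a + r / 2) ((a + b) / 2).
have aa' : a < a' by rewrite /a' lt_min; apply/andP; split; lra.
have a'b : a' < b by rewrite /a' gt_min; apply/orP; right; lra.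
have a'r : a' <= a + r / 2 by rewrite /a' ge_min lexx.
have pa' : phi b < phi a'.
  have : `|phi a - phi a'| < (phi a - phi b) / 2.
    apply: Hr; first by rewrite /= !ltW.
    by rewrite ltr_distl; apply/andP; split; lra.
  by rewrite ltr_distl => /andP[]; lra.
(* With this slope the line loses only half of the drop up to b, so [phi b] lies strictly below
   it. *)
pose e := (phi a' - phi b) / (2 * (b - a')).
have e0 : 0 < e by rewrite divr_gt0// ?mulr_gt0//; lra.
have eb : e * (b - a') = (phi a' - phi b) / 2.
  by rewrite /e; field; lra.
pose S := [set t | a' <= t <= b /\ phi a' - e * (t - a') <= phi t].
have Sa' : S a' by split; [rewrite lexx ltW|rewrite subrr mulr0 subr0].
have supS : has_sup S.
  by split; [exists a'|exists b => t [/andP[]]].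
pose s := sup S.
have a's : a' <= s by apply: sup_upper_bound.
have sb : s <= b by apply: ge_sup => [|t [/andP[]]//]; exists a'.
have sI : a <= s <= b by rewrite sb andbT; lra.
have Ss : phi a' - e * (s - a') <= phi s.
  rewrite leNgt; apply/negP => lts.
  pose g := phi a' - e * (s - a') - phi s.
  have g0 : 0 < g by rewrite /g; lra.
  have [q q0 Hq] := cphi s sI _ g0.
  have [t [/andP[a't tb] St] ts] := sup_adherent q0 supS.
  have tles : t <= s by apply: sup_upper_bound => //; split => //; rewrite a't.
  have : `|phi s - phi t| < g.
    apply: Hq; first by rewrite /= tb andbT; lra.
    rewrite ltr_distl; apply/andP; split; rewrite -/s in ts; lra.
  rewrite ltr_distl => /andP[h1 h2].
  have : e * (t - a') <= e * (s - a') by rewrite ler_pM2l//; lra.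
  rewrite /g in h1 h2; lra.
have sltb : s < b.
  rewrite lt_neqAle sb andbT; apply/eqP => sE.
  by move: Ss; rewrite sE eb; lra.
have [||h0 h00 Hh] := H s _ e => //; first by apply/andP; split; lra.
pose h := Num.min (h0 / 2) (b - s).
have h_gt0 : 0 < h by rewrite lt_min; apply/andP; split; lra.
have hh0 : h < h0 by rewrite gt_min; apply/orP; left; lra.
have hb : h <= b - s by rewrite ge_min lexx orbT.
have := Hh h; rewrite h_gt0 hh0 => /(_ isT) Hs.
have : s + h <= s.
  apply: sup_upper_bound => //; split; first by apply/andP; split; lra.
  by have := mulrDr e (s - a') h; rewrite (_ : s - a' + h = s + h - a'); lra.
lra.
Qed.

End Basics.

(** * Distance to the boundary *)

Section Distance.
Variables (R : realType) (V : normedModType R).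
Implicit Types (B C D : set V) (x y z : V) (r : R).

(** By default the infimum of an empty set is 0; lower bounds therefore ask for a nonempty B. *)
Definition dist B x : R := inf [set `|x - y| | y in B].

Lemma dist_le B x y : B y -> dist B x <= `|x - y|.
Proof. by move=> By; apply: ge_inf; [exists 0 => _ [z _ <-]|exists y]. Qed.

Lemma dist_ge B x r : B !=set0 -> (forall y, B y -> r <= `|x - y|) -> r <= dist B x.
Proof.
move=> [y By] H; apply: lb_le_inf; first by exists `|x - y|; exists y.
by move=> _ [z Bz <-]; exact: H.
Qed.

Lemma dist_lt B x r : B !=set0 -> dist B x < r -> exists2 y, B y & `|x - y| < r.
Proof.
move=> B0 dr; apply: contrapT => H; move: dr; apply/negP; rewrite -leNgt.
by apply: dist_ge => // y By; rewrite leNgt; apply/negP => yr; apply: H; exists y.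
Qed.

Lemma dist_lip B x z : B !=set0 -> dist B x <= dist B z + `|x - z|.
Proof.
move=> B0; rewrite -lerBlDr; apply: dist_ge => // y By; rewrite lerBlDr.
apply: le_trans (dist_le x By) _; rewrite [leRHS]addrC.
exact: ler_distD.
Qed.

Lemma dist_ge0 B x : B !=set0 -> 0 <= dist B x.
Proof. by move=> B0; apply: dist_ge. Qed.

Lemma dist_cont B : B !=set0 -> cont_on setT (dist B : V -> R^o).
Proof.
move=> B0 z _ e e0; exists e => // z' _ zz'.
have := dist_lip z z' B0; have := dist_lip z' z B0; rewrite (distrC z').
by rewrite ltr_distl => h1 h2; apply/andP; split; lra.
Qed.

Lemma cont_onS (U W : normedModType R) (A K : set U) (f : U -> W) :
  A `<=` K -> cont_on K f -> cont_on A f.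
Proof.
move=> AK cf t At e e0; have [r r0 H] := cf t (AK _ At) e e0.
by exists r => // z' Az'; apply: H; exact: AK.
Qed.

Lemma cont_on_comp (U W X : normedModType R) (A : set U) (K : set W)
    (f : U -> W) (g : W -> X) :
  (forall t, A t -> K (f t)) -> cont_on A f -> cont_on K g ->
  cont_on A (g \o f).
Proof.
move=> AK cf cg t At e e0.
have [r r0 Hg] := cg (f t) (AK _ At) e e0.
have [s s0 Hf] := cf t At r r0.
by exists s => // z' Az' zz'; apply: Hg; [exact: AK|exact: Hf].
Qed.

Lemma convex_connected C :
  (forall x y (s : R), C x -> C y -> 0 <= s <= 1 -> C (x + s *: (y - x))) ->
  connected C.
Proof.
move=> cC; have [->|/set0P[x Cx]] := eqVneq C set0; first exact: connected0.
pose A y := (fun s : R => x + s *: (y - x)) @` `[0, 1].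
have -> : C = \bigcup_(y in C) A y.
  apply/seteqP; split=> [y Cy|_ [y Cy [s /= + <-]]].
    exists y => //; exists 1; first by rewrite /= in_itv /= ler01 lexx.
    by rewrite scale1r addrC subrK.
  by rewrite in_itv /=; exact: cC.
apply: bigcup_connected.
  exists x => y Cy; exists 0; first by rewrite /= in_itv /= ler01 lexx.
  by rewrite scale0r addr0.
move=> y Cy; apply: connected_continuous_connected; first exact: segment_connected.
apply: continuous_subspaceT => s; apply: cvgD; first exact: cvg_cst.
by apply: cvgZr_tmp; exact: cvg_id.
Qed.

Lemma norm_convex x y z (s r : R) : 0 <= s <= 1 ->
  `|z - x| < r -> `|z - y| < r -> `|z - (x + s *: (y - x))| < r.
Proof.
move=> /andP[s0 s1] zx zy.
have -> : z - (x + s *: (y - x)) = (1 - s) *: (z - x) + s *: (z - y).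
  rewrite scalerBl scale1r -addrA [- _ + _]addrC -scalerBr.
  have -> : z - y - (z - x) = - (y - x) by rewrite !opprB addrC addrA subrK.
  by rewrite scalerN opprD addrA.
apply: le_lt_trans (ler_normD _ _) _.
rewrite !normrZ (ger0_norm s0) ger0_norm ?subr_ge0//.
have [->|s_neq0] := eqVneq s 0; first by rewrite subr0 mul1r mul0r addr0.
have s_gt0 : 0 < s by rewrite lt_def s_neq0.
have : s * `|z - y| < s * r by rewrite ltr_pM2l.
have : (1 - s) * `|z - x| <= (1 - s) * r by apply: ler_wpM2l; [rewrite subr_ge0|exact: ltW].
lra.
Qed.

Lemma ball_connected x r : connected [set y | `|x - y| < r].
Proof. by apply: convex_connected => y z s /= *; exact: norm_convex. Qed.

Lemma open_normP C : open C <-> forall x, C x -> exists2 r : R, 0 < r &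
  forall y, `|x - y| < r -> C y.
Proof.
rewrite openE; split=> [oC x /oC/nbhs_normP[r r0 H]|H x /H[r r0 h]].
  by exists r => // y; exact: H.
by apply/nbhs_normP; exists r.
Qed.

Lemma closure_normP C x : closure C x <->
  forall r : R, 0 < r -> exists2 y, C y & `|x - y| < r.
Proof.
split=> [cC r r0|H U /nbhs_normP[r /= r0 rU]].
  have [|y [Cy]] := cC (ball x r); first exact: nbhsx_ballx.
  by rewrite -ball_normE; exists y.
by have [y Cy xy] := H r r0; exists y; split => //; apply: rU.
Qed.

(** D and the complement of its closure separate any set that avoids the boundary. This derives
    membership in the fluid domain from knowledge of the boundary alone. *)
Lemma connected_in_open D C : open D -> connected C ->
  (forall y, C y -> ~ (closure D `\` interior D) y) ->
  (exists2 y, C y & D y) -> C `<=` D.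
Proof.
move=> oD cC CB [y Cy Dy].
have iD : interior D = D by apply/interior_id.
have sep : separated D (~` closure D).
  split; first by rewrite setICr.
  apply/seteqP; split => // z [Dz].
  move=> /(_ D (open_nbhs_nbhs _))[]; first by split.
  by move=> w [nw Dw]; apply: nw; exact: subset_closure.
have [] := connected_subset sep _ cC => //.
- move=> z Cz; have [Dz|nDz] := pselect (D z); [by left|right => cDz].
  by apply: (CB z Cz); split => //; rewrite iD.
- by move=> /(_ y Cy) nD; exfalso; apply: nD; exact: subset_closure.
Qed.

Lemma in_ball_open D x r y : open D -> D x ->
  closure D `\` interior D !=set0 ->
  r <= dist (closure D `\` interior D) x -> `|x - y| < r -> D y.
Proof.
move=> oD Dx B0 rd xy.
apply: (@connected_in_open D [set y | `|x - y| < r]) => //.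
- exact: ball_connected.
- by move=> z /= xz /(dist_le x)/(le_trans rd); rewrite leNgt xz.
- by exists x => //=; rewrite subrr normr0 (le_lt_trans _ xy).
Qed.

Lemma dist_gt0 D x : open D -> D x -> closure D `\` interior D !=set0 ->
  0 < dist (closure D `\` interior D) x.
Proof.
move=> oD Dx B0; have /open_normP/(_ x Dx)[r r0 H] := oD.
apply: lt_le_trans r0 _; apply: dist_ge => // y [_ niy].
rewrite leNgt; apply/negP => /H Dy; apply: niy.
by move/interior_id : oD => ->.
Qed.

Lemma dist0_boundary D y : (closure D `\` interior D) y ->
  dist (closure D `\` interior D) y = 0.
Proof.
move=> By; apply/eqP; rewrite eq_le dist_ge0 ?andbT; last by exists y.
by apply: le_trans (dist_le y By) _; rewrite subrr normr0.
Qed.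

(** The points reachable from x by such a corridor are open and closed in D: a corridor is extended
    by gluing on a ball around the new point, of half its distance to the boundary. *)
Lemma connected_open_clearance D x y : open D -> connected D ->
  closure D `\` interior D !=set0 -> D x -> D y ->
  exists2 r : R, 0 < r & exists C, [/\ connected C, C x, C y &
     forall z, C z -> r <= dist (closure D `\` interior D) z].
Proof.
set B := closure D `\` interior D => oD cD B0 Dx Dy.
pose J z := exists2 r : R, 0 < r & exists C, [/\ connected C, C x, C z &
     forall z, C z -> r <= dist B z].
suff : [set z | D z /\ J z] = D by move/seteqP => [_ /(_ y Dy)[]].
have step z w : D w -> J z -> `|w - z| < dist B w / 2 -> J w.
  move=> Dw [r r0 [C [cC Cx Cz Cr]]] wz.
  have dw := dist_gt0 oD Dw B0.
  exists (Num.min r (dist B w / 2)); first by rewrite lt_min r0 divr_gt0.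
  exists (C `|` [set v | `|w - v| < dist B w / 2]); split.
  - by apply: connectedU => //; [exists z|exact: ball_connected].
  - by left.
  - by right; rewrite /= subrr normr0 divr_gt0.
  - move=> v [/Cr Cv|/= wv]; first by rewrite ge_min Cv.
    rewrite ge_min; apply/orP; right.
    by have := dist_lip w v B0; lra.
apply: cD.
- exists x; split => //; exists (dist B x); first exact: dist_gt0.
  exists [set x]; split => //; first exact: connected1.
  by move=> _ ->.
- exists [set z | D z /\ J z]; last by apply/seteqP; split => [z []|z []].
  apply/open_normP => z [Dz Jz].
  have dz := dist_gt0 oD Dz B0.
  exists (dist B z / 3); first by rewrite divr_gt0.
  move=> w zw; have Dw : D w.
    by apply: (in_ball_open oD Dz B0 (lexx _)); apply: lt_trans zw _; rewrite gtr_pMr// invf_lt1//; lra.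
  split => //; apply: step Jz _ => //; rewrite distrC.
  by have := dist_lip z w B0; lra.
- exists (closure [set z | D z /\ J z]); first exact: closed_closure.
  apply/seteqP; split => [z [Dz Jz]|z [Dz /closure_normP cz]].
    by split => //; apply: subset_closure.
  split => //; have [|w [Dw Jw] zw] := cz (dist B z / 2).
    by rewrite divr_gt0// dist_gt0.
  exact: step Jw zw.
Qed.

End Distance.

(** * Operations on functions continuous on a set *)

Section ContPair.
Variable R : realType.
Implicit Types (U V W : normedModType R).

Lemma norm_pair_lt V W (x : V * W) (e : R) : (`|x| < e) = (`|x.1| < e) && (`|x.2| < e).
Proof. by rewrite prod_normE gt_max. Qed.

Lemma norm_pair_le V W (x : V * W) (e : R) : (`|x| <= e) = (`|x.1| <= e) && (`|x.2| <= e).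
Proof. by rewrite prod_normE ge_max. Qed.

Lemma norm_fst V W (x : V * W) : `|x.1| <= `|x|.
Proof. by rewrite prod_normE le_max lexx. Qed.

Lemma norm_snd V W (x : V * W) : `|x.2| <= `|x|.
Proof. by rewrite prod_normE le_max lexx orbT. Qed.

Lemma cont_on_pair U V W (K : set U) (f : U -> V) (g : U -> W) :
  cont_on K f -> cont_on K g -> cont_on K (fun z => (f z, g z)).
Proof.
move=> cf cg z Kz e e0.
have [r r0 Hf] := cf z Kz e e0; have [s s0 Hg] := cg z Kz e e0.
exists (Num.min r s); first by rewrite lt_min r0.
move=> z' Kz'; rewrite lt_min => /andP[zr zs].
by rewrite norm_pair_lt /= Hf// Hg.
Qed.

Lemma cont_on_fst V W (K : set (V * W)) : cont_on K fst.
Proof.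
by move=> z _ e e0; exists e => // z' _; apply: le_lt_trans; exact: (norm_fst (z - z')).
Qed.

Lemma cont_on_snd V W (K : set (V * W)) : cont_on K snd.
Proof.
by move=> z _ e e0; exists e => // z' _; apply: le_lt_trans; exact: (norm_snd (z - z')).
Qed.

Lemma cont_on_cst U W (K : set U) (a : W) : cont_on K (fun=> a).
Proof. by move=> z _ e e0; exists 1 => // z' _ _; rewrite subrr normr0. Qed.

Lemma cont_on_id U (K : set U) : cont_on K id.
Proof. by move=> z _ e e0; exists e. Qed.

Lemma cont_onD U W (K : set U) (f g : U -> W) :
  cont_on K f -> cont_on K g -> cont_on K (fun z => f z + g z).
Proof.
move=> /within_cont_on cf /within_cont_on cg; apply/within_cont_on => z.
by apply: cvgD; [exact: cf|exact: cg].
Qed.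

Lemma cont_onN U W (K : set U) (f : U -> W) :
  cont_on K f -> cont_on K (fun z => - f z).
Proof.
by move=> /within_cont_on cf; apply/within_cont_on => z; apply: cvgN; exact: cf.
Qed.

Lemma cont_onB U W (K : set U) (f g : U -> W) :
  cont_on K f -> cont_on K g -> cont_on K (fun z => f z - g z).
Proof. by move=> cf cg; apply: cont_onD => //; exact: cont_onN. Qed.

Lemma cont_onM U (K : set U) (f g : U -> R) :
  cont_on K f -> cont_on K g -> cont_on K (fun z => f z * g z).
Proof.
move=> /within_cont_on cf /within_cont_on cg; apply/within_cont_on => z.
by apply: cvgM; [exact: cf|exact: cg].
Qed.

Lemma cont_onZ U W (K : set U) (f : U -> R) (g : U -> W) :
  cont_on K f -> cont_on K g -> cont_on K (fun z => f z *: g z).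
Proof.
move=> /within_cont_on cf /within_cont_on cg; apply/within_cont_on => z.
by apply: cvgZ; [exact: cf|exact: cg].
Qed.

Lemma cont_on_eq U W (K : set U) (f g : U -> W) :
  (forall z, K z -> f z = g z) -> cont_on K f -> cont_on K g.
Proof.
move=> fg cf z Kz e e0; have [r r0 H] := cf z Kz e e0.
by exists r => // z' Kz'; rewrite -!fg//; exact: H.
Qed.

Lemma cont_on_compact_image U W (K : set U) (f : U -> W) :
  compact K -> cont_on K f -> compact (f @` K).
Proof. by move=> cK /within_cont_on cf; exact: continuous_compact. Qed.

Lemma compact_rect (a b c d : R) :
  compact [set z : R * R | a <= z.1 <= b /\ c <= z.2 <= d].
Proof.
have -> : [set z : R * R | a <= z.1 <= b /\ c <= z.2 <= d] = `[a, b] `*` `[c, d].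
  by apply/seteqP; split => z /=; rewrite !in_itv.
by apply: compact_setX; exact: segment_compact.
Qed.

Lemma cont_on_itv (a b : R) (W : normedModType R) (f : R -> W) :
  cont_on [set t | a <= t <= b] f <-> {within `[a, b], continuous f}.
Proof.
have -> : [set t | a <= t <= b] = [set` `[a, b]].
  by apply/seteqP; split => z /=; rewrite in_itv.
by rewrite within_cont_on.
Qed.

(** The kinematic condition holds for positive times; continuity carries the Lipschitz bound to time
    0. *)
Lemma lip_extend0 (V : normedModType R) (T L : R) (phi : R -> V) :
  cont_on [set t | 0 <= t <= T] phi ->
  (forall t s, 0 < t <= T -> 0 < s <= T -> `|phi t - phi s| <= L * `|t - s|) ->
  forall t s, 0 <= t <= T -> 0 <= s <= T -> `|phi t - phi s| <= L * `|t - s|.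
Proof.
move=> cphi H.
have H0 t : 0 < t <= T -> `|phi t - phi 0| <= L * `|t - 0|.
  move=> /andP[t0 tT]; apply/ler_addgt0Pr => e e0.
  have L0 : 0 <= L.
    have th : 0 < t / 2 <= T by apply/andP; split; lra.
    have tt : 0 < t <= T by rewrite t0.
    have := le_trans (normr_ge0 _) (H t (t / 2) tt th).
    by rewrite pmulr_lge0// normr_gt0; lra.
  have zI : [set t | 0 <= t <= T] 0 by rewrite /= lexx/= ltW// (lt_le_trans t0).
  have [r r0 Hr] := cphi 0 zI e e0.
  pose s := Num.min (r / 2) t.
  have s0 : 0 < s by rewrite lt_min t0 andbT divr_gt0.
  have st : s <= t by rewrite ge_min lexx orbT.
  have sr : s < r by rewrite gt_min; apply/orP; left; lra.
  have sT : s <= T by exact: le_trans tT.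
  have h1 : `|phi 0 - phi s| < e.
    by apply: Hr; rewrite /= ?sT ?(ltW s0)// sub0r normrN gtr0_norm.
  have h2 : `|phi t - phi s| <= L * (t - s).
    by rewrite -[t - s]ger0_norm ?subr_ge0//; apply: H; apply/andP.
  have := ler_distD (phi s) (phi t) (phi 0); rewrite (distrC (phi s)) => h3.
  rewrite subr0 (gtr0_norm t0).
  have := mulr_ge0 L0 (ltW s0); lra.
move=> t s /andP[]; rewrite le_eqVlt => /predU1P[<-|t0] tT /andP[].
  rewrite le_eqVlt => /predU1P[<-|s0] sT; first by rewrite !subrr !normr0 mulr0.
  by rewrite distrC (distrC 0); apply: H0; rewrite s0.
rewrite le_eqVlt => /predU1P[<-|s0] sT; first by apply: H0; rewrite t0.
by apply: H; apply/andP.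
Qed.

End ContPair.

Section Ramp.
Variable R : realType.

(** A Lipschitz cut-off is enough: it is compared at two points, never differentiated. *)
Definition ramp (s : R) : R := Num.min 1 (Num.max 0 s).

Lemma ramp01 s : 0 <= ramp s <= 1.
Proof. by rewrite /ramp le_min ler01 le_max lexx /= ge_min lexx. Qed.

Lemma ramp0 s : s <= 0 -> ramp s = 0.
Proof. by move=> s0; rewrite /ramp (max_l s0) min_r. Qed.

Lemma ramp1 s : 1 <= s -> ramp s = 1.
Proof.
by move=> s1; rewrite /ramp max_r ?min_l// (le_trans ler01).
Qed.

Lemma ramp_id s : 0 <= s <= 1 -> ramp s = s.
Proof. by move=> /andP[s0 s1]; rewrite /ramp max_r ?min_r. Qed.

Lemma ramp_lip s s' : `|ramp s - ramp s'| <= `|s - s'|.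
Proof.
wlog ss : s s' / s <= s'.
  by move=> H; have [/H//|/ltW/H] := leP s s'; rewrite distrC (distrC s').
rewrite distrC (distrC s) [leRHS]ger0_norm ?subr_ge0//.
have [s0|s0] := leP s 0.
  rewrite (ramp0 s0) subr0 ger0_norm; last by case/andP: (ramp01 s').
  have [s'0|s'0] := leP s' 0; first by rewrite ramp0//; lra.
  by rewrite /ramp max_r ?(ltW s'0)// ge_min; apply/orP; right; lra.
have [s1|s1] := leP 1 s.
  by rewrite (ramp1 s1) ramp1 ?subrr ?normr0 ?subr_ge0//; lra.
rewrite (ramp_id (s := s)); last by apply/andP; split; lra.
have [s'1|s'1] := leP 1 s'; first by rewrite ramp1// ger0_norm; lra.
by rewrite ramp_id ?ger0_norm ?subr_ge0//; apply/andP; split; lra.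
Qed.

Lemma ramp_cont : cont_on setT (ramp : R -> R).
Proof.
by move=> s _ e e0; exists e => // s' _; apply: le_lt_trans; exact: ramp_lip.
Qed.

End Ramp.

(** * Classical flows and their boundary *)

Section FlowDef.
Variable R : realType.
Local Notation plane := (R * R)%type.
Variables (c : R -> R -> plane) (D : R -> set plane).

Definition spacetime : set (R * plane) :=
  [set z | 0 <= z.1 /\ closure (D z.1) z.2].

(** On the walls and at time 0 the functions [ft], [f1], [f2] are merely continuous extensions; that
    they differentiate f along a wall has to be proved. *)
Definition C1_field (f ft f1 f2 : R -> plane -> R) : Prop :=
  [/\ cont_on spacetime (fun z => f z.1 z.2),
      cont_on spacetime (fun z => ft z.1 z.2),
      cont_on spacetime (fun z => f1 z.1 z.2) &
      cont_on spacetime (fun z => f2 z.1 z.2)] /\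
  forall (t : R) (x : plane), 0 < t -> D t x ->
    [/\ is_derive t (1 : R) (fun s => f s x) (ft t x),
        is_derive x.1 (1 : R) (fun a => f t (a, x.2)) (f1 t x) &
        is_derive x.2 (1 : R) (fun b => f t (x.1, b)) (f2 t x)].

(** A solution for all times, the one to be refuted. The parameter derivative of the curve survives
    as a Lipschitz bound, which controls the number of squares needed to cover the boundary. *)
Record C1_flow (u1 u1t u11 u12 u2 u2t u21 u22 : R -> plane -> R) : Prop := {
  flow_curve : cont_on [set z : R * R | 0 <= z.1 /\ 0 <= z.2 <= 1]
                 (fun z => c z.1 z.2) ;
  flow_curve_lip : forall T : R, exists2 L : R, 0 <= L &
    forall t a b : R, 0 <= t <= T -> 0 <= a <= 1 -> 0 <= b <= 1 ->
      `|c t a - c t b| <= L * `|a - b| ;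
  flow_domain : forall t : R, 0 <= t -> fluid_domain (c t) (D t) ;
  flow_surface : forall t : R, 0 <= t -> surface_conditions (c t) ;
  flow_u1 : C1_field u1 u1t u11 u12 ;
  flow_u2 : C1_field u2 u2t u21 u22 ;
  flow_impermeable : forall t : R, 0 <= t -> impermeable (D t) (u1 t) (u2 t) ;
  flow_endpoints : forall t : R, 0 <= t -> endpoints_at_rest (u2 t) ;
  flow_div_curl : forall (t : R) (x : plane), 0 < t -> D t x ->
    u11 t x + u22 t x = 0 /\ u12 t x = u21 t x ;
  flow_kinematic : forall t a : R, 0 < t -> 0 <= a <= 1 ->
    is_derive t (1 : R) (fun s => (c s a).1) (u1 t (c t a)) /\
    is_derive t (1 : R) (fun s => (c s a).2) (u2 t (c t a))
}.

End FlowDef.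

Section Boundary.
Variable R : realType.
Local Notation plane := (R * R)%type.
Variables (c : R -> R -> plane) (D : R -> set plane).
Variables (u1 u1t u11 u12 u2 u2t u21 u22 : R -> plane -> R).
Hypothesis F : C1_flow c D u1 u1t u11 u12 u2 u2t u21 u22.

Definition velocity (v1 v2 : R -> plane -> R) t x : plane := (v1 t x, v2 t x).
Local Notation vel := (velocity u1 u2).
Local Notation B t := (bdry (D t)).
Local Notation K := (spacetime D).

Lemma flow_bdry (t : R) : 0 <= t -> B t = walls (R:=R) `|` c t @` `[0, 1].
Proof. by move=> t0; have [[]] := flow_domain F t0. Qed.

Lemma flow_open (t : R) : 0 <= t -> open (D t).
Proof. by move=> t0; have [[]] := flow_domain F t0. Qed.

Lemma flow_connected (t : R) : 0 <= t -> connected (D t).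
Proof. by move=> t0; have [[]] := flow_domain F t0. Qed.

Lemma flow_strip (t : R) (x : plane) : 0 <= t -> D t x -> 0 < x.1 < 1 /\ 0 < x.2.
Proof. by move=> t0; have [[_ _ _ + _] _] := flow_domain F t0 => /[apply]. Qed.

Lemma bdry_neq0 (t : R) : 0 <= t -> B t !=set0.
Proof.
move=> t0; rewrite flow_bdry//; exists (0, 0); left.
by split => /=; rewrite ?lexx ?ler01//; exact: Or31.
Qed.

Lemma spacetime_bdry (t : R) (y : plane) : 0 <= t -> B t y -> K (t, y).
Proof. by move=> t0 []. Qed.

Lemma spacetime_in (t : R) (x : plane) : 0 <= t -> D t x -> K (t, x).
Proof. by move=> t0 Dx; split => //=; exact: subset_closure. Qed.

(** The four pieces of the boundary share the parameter interval [0, 1]; every index from 3 on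
    stands for the bottom. *)
Definition bcurve (i : nat) (t s : R) : plane :=
  match i with 0 => c t s | 1 => (0, s) | 2 => (1, s) | _ => (s, 0) end.

Lemma bcurve_bdry (i : nat) (t s : R) : 0 <= t -> 0 <= s <= 1 -> B t (bcurve i t s).
Proof.
move=> t0 s01; rewrite flow_bdry//; case: i => [|[|[|i]]] /=.
- by right; exists s => //; rewrite /= in_itv.
- by left; split => //=; rewrite ?lexx ?ler01//; exact: Or31.
- by left; split => //=; rewrite ?lexx ?ler01//; exact: Or32.
- by left; split => //=; rewrite ?lexx ?ler01//; exact: Or33.
Qed.

Lemma bdry_bcurve (t : R) (y : plane) : 0 <= t -> B t y ->
  exists2 i, (i < 4)%N & exists2 s : R, 0 <= s <= 1 & y = bcurve i t s.
Proof.
move=> t0; rewrite flow_bdry//; case: y => y1 y2 [[/= h1 h2 []/= e]|[s /=]].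
- by exists 1%N => //; exists y2 => //; rewrite e.
- by exists 2%N => //; exists y2 => //; rewrite e.
- by exists 3%N => //; exists y1 => //; rewrite e.
- by rewrite in_itv /= => s01 <-; exists 0%N => //; exists s.
Qed.

Lemma bcurve_cont i :
  cont_on [set z : R * R | 0 <= z.1 /\ 0 <= z.2 <= 1] (fun z => bcurve i z.1 z.2).
Proof.
case: i => [|[|[|i]]] /=.
- exact: flow_curve F.
- by apply: cont_on_pair; [exact: cont_on_cst|exact: cont_on_snd].
- by apply: cont_on_pair; [exact: cont_on_cst|exact: cont_on_snd].
- by apply: cont_on_pair; [exact: cont_on_snd|exact: cont_on_cst].
Qed.

Definition lateral (T : R) : set (R * plane) := [set z | 0 <= z.1 <= T /\ B z.1 z.2].

(** Each of the four boundary pieces is a continuous image of a rectangle, so compactness is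
    available at the boundary before anything is known on how [D t] varies. *)
Lemma lateral_compact T : compact (lateral T).
Proof.
pose C0 := [set z : R * R | 0 <= z.1 <= T /\ 0 <= z.2 <= 1].
pose A i := (fun z : R * R => (z.1, bcurve i z.1 z.2)) @` C0.
have cA i : compact (A i).
  apply: cont_on_compact_image; first exact: compact_rect.
  apply: cont_on_pair; first exact: cont_on_fst.
  by apply: cont_onS (bcurve_cont i) => z [/andP[]].
have -> : lateral T = A 0%N `|` A 1%N `|` A 2%N `|` A 3%N.
  apply/seteqP; split => [[t y] [/= /andP[t0 tT] By]|].
    have [i i4 [s s01 ->]] := bdry_bcurve t0 By.
    have : A i (t, bcurve i t s) by exists (t, s) => //; split => //=; rewrite t0.
    by case: i i4 => [|[|[|[|i]]]]// _ h; [left; left; left|left; left; right|left; right|right].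
  have H i : A i `<=` lateral T.
    move=> _ [[t s] [/= tT s01] <-]; split => //=; apply: bcurve_bdry => //.
    by case/andP: tT.
  by move=> z [[[]|]|]; exact: H.
by do 3 (apply: compactU; last by []).
Qed.

Lemma lateral_spacetime T : lateral T `<=` K.
Proof. by move=> [t y] [/= /andP[t0 _]]; exact: spacetime_bdry. Qed.

Lemma near_bdry_unif (W : normedModType R) (f : R -> plane -> W) (T e : R) :
  cont_on K (fun z => f z.1 z.2) -> 0 < e ->
  exists2 r : R, 0 < r & forall (t : R) (x y : plane), 0 <= t <= T -> B t y -> closure (D t) x ->
    `|x - y| < r -> `|f t x - f t y| < e.
Proof.
move=> cf e0.
have [r r0 H] := cont_on_compact_unif (@lateral_compact T) (@lateral_spacetime T) cf e0.
exists r => // t x y /andP[t0 tT] By cx xy.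
rewrite distrC; apply: (H (t, y) (t, x)) => //=; first by split => //=; rewrite t0.
by rewrite norm_pair_lt /= subrr normr0 r0 distrC.
Qed.

Lemma near_bdry_bound (f : R -> plane -> R) (T : R) :
  cont_on K (fun z => f z.1 z.2) ->
  exists2 r : R, 0 < r & exists2 M : R, 0 < M & forall (t : R) (x : plane), 0 <= t <= T ->
    closure (D t) x -> dist (B t) x < r -> `|f t x| <= M.
Proof.
move=> cf; have [r r0 H] := near_bdry_unif T cf ltr01.
exists r => //.
have [M M0 HM] := cont_on_bounded (@lateral_compact T) (cont_onS (@lateral_spacetime T) cf).
exists (M + 1); first lra.
move=> t x tT cx dx; have t0 : 0 <= t by case/andP: tT.
have [y By xy] := dist_lt (bdry_neq0 t0) dx.
have := H t x y tT By cx xy; have : `|f t y| <= M by exact: (HM (t, y)).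
by have := ler_normD (f t x - f t y) (f t y); rewrite subrK; lra.
Qed.

Lemma velocity_cont : cont_on K (fun z => vel z.1 z.2).
Proof.
by apply: cont_on_pair; [have [[]] := flow_u1 F|have [[]] := flow_u2 F].
Qed.

(** The plane carries the maximum norm: its balls are squares and contain the corner through which
    two axis-parallel segments join x to z. Hence partial derivatives suffice. *)
Lemma C1_field_lip f ft f1 f2 (t : R) (x z : plane) (M d : R) : C1_field D f ft f1 f2 -> 0 < t ->
  (forall w, `|x - w| < d -> [/\ D t w, `|f1 t w| <= M & `|f2 t w| <= M]) ->
  `|x - z| < d -> `|f t x - f t z| <= 2 * M * `|x - z|.
Proof.
move=> [_ Hf] t0 H xz.
have M0 : 0 <= M.
  have [_ + _] : [/\ D t x, `|f1 t x| <= M & `|f2 t x| <= M].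
    by apply: H; rewrite subrr normr0 (le_lt_trans _ xz).
  exact: le_trans.
case: x H xz => x1 x2; case: z => z1 z2 H.
rewrite norm_pair_lt /= => /andP[xz1 xz2].
have L1 : `|f t (x1, x2) - f t (z1, x2)| <= M * `|x1 - z1|.
  have in1 a : `|a - x1| <= `|z1 - x1| -> `|(x1, x2) - (a, x2)| < d.
    move=> ha; rewrite norm_pair_lt /= subrr normr0; apply/andP; split.
      by apply: le_lt_trans xz1; rewrite distrC (distrC x1).
    exact: le_lt_trans xz2.
  have [a ax|a [ax _ e]] := @mean_value R (fun a => f t (a, x2)) (fun a => f1 t (a, x2)) x1 z1.
    by move=> _; have [Dw _ _] := H _ (in1 a ax); have [_ h _] := Hf t (a, x2) t0 Dw.
  rewrite distrC e normrM (distrC z1) ler_wpM2r//.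
  by have [] := H _ (in1 a ax).
have L2 : `|f t (z1, x2) - f t (z1, z2)| <= M * `|x2 - z2|.
  have in2 a : `|a - x2| <= `|z2 - x2| -> `|(x1, x2) - (z1, a)| < d.
    move=> ha; rewrite norm_pair_lt /= xz1/=.
    by apply: le_lt_trans xz2; rewrite distrC (distrC x2).
  have [a ax|a [ax _ e]] := @mean_value R (fun a => f t (z1, a)) (fun a => f2 t (z1, a)) x2 z2.
    by move=> _; have [Dw _ _] := H _ (in2 a ax); have [_ _ h] := Hf t (z1, a) t0 Dw.
  rewrite distrC e normrM (distrC z2) ler_wpM2r//.
  by have [] := H _ (in2 a ax).
have := ler_distD (f t (z1, x2)) (f t (x1, x2)) (f t (z1, z2)).
have : M * `|x1 - z1| <= M * `|(x1, x2) - (z1, z2)|.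
  by rewrite ler_wpM2l//; exact: (norm_fst ((x1, x2) - (z1, z2))).
have : M * `|x2 - z2| <= M * `|(x1, x2) - (z1, z2)|.
  by rewrite ler_wpM2l//; exact: (norm_snd ((x1, x2) - (z1, z2))).
lra.
Qed.

Lemma curve_velocity (t t' a : R) : 0 < t -> 0 < t' -> 0 <= a <= 1 -> forall e : R,
  (forall s : R, `|s - t| <= `|t' - t| -> `|s - t'| <= `|t' - t| -> `|vel s (c s a) - vel t (c t a)| <= e) ->
  `|c t' a - (c t a + (t' - t) *: vel t (c t a))| <= e * `|t' - t|.
Proof.
move=> t0 t'0 a01 e H.
have pos s : `|s - t| <= `|t' - t| -> `|s - t'| <= `|t' - t| -> 0 < s.
  by case: (leP t t') => tt'; rewrite !ler_distl; [rewrite ger0_norm|rewrite ltr0_norm]; lra.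
rewrite norm_pair_le /=; apply/andP; split.
  have [s h1 h2|s [h1 h2 es]] := @mean_value R (fun s => (c s a).1) (fun s => u1 s (c s a)) t t'.
    by have [] := flow_kinematic F (pos s h1 h2) a01.
  rewrite opprD addrA es -[_ *: _]/(_ * _) mulrC -mulrBr normrM mulrC ler_wpM2r//.
  by apply: le_trans (H s h1 h2); exact: (norm_fst (vel s (c s a) - vel t (c t a))).
have [s h1 h2|s [h1 h2 es]] := @mean_value R (fun s => (c s a).2) (fun s => u2 s (c s a)) t t'.
  by have [] := flow_kinematic F (pos s h1 h2) a01.
rewrite opprD addrA es -[_ *: _]/(_ * _) mulrC -mulrBr normrM mulrC ler_wpM2r//.
by apply: le_trans (H s h1 h2); exact: (norm_snd (vel s (c s a) - vel t (c t a))).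
Qed.

Lemma curve_vel_cont : cont_on [set z : R * R | 0 <= z.1 /\ 0 <= z.2 <= 1]
  (fun z => vel z.1 (c z.1 z.2)).
Proof.
apply: (@cont_on_comp _ _ _ _ _ K (fun z : R * R => (z.1, c z.1 z.2)) (fun z => vel z.1 z.2)).
- by move=> [t s] /= [t0 s01]; apply: spacetime_bdry => //; exact: (bcurve_bdry 0).
- by apply: cont_on_pair; [exact: cont_on_fst|exact: flow_curve F].
- exact: velocity_cont.
Qed.

Lemma lateral_wall_rest (t s : R) : 0 <= t -> 0 <= s <= 1 ->
  u1 t (0, s) = 0 /\ u1 t (1, s) = 0.
Proof.
move=> t0 s01; split.
  by have [+ _] := flow_impermeable F t0 (@bcurve_bdry 1 t s t0 s01); apply; left.
by have [+ _] := flow_impermeable F t0 (@bcurve_bdry 2 t s t0 s01); apply; right.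
Qed.

Lemma bottom_rest (t s : R) : 0 <= t -> 0 <= s <= 1 -> u2 t (s, 0) = 0.
Proof.
move=> t0 s01.
by have [_] := flow_impermeable F t0 (@bcurve_bdry 3 t s t0 s01); apply.
Qed.

(* A wall is mapped onto itself by x |-> x + h u(t, x) since its endpoints are
   at rest; this makes wall points as good as surface particles. *)
Lemma wall_step (v : R -> R) (k s : R) : cont_on [set r : R | 0 <= r <= 1] v ->
  v 0 = 0 -> v 1 = 0 -> 0 <= s <= 1 -> exists2 r : R, 0 <= r <= 1 & r + k * v r = s.
Proof.
move=> cv v0 v1 s01.
have cg : {within `[0, 1], continuous (fun r => r + k * v r)}.
  apply/cont_on_itv; apply: cont_onD; first exact: cont_on_id.
  by apply: cont_onM => //; exact: cont_on_cst.
have [|r r01 e] := @IVT R _ 0 1 s ler01 cg.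
- by rewrite v0 v1 !mulr0 !addr0 min_l ?max_r.
- by exists r => //; move: r01; rewrite in_itv.
Qed.

End Boundary.

(** * Short-time motion of the boundary *)

Section Step.
Variable R : realType.
Local Notation plane := (R * R)%type.
Variables (c : R -> R -> plane) (D : R -> set plane).
Variables (u1 u1t u11 u12 u2 u2t u21 u22 : R -> plane -> R).
Hypothesis F : C1_flow c D u1 u1t u11 u12 u2 u2t u21 u22.
Local Notation vel := (velocity u1 u2).
Local Notation B t := (bdry (D t)).
Local Notation K := (spacetime D).

(** A surface point is carried along by the kinematic condition, up to o(h). A wall point is reached
    exactly, by [wall_step], because the normal velocity vanishes on the wall. Negative h is
    allowed, for comparisons backwards in time. *)
Lemma boundary_step (T eta : R) : 0 < eta -> exists2 h0 : R, 0 < h0 &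
  forall t h : R, 0 < t <= T -> 0 < t + h <= T -> `|h| < h0 ->
  forall y', B (t + h) y' ->
  exists2 y, B t y & `|y' - (y + h *: vel t y)| <= eta * `|h|.
Proof.
move=> eta0.
have sub : [set z : R * R | 0 <= z.1 <= T /\ 0 <= z.2 <= 1] `<=`
           [set z : R * R | 0 <= z.1 /\ 0 <= z.2 <= 1].
  by move=> z [/andP[z0 _] z1]; split.
have [r r0 H] := cont_on_compact_unif (@compact_rect R 0 T 0 1) sub (curve_vel_cont F) eta0.
exists r => // t h /andP[t0 tT] /andP[th0 thT] hr y' By'.
have [i i4 [s s01 ->]] := bdry_bcurve F (ltW th0) By'.
have tn := ltW t0.
have u2c i0 : (0 < i0)%N -> cont_on [set q : R | 0 <= q <= 1] (fun q => u2 t (bcurve c i0 t q)).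
  move=> i00; apply: (@cont_on_comp _ _ _ _ _ K (fun q : R => (t, bcurve c i0 t q)) (fun z => u2 z.1 z.2)).
  - by move=> q q01; apply: spacetime_bdry => //; exact: (bcurve_bdry F).
  - apply: cont_on_pair; first exact: cont_on_cst.
    case: i0 i00 => [//|[|[|i0]]] _ /=.
    + by apply: cont_on_pair; [exact: cont_on_cst|exact: cont_on_id].
    + by apply: cont_on_pair; [exact: cont_on_cst|exact: cont_on_id].
    + by apply: cont_on_pair; [exact: cont_on_id|exact: cont_on_cst].
  - by have [[]] := flow_u2 F.
have u1c : cont_on [set q : R | 0 <= q <= 1] (fun q => u1 t (q, 0)).
  apply: (@cont_on_comp _ _ _ _ _ K (fun q : R => (t, (q, 0))) (fun z => u1 z.1 z.2)).
  - by move=> q q01; apply: spacetime_bdry => //; exact: (bcurve_bdry F 3).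
  - apply: cont_on_pair; first exact: cont_on_cst.
    by apply: cont_on_pair; [exact: cont_on_id|exact: cont_on_cst].
  - by have [[]] := flow_u1 F.
have i01 : 0 <= (0 : R) <= 1 by rewrite lexx ler01.
have i11 : 0 <= (1 : R) <= 1 by rewrite lexx ler01.
have [e0 e1] := flow_endpoints F tn.
case: i i4 By' => [|[|[|[|i]]]]// _ By' /=.
- exists (c t s); first exact: (bcurve_bdry F 0).
  have := @curve_velocity _ _ _ _ _ _ _ _ _ _ _ F t (t + h) s t0 th0 s01 eta.
  rewrite (addrC t h) addrK; apply => q q1 q2; apply/ltW.
  rewrite distrC; apply: (H (t, s) (q, s)) => /=.
  + by split => //=; rewrite tn.
  + split => //=; move: q1 q2; rewrite !ler_distl.
    by have [h0|h0] := leP 0 h; [rewrite ger0_norm|rewrite ltr0_norm]; lra.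
  + by rewrite norm_pair_lt /= subrr normr0 r0 distrC (le_lt_trans q1).
- have [|||q q01 qE] := @wall_step R (fun q => u2 t (0, q)) h s _ _ _ s01.
  + exact: (u2c 1%N).
  + exact: (bottom_rest F).
  + exact: e0.
  exists (0, q); first exact: (bcurve_bdry F 1).
  rewrite norm_pair_le /= -qE (proj1 (lateral_wall_rest F tn q01)) scaler0 addr0 !subrr normr0.
  by rewrite mulr_ge0// ltW.
- have [|||q q01 qE] := @wall_step R (fun q => u2 t (1, q)) h s _ _ _ s01.
  + exact: (u2c 2%N).
  + exact: (bottom_rest F).
  + exact: e1.
  exists (1, q); first exact: (bcurve_bdry F 2).
  rewrite norm_pair_le /= -qE (proj2 (lateral_wall_rest F tn q01)) scaler0 addr0 !subrr normr0.
  by rewrite mulr_ge0// ltW.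
- have [|||q q01 qE] := @wall_step R (fun q => u1 t (q, 0)) h s _ _ _ s01.
  + exact: u1c.
  + exact: (proj1 (lateral_wall_rest F tn i01)).
  + exact: (proj2 (lateral_wall_rest F tn i01)).
  exists (q, 0); first exact: (bcurve_bdry F 3).
  rewrite norm_pair_le /= -qE (bottom_rest F tn q01) scaler0 addr0 !subrr normr0.
  by rewrite mulr_ge0// ltW.
Qed.

Lemma bcurve_time_lip (T : R) : exists2 U : R, 0 < U &
  forall (i : nat) (t s a : R), 0 <= t <= T -> 0 <= s <= T -> 0 <= a <= 1 ->
    `|bcurve c i t a - bcurve c i s a| <= U * `|t - s|.
Proof.
have LC : compact (lateral D T) by exact: (@lateral_compact _ _ _ _ _ _ _ _ _ _ _ F T).
have [[U1c _ _ _] _] := flow_u1 F; have [[U2c _ _ _] _] := flow_u2 F.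
have [M1 M10 H1] := cont_on_bounded LC (cont_onS (@lateral_spacetime _ _ _) U1c).
have [M2 M20 H2] := cont_on_bounded LC (cont_onS (@lateral_spacetime _ _ _) U2c).
exists (M1 + M2); first by rewrite addr_gt0.
move=> i t s a tT sT a01; case: i => [|i]; last first.
  have -> : bcurve c i.+1 t a = bcurve c i.+1 s a by case: i => [|[]].
  by rewrite subrr normr0 mulr_ge0// addr_ge0// ltW.
rewrite /=; move: t s tT sT; apply: lip_extend0.
  apply: (@cont_on_comp _ _ _ _ _ _ (fun t : R => (t, a)) _ _ _ (flow_curve F)).
    by move=> t /= /andP[].
  by apply: cont_on_pair; [exact: cont_on_id|exact: cont_on_cst].
move=> t s /andP[t0 tT] /andP[s0 sT].
have pos q : `|q - s| <= `|t - s| -> `|q - t| <= `|t - s| -> 0 < q <= T.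
  by rewrite !ler_distl; have [ts|ts] := leP s t; [rewrite ger0_norm|rewrite ltr0_norm]; lra.
have bd q : 0 < q <= T -> `|u1 q (c q a)| <= M1 /\ `|u2 q (c q a)| <= M2.
  move=> /andP[q0 qT].
  have L : lateral D T (q, c q a).
    by split => /=; [rewrite ltW|apply: (bcurve_bdry F 0) => //; exact: ltW].
  by split; [exact: (H1 _ L)|exact: (H2 _ L)].
rewrite norm_pair_le /=; apply/andP; split.
  have [q q1 q2|q [q1 q2 ->]] := @mean_value R (fun q => (c q a).1) (fun q => u1 q (c q a)) s t.
    by have /andP[q0 _] := pos q q1 q2; have [] := flow_kinematic F q0 a01.
  have [h _] := bd q (pos q q1 q2).
  by rewrite normrM ler_wpM2r// (le_trans h)// lerDl ltW.
have [q q1 q2|q [q1 q2 ->]] := @mean_value R (fun q => (c q a).2) (fun q => u2 q (c q a)) s t.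
  by have /andP[q0 _] := pos q q1 q2; have [] := flow_kinematic F q0 a01.
have [_ h] := bd q (pos q q1 q2).
by rewrite normrM ler_wpM2r// (le_trans h)// lerDr ltW.
Qed.

Lemma dist_bdry_time_lip (T : R) : exists2 U : R, 0 < U &
  forall (t s : R) (x : plane), 0 <= t <= T -> 0 <= s <= T ->
    dist (B t) x <= dist (B s) x + U * `|t - s|.
Proof.
have [U U0 H] := bcurve_time_lip T; exists U => // t s x tT sT.
have [t0 s0] : 0 <= t /\ 0 <= s by case/andP: tT; case/andP: sT.
rewrite -lerBlDr; apply: dist_ge; first exact: bdry_neq0 F _ s0.
move=> y By; have [i _ [a a01 ->]] := bdry_bcurve F s0 By.
rewrite lerBlDr; apply: le_trans (dist_le x (bcurve_bdry F i t0 a01)) _.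
apply: le_trans (ler_distD (bcurve c i s a) _ _) _.
by rewrite lerD2l distrC; exact: H.
Qed.

(* Up to o(h), the nearest boundary point y is joined to x by a segment in D(t),
   so u(t, x) - u(t, y) = O(dist); other boundary points, possibly seen across an
   air gap, are farther away by O(h) and do not matter. *)
Lemma distance_step (T : R) : exists2 d0 : R, 0 < d0 & exists2 L : R, 0 < L &
  (forall (t : R) (x : plane), 0 <= t <= T -> D t x -> dist (B t) x < d0 -> `|vel t x| <= L) /\
  forall eta : R, 0 < eta -> exists2 h0 : R, 0 < h0 &
  forall (t h : R) (x : plane), 0 < t <= T -> 0 < t + h <= T -> `|h| < h0 ->
    D t x -> dist (B t) x < d0 ->
    dist (B t) x - `|h| * (L * dist (B t) x + eta) <= dist (B (t + h)) (x + h *: vel t x).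
Proof.
have [[U1c _ U11c U12c] _] := flow_u1 F; have [[U2c _ U21c U22c] _] := flow_u2 F.
have [r1 r10 [M1 M10 H1]] := near_bdry_bound F T U1c.
have [r2 r20 [M2 M20 H2]] := near_bdry_bound F T U2c.
have [r3 r30 [M3 M30 H3]] := near_bdry_bound F T U11c.
have [r4 r40 [M4 M40 H4]] := near_bdry_bound F T U12c.
have [r5 r50 [M5 M50 H5]] := near_bdry_bound F T U21c.
have [r6 r60 [M6 M60 H6]] := near_bdry_bound F T U22c.
pose r := Num.min (Num.min (Num.min r1 r2) (Num.min r3 r4)) (Num.min r5 r6).
have rp : [/\ 0 < r, r <= r1, r <= r2 & r <= r3] /\ [/\ r <= r4, r <= r5 & r <= r6].
  by rewrite /r !lt_min r10 r20 r30 r40 r50 r60 !ge_min !lexx !orbT.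
case: rp => -[r0 rr1 rr2 rr3] [rr4 rr5 rr6].
pose L := 2 * (M1 + M2 + M3 + M4 + M5 + M6).
have [LM1 LM2] : 2 * (M3 + M4) <= L /\ 2 * (M5 + M6) <= L by rewrite /L; split; lra.
exists (r / 2); first by rewrite divr_gt0.
exists L; first by rewrite /L; lra.
have velb t x : 0 <= t <= T -> closure (D t) x -> dist (B t) x < r / 2 -> `|vel t x| <= L / 2.
  move=> tT cx dx.
  rewrite norm_pair_le /=; apply/andP; split.
    by have := H1 t x tT cx; rewrite /L => h; have := h _; lra.
  by have := H2 t x tT cx; rewrite /L => h; have := h _; lra.
split; first by move=> t x tT Dx dx; apply: le_trans (velb t x tT (subset_closure Dx) dx) _; rewrite /L; lra.
move=> eta eta0.
have eta40 : 0 < eta / 4 by lra.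
have [h1 h10 Hb] := boundary_step T eta40.
have [q q0 Hq] := near_bdry_unif F T (velocity_cont F) eta40.
have L0 : 0 < L by rewrite /L; lra.
pose W := 3 * L + eta.
have W0 : 0 < W by rewrite /W; lra.
exists (Num.min h1 (q / W)); first by rewrite lt_min h10 divr_gt0.
move=> t h x /andP[t0 tT] thT; rewrite lt_min => /andP[hh1 hq] Dx dx.
have tI : 0 <= t <= T by rewrite ltW.
have tn := ltW t0; have B0 := bdry_neq0 F tn.
have oD := flow_open F tn.
set d := dist (B t) x.
have d0 : 0 < d by exact: dist_gt0.
have thn : 0 <= t + h by case/andP: thT => /ltW.
apply: dist_ge; first exact: bdry_neq0 F _ thn.
move=> y' By'.
have [|y By yy'] := Hb t h _ thT hh1 y' By'; first by rewrite t0.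
have velx := velb t x tI (subset_closure Dx) dx.
have [hz|hz] := eqVneq h 0.
  rewrite hz normr0 mul0r subr0 scale0r addr0.
  move: yy'; rewrite hz scale0r addr0 normr0 mulr0 normr_le0 subr_eq0 => /eqP ->.
  exact: dist_le.
have nh0 : 0 < `|h| by rewrite normr_gt0.
have key : `|vel t x - vel t y| <= L * d + eta / 2 ->
    d - `|h| * (L * d + eta) <= `|x + h *: vel t x - y'|.
  move=> hv.
  have e1 : x - y = (x + h *: vel t x - (y + h *: vel t y)) - (h *: vel t x - h *: vel t y).
    by rewrite opprD addrACA addrK.
  have : `|x - y| <= `|x + h *: vel t x - y'| + `|y' - (y + h *: vel t y)| + `|h| * `|vel t x - vel t y|.
    rewrite {1}e1 -scalerBr; apply: le_trans (ler_normB _ _) _; rewrite normrZ lerD2r.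
    exact: ler_distD.
  have := dist_le x By; rewrite -/d.
  have : `|h| * `|vel t x - vel t y| <= `|h| * (L * d + eta / 2) by rewrite ler_pM2l.
  have := mulr_gt0 nh0 eta0; move: yy'; clear; lra.
have vely : `|vel t y| <= L / 2.
  have dy : dist (B t) y = 0 by exact: dist0_boundary.
  by apply: (velb t y tI); [case: By|rewrite dy divr_gt0].
(* Both points move with speed at most L / 2, so a boundary point that is farther than d by W times
   the length of h cannot come closer than d. *)
have [far|near] := leP (d + W * `|h|) `|x - y|.
  have e1 : x - y = (x + h *: vel t x - (y + h *: vel t y)) - (h *: vel t x - h *: vel t y).
    by rewrite opprD addrACA addrK.
  have : `|x - y| <= `|x + h *: vel t x - y'| + `|y' - (y + h *: vel t y)| + `|h| * `|vel t x - vel t y|.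
    rewrite {1}e1 -scalerBr; apply: le_trans (ler_normB _ _) _; rewrite normrZ lerD2r.
    exact: ler_distD.
  have : `|h| * `|vel t x - vel t y| <= `|h| * L.
    by rewrite ler_pM2l//; apply: le_trans (ler_normB _ _) _; rewrite [L]splitr lerD.
  have := mulr_ge0 (ltW nh0) (mulr_ge0 (ltW L0) (ltW d0)).
  have := mulr_gt0 nh0 eta0; have := mulr_gt0 nh0 L0.
  move: far yy'; rewrite /W; clear; lra.
apply: key.
have dW : 0 < d + W * `|h| by rewrite addr_gt0// mulr_gt0.
(* The point z of the segment from x to y lies in the ball of radius d around x, hence in the fluid,
   where the Lipschitz bound applies. From z to y there remains a length O(h), handled by uniform
   continuity at the boundary. *)
pose th := d / (d + W * `|h|).
have th01 : 0 < th < 1.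
  by rewrite /th divr_gt0//= ltr_pdivrMr// mul1r ltrDl mulr_gt0.
case/andP: th01 => th0 th1.
have thE : th * (d + W * `|h|) = d by rewrite /th divfK// gt_eqF.
pose z := x + th *: (y - x).
have xz : `|x - z| < d.
  have -> : x - z = - (th *: (y - x)) by rewrite /z opprD addrA subrr add0r.
  by rewrite normrN normrZ gtr0_norm// distrC -thE ltr_pM2l.
have zy : `|z - y| < q.
  have -> : z - y = - ((1 - th) *: (y - x)).
    by rewrite /z scalerBl scale1r !opprB [LHS]addrAC [RHS]addrC.
  rewrite normrN normrZ gtr0_norm ?subr_gt0// distrC.
  have : (1 - th) * `|x - y| <= (1 - th) * (d + W * `|h|) by rewrite ler_pM2l ?subr_gt0// ltW.
  have := thE; move: hq; rewrite ltr_pdivlMr// mulrC; clear; lra.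
have Dball w : `|x - w| < d -> D t w by exact: in_ball_open (lexx _).
have bnd w (f : R -> plane -> R) r' M : `|x - w| < d -> r <= r' ->
    (forall t x, 0 <= t <= T -> closure (D t) x -> dist (B t) x < r' -> `|f t x| <= M) ->
    `|f t w| <= M.
  move=> xw rr'; apply => //; first exact/subset_closure/Dball.
  have := dist_lip w x B0; rewrite distrC -/d; move: xw dx rr'; rewrite -/d; clear; lra.
have lip1 : `|u1 t x - u1 t z| <= 2 * (M3 + M4) * `|x - z|.
  apply: (C1_field_lip (flow_u1 F) t0) xz => w xw; split; first exact: Dball.
  - by apply: (@le_trans _ _ M3); [exact: (bnd _ _ _ _ xw rr3)|rewrite lerDl ltW].
  - by apply: (@le_trans _ _ M4); [exact: (bnd _ _ _ _ xw rr4)|rewrite lerDr ltW].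
have lip2 : `|u2 t x - u2 t z| <= 2 * (M5 + M6) * `|x - z|.
  apply: (C1_field_lip (flow_u2 F) t0) xz => w xw; split; first exact: Dball.
  - by apply: (@le_trans _ _ M5); [exact: (bnd _ _ _ _ xw rr5)|rewrite lerDl ltW].
  - by apply: (@le_trans _ _ M6); [exact: (bnd _ _ _ _ xw rr6)|rewrite lerDr ltW].
have vxz : `|vel t x - vel t z| <= L * d.
  rewrite norm_pair_le /=; apply/andP; split.
  - by apply: le_trans lip1 _; apply: ler_pM => //; [rewrite mulr_ge0// addr_ge0 ?(ltW M30) ?(ltW M40)|exact: ltW].
  - by apply: le_trans lip2 _; apply: ler_pM => //; [rewrite mulr_ge0// addr_ge0 ?(ltW M50) ?(ltW M60)|exact: ltW].
have vzy : `|vel t z - vel t y| < eta / 4.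
  by apply: Hq => //; exact/subset_closure/Dball.
have := ler_distD (vel t z) (vel t x) (vel t y); move: vxz vzy eta0; clear; lra.
Qed.
End Step.

(** * Persistence of the fluid domain *)

Section NoDrop.
Variable R : realType.
Local Notation plane := (R * R)%type.
Variables (c : R -> R -> plane) (D : R -> set plane).
Variables (u1 u1t u11 u12 u2 u2t u21 u22 : R -> plane -> R).
Hypothesis F : C1_flow c D u1 u1t u11 u12 u2 u2t u21 u22.
Local Notation vel := (velocity u1 u2).
Local Notation B t := (bdry (D t)).
Local Notation K := (spacetime D).

Lemma ball_dist (E : set plane) (x : plane) (r : R) : open E -> bdry E !=set0 ->
  (forall y, `|x - y| < r -> E y) -> r <= dist (bdry E) x.
Proof.
move=> /interior_id oE B0 H; apply: dist_ge => // y [_ nE].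
by rewrite leNgt; apply/negP => /H; rewrite -oE.
Qed.

(** Off its endpoints the surface avoids the walls, so by compactness it keeps a positive distance
    from z over [0, T]. The part of a ball inside the open strip is convex, meets the fluid, and
    does not meet its boundary. *)
Lemma wall_box (T : R) (z : plane) : walls z -> z != (0, 1) -> z != (1, 1) ->
  exists2 r : R, 0 < r & forall (t : R) (x : plane), 0 <= t <= T ->
    `|z - x| < r -> 0 < x.1 < 1 -> 0 < x.2 -> D t x.
Proof.
move=> wz z0 z1; have [T0|T0] := ltP T 0.
  by exists 1 => // t x /andP[t0 tT]; have := le_lt_trans (le_trans t0 tT) T0; rewrite ltxx.
pose S := [set q : R * R | 0 <= q.1 <= T /\ 0 <= q.2 <= 1].
have S0 : S !=set0 by exists (0, 0); split => //=; rewrite lexx ?ler01.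
have cf : cont_on S (fun q => `|z - c q.1 q.2|).
  apply: (@cont_on_comp _ _ _ _ _ setT (fun q : R * R => z - c q.1 q.2) (fun w => `|w|)) => //.
    apply: cont_onB; first exact: cont_on_cst.
    by apply: cont_onS (flow_curve F) => q [/andP[]].
  move=> w _ e e0; exists e => // w' _; apply: le_lt_trans.
  exact: ler_dist_dist.
have [[t0 a0] /set_mem [/= t0T a01] min] := compact_EVT_min S0 (@compact_rect R 0 T 0 1)
  (proj2 (within_cont_on _ _) cf).
have t00 : 0 <= t0 by case/andP: t0T.
exists `|z - c t0 a0|.
  rewrite normr_gt0 subr_eq0; apply/eqP => zc.
  have [e0 e1 _] := flow_surface F t00.
  have [_ nw] := flow_domain F t00.
  case/andP: (a01); rewrite le_eqVlt => /predU1P[az|a00].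
    by move: z0; rewrite zc -az e0 eqxx.
  rewrite le_eqVlt => /predU1P[az|a0l].
    by move: z1; rewrite zc az e1 eqxx.
  by apply: (nw a0); [rewrite a00|rewrite -zc].
move=> t x tT zx x1 x2; have tn : 0 <= t by case/andP: tT.
pose C := [set x : plane | [/\ `|z - x| < `|z - c t0 a0|, 0 < x.1 < 1 & 0 < x.2]].
apply: (@connected_in_open _ _ (D t) C) => //.
- exact: flow_open F _ tn.
- apply: convex_connected => p q s [p0 p1 p2] [q0 q1 q2] s01; split => /=.
  + exact: norm_convex.
  + have := @norm_convex _ R^o p.1 q.1 (1/2) s (1/2) s01.
    rewrite !ltr_distl => H; have {H} := H _ _.
    by move=> H; have : 1/2 - 1/2 < p.1 + s *: (q.1 - p.1) < 1/2 + 1/2; [lra|lra].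
  + case/andP: s01 => s0 s1; rewrite -[_ *: _]/(_ * _).
    have [->|s_neq0] := eqVneq s 0; first by rewrite mul0r addr0.
    have : 0 < s * q.2 by rewrite mulr_gt0// lt_def s_neq0.
    have : 0 <= (1 - s) * p.2 by rewrite mulr_ge0 ?subr_ge0// ltW.
    by lra.
- move=> y [y0 y1 y2]; rewrite -/(bdry (D t)) (flow_bdry F tn) => -[[_ _]|[a]] /=.
    by move=> [] e; move: y1 y2; rewrite ?e ltxx ?andbF.
  rewrite in_itv /= => a01' ya; move: y0; rewrite ltNge; apply/negP/negPn.
  by rewrite -ya; apply: (min (t, a)); apply/mem_set.
- have zB : B t z by rewrite (flow_bdry F tn); left.
  have := proj1 (closure_normP _ _) (proj1 zB) `|z - c t0 a0|.
  case.
    rewrite normr_gt0 subr_eq0; apply/eqP => zc.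
    by move: zx; rewrite zc subrr normr0 ltNge normr_ge0.
  by move=> y Dy zy; exists y => //; have [] := flow_strip F tn Dy.
Qed.

(** A point just above the bottom is in the fluid at all times; being joined to it identifies the
    fluid among the components of the complement of the boundary. *)
Lemma base_point (T : R) : exists b : plane, exists2 r : R, 0 < r &
  forall t : R, 0 <= t <= T -> D t b /\ r <= dist (B t) b.
Proof.
pose z : plane := (1/2, 0).
have [|||r r0 H] := @wall_box T z.
- by split => /=; [lra|rewrite lexx ler01|exact: Or33].
- by apply/eqP => -[]; lra.
- by apply/eqP => -[]; lra.
pose q := Num.min r 1 / 2.
have q0 : 0 < q by rewrite divr_gt0// lt_min r0 ltr01.
have q1 : q <= 1/2 by rewrite /q ler_pM2r ?ge_min ?lexx ?orbT// invr_gt0.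
have qr : 2 * q <= r by rewrite /q mulrC divfK ?gt_eqF// ge_min lexx.
have bal t : 0 <= t <= T -> forall y, `|((1/2, q) : plane) - y| < q -> D t y.
  move=> tT y; rewrite norm_pair_lt /= !ltr_distl => /andP[y1 y2]; apply: H => //.
  + by rewrite norm_pair_lt /= !ltr_distl; apply/andP; split; lra.
  + lra.
  + lra.
exists (1/2, q), q => // t tT; split; first by apply: bal => //; rewrite subrr normr0.
have tn : 0 <= t by case/andP: tT.
apply: ball_dist; [exact: flow_open F _ tn|exact: bdry_neq0 F _ tn|exact: bal].
Qed.

Variables (b x : plane) (cap : R).

(* [clearance t] is the width of the widest connected corridor of the domain
   joining x to the base point b. As boundary points move with the flow, it decays
   at most exponentially; so a point far from the boundary cannot leave the domain
   abruptly, although D(t) is not assumed to vary continuously. *)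
Definition clearances t : set R := [set r | r <= cap /\
  exists C, [/\ connected C, C b, C x & forall y, C y -> r <= dist (B t) y]].

Definition clearance t := sup (clearances t).

Hypothesis cap0 : 0 < cap.

Lemma clearances0 (t : R) : 0 <= t -> clearances t 0.
Proof.
move=> t0; split; first exact: ltW.
exists setT; split => //; first exact: convex_connected.
by move=> y _; apply: dist_ge0; exact: bdry_neq0 F _ t0.
Qed.

Lemma clearances_sup (t : R) : 0 <= t -> has_sup (clearances t).
Proof.
by move=> t0; split; [exists 0; exact: clearances0|exists cap => r []].
Qed.

Lemma clearance_ge (t r : R) : 0 <= t -> clearances t r -> r <= clearance t.
Proof. by move=> t0; apply: sup_upper_bound; exact: clearances_sup. Qed.

Lemma clearance_lt (t r : R) : 0 <= t -> r < clearance t ->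
  exists C, [/\ connected C, C b, C x & forall y, C y -> r <= dist (B t) y].
Proof.
move=> t0 rm; have e0 : 0 < clearance t - r by rewrite subr_gt0.
have [s [_ [C [cC Cb Cx Cs]]] rs] := sup_adherent e0 (clearances_sup t0).
exists C; split => // y /Cs; apply: le_trans; rewrite ltW//.
by move: rs; rewrite -/(clearance t) opprB addrC subrK.
Qed.

Lemma clearance_ge0 (t : R) : 0 <= t -> 0 <= clearance t.
Proof. by move=> t0; apply: clearance_ge => //; exact: clearances0. Qed.

Lemma clearance_le_cap (t : R) : 0 <= t -> clearance t <= cap.
Proof.
by move=> t0; apply: ge_sup => [|r []//]; exists 0; exact: clearances0.
Qed.

Lemma clearance_gt0 (t : R) : 0 <= t -> D t b -> D t x -> 0 < clearance t.
Proof.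
move=> t0 Db Dx.
have [r r0 [C [cC Cb Cx Cr]]] := connected_open_clearance (flow_open F t0)
  (flow_connected F t0) (bdry_neq0 F t0) Db Dx.
apply: (@lt_le_trans _ _ (Num.min r cap)); first by rewrite lt_min r0.
apply: clearance_ge => //; split; first by rewrite ge_min lexx orbT.
by exists C; split => // y /Cr ry; rewrite ge_min ry.
Qed.

Lemma level_in_domain (t r : R) (C : set plane) : 0 <= t -> D t b -> 0 < r ->
  connected C -> C b -> (forall y, C y -> r <= dist (B t) y) -> C `<=` D t.
Proof.
move=> t0 Db r0 cC Cb Cr; apply: connected_in_open => //.
- exact: flow_open F _ t0.
- move=> y /Cr + By; rewrite leNgt => /negP; apply.
  by rewrite (_ : dist _ _ = 0)//; exact: dist0_boundary.
- by exists b.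
Qed.

Lemma clearance_in (t : R) : 0 <= t -> D t b -> 0 < clearance t -> D t x.
Proof.
move=> t0 Db m0; have m20 : clearance t / 2 < clearance t by rewrite ltr_pdivrMr// ltr_pMr// ltr1n.
have [C [cC Cb Cx Cr]] := clearance_lt t0 m20.
by apply: (level_in_domain t0 Db _ cC Cb Cr) => //; rewrite divr_gt0.
Qed.

Lemma clearance_lip (T U : R) :
  (forall (t s : R) (x : plane), 0 <= t <= T -> 0 <= s <= T ->
    dist (B t) x <= dist (B s) x + U * `|t - s|) ->
  0 < U -> forall t s : R, 0 <= t <= T -> 0 <= s <= T ->
  clearance t <= clearance s + U * `|t - s|.
Proof.
move=> H U0 t s tT sT.
have [t0 s0] : 0 <= t /\ 0 <= s by case/andP: tT; case/andP: sT.
apply: ge_sup; first by exists 0; exact: clearances0.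
move=> r [rc [C [cC Cb Cx Cr]]]; rewrite -lerBlDr; apply: clearance_ge => //.
split; first by rewrite lerBlDr (le_trans rc)// lerDl mulr_ge0// ltW.
by exists C; split => // y /Cr ry; rewrite lerBlDr; exact: le_trans (H _ _ _ _ _).
Qed.

(** An almost optimal corridor is pushed along by the flow. The map [Phi] moves points near the
    boundary with the velocity and is cut down to the identity at distance d0 / 2, so that b and x
    stay fixed and the image of the corridor, being connected, still joins them. *)
Lemma clearance_step (T U d0 L : R) : 0 < U -> 0 < L -> 0 < d0 -> 8 * cap <= d0 ->
  (forall (t s : R) (x : plane), 0 <= t <= T -> 0 <= s <= T ->
    dist (B t) x <= dist (B s) x + U * `|t - s|) ->
  (forall (t : R) (x : plane), 0 <= t <= T -> D t x -> dist (B t) x < d0 -> `|vel t x| <= L) ->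
  (forall eta : R, 0 < eta -> exists2 h0 : R, 0 < h0 &
  forall (t h : R) (x : plane), 0 < t <= T -> 0 < t + h <= T -> `|h| < h0 ->
    D t x -> dist (B t) x < d0 ->
    dist (B t) x - `|h| * (L * dist (B t) x + eta) <= dist (B (t + h)) (x + h *: vel t x)) ->
  forall e : R, 0 < e -> exists2 h0 : R, 0 < h0 &
  forall t h : R, 0 < t <= T -> 0 < t + h <= T -> `|h| < h0 -> D t b ->
    d0 <= 2 * dist (B t) b -> d0 <= 2 * dist (B t) x ->
    clearance t - `|h| * (L * clearance t + e) <= clearance (t + h).
Proof.
move=> U0 L0 d00 capd HU HL Hstep e e0.
have e20 : 0 < e / 2 by rewrite divr_gt0.
have [h1 h10 H1] := Hstep _ e20.
have LU : 0 < 8 * (L + U) by rewrite mulr_gt0// addr_gt0.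
exists (Num.min (Num.min h1 L^-1) (d0 / (8 * (L + U)))).
  by rewrite !lt_min h10 invr_gt0 L0 divr_gt0.
move=> t h tT thT; rewrite !lt_min => /andP[/andP[hh1 hL] hd] Db db dx.
have [t0 tn thn] : [/\ 0 < t, 0 <= t & 0 <= t + h].
  by case/andP: tT => ? _; case/andP: thT => ? _; split => //; exact: ltW.
have hLU : `|h| * (L + U) <= d0 / 8.
  have : `|h| * (8 * (L + U)) < d0 by rewrite -ltr_pdivlMr.
  by lra.
have hL1 : `|h| * L <= 1 by rewrite -ler_pdivlMr// ltW// mul1r.
set m := clearance t.
have [h_eq0|hn0] := eqVneq h 0; first by rewrite h_eq0 normr0 mul0r subr0 addr0.
have h0 : 0 < `|h| by rewrite normr_gt0.
have := clearance_ge0 tn; rewrite le_eqVlt -/m => /predU1P[<-|m0].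
  rewrite sub0r mulr0 add0r (le_trans _ (clearance_ge0 thn))// oppr_le0.
  by rewrite mulr_ge0 ?ltW.
(* The supremum need not be attained: r gives up half of the admissible error, and at most half of m
   so as to stay positive. *)
pose r := m - Num.min (m / 2) (`|h| * (e / 2)).
have rm : r < m by rewrite /r ltrBlDr ltrDl lt_min divr_gt0// mulr_gt0.
have r0 : 0 < r by rewrite /r subr_gt0 gt_min; apply/orP; left; lra.
have rh : m - `|h| * (e / 2) <= r by rewrite /r lerD2l lerN2 ge_min lexx orbT.
have mcap : m <= cap := clearance_le_cap tn.
have [C [cC Cb Cx Cr]] := clearance_lt tn rm.
have CD := level_in_domain tn Db r0 cC Cb Cr.
pose kap (s : R) := ramp (2 - 4 / d0 * s).
have kap1 s : s <= d0 / 4 -> kap s = 1.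
  move=> sd; apply: ramp1; have : 4 / d0 * s <= 1.
    by rewrite mulrAC ler_pdivrMr// mul1r mulrC -ler_pdivlMr.
  by clear -F b x cap0; lra.
have kap0 s : d0 <= 2 * s -> kap s = 0.
  move=> sd; apply: ramp0; have : 2 <= 4 / d0 * s.
    by rewrite mulrAC ler_pdivlMr// (_ : 4 * s = 2 * (2 * s)) ?ler_pM2l// mulrA -natrM.
  by clear -F b x cap0; lra.
have kap01 s : 0 <= kap s <= 1 := ramp01 _.
pose Phi y := y + (h * kap (dist (B t) y)) *: vel t y.
have Phib : Phi b = b by rewrite /Phi (kap0 _ db) mulr0 scale0r addr0.
have Phix : Phi x = x by rewrite /Phi (kap0 _ dx) mulr0 scale0r addr0.
have B0 := bdry_neq0 F tn.
have cPhi : cont_on C Phi.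
  apply: cont_onD; first exact: cont_on_id.
  apply: cont_onZ.
    apply: cont_onM; first exact: cont_on_cst.
    apply: (@cont_on_comp _ _ _ _ _ setT (dist (B t)) kap) => //.
      by apply: cont_onS (dist_cont B0).
    apply: (@cont_on_comp _ _ _ _ _ setT (fun s : R => 2 - 4 / d0 * s) (@ramp R)) => //; last exact: ramp_cont.
    apply: cont_onB; first exact: cont_on_cst.
    by apply: cont_onM; [exact: cont_on_cst|exact: cont_on_id].
  apply: (@cont_on_comp _ _ _ _ _ K (fun y : plane => (t, y)) (fun z => vel z.1 z.2)).
  - by move=> y /CD Dy; exact: spacetime_in.
  - by apply: cont_on_pair; [exact: cont_on_cst|exact: cont_on_id].
  - exact: velocity_cont F.
have : clearances (t + h) (r - `|h| * (L * r + e / 2)).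
  split.
    rewrite lerBlDr (le_trans (ltW rm))// (le_trans mcap)// lerDl mulr_ge0//.
    by rewrite addr_ge0 ?(ltW e20)// mulr_ge0// ltW.
  exists (Phi @` C); split.
  - by apply: connected_continuous_connected => //; exact/within_cont_on.
  - by exists b.
  - by exists x.
  move=> _ [y Cy <-]; have Dy := CD _ Cy.
  have tI : 0 <= t <= T by case/andP: tT => _ ->; rewrite tn.
  have thI : 0 <= t + h <= T by case/andP: thT => _ ->; rewrite thn.
  have ry := Cr _ Cy.
  (* Away from the layer crude Lipschitz bounds suffice: the distance is at least d0 / 4, while the
     cap limits the width of a corridor to d0 / 8. *)
  have [dy|dy] := leP (d0 / 4) (dist (B t) y).
    have vb : `|(h * kap (dist (B t) y)) *: vel t y| <= `|h| * L.
      rewrite normrZ normrM -mulrA ler_pM2l//.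
      have [dd|dd] := leP d0 (2 * dist (B t) y); first by rewrite kap0// normr0 mul0r ltW.
      have /andP[k0 k1] := kap01 (dist (B t) y).
      rewrite ger0_norm// -[L]mul1r ler_pM//; apply: HL => //.
      by have := dist_ge0 y B0; lra.
    have h2 := dist_lip y (Phi y) (bdry_neq0 F thn).
    have h3 := HU t (t + h) y tI thI.
    have h4 : `|y - Phi y| <= `|h| * L by rewrite /Phi opprD addrA subrr add0r normrN.
    have h5 : `|t - (t + h)| = `|h| by rewrite opprD addrA subrr add0r normrN.
    rewrite h5 in h3.
    have h6 : 0 <= `|h| * (L * r + e / 2).
      by rewrite mulr_ge0// addr_ge0 ?(ltW e20)// mulr_ge0// ltW.
    move: dy h2 h3 h4 h6 hLU mcap rm capd; clear -F b x cap0; lra.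
  rewrite /Phi kap1 ?mulr1; last exact: ltW.
  apply: le_trans (H1 t h y tT thT hh1 Dy _); last by lra.
  have : (1 - `|h| * L) * r <= (1 - `|h| * L) * dist (B t) y.
    by rewrite ler_wpM2l// subr_ge0.
  lra.
move=> /(clearance_ge thn); apply: le_trans.
have : `|h| * (L * r) <= `|h| * (L * m) by rewrite ler_pM2l// ler_pM2l// ltW.
lra.
Qed.

End NoDrop.

(** * Compactness of the space-time fluid region *)

Section Compactness.
Variable R : realType.
Local Notation plane := (R * R)%type.
Variables (c : R -> R -> plane) (D : R -> set plane).
Variables (u1 u1t u11 u12 u2 u2t u21 u22 : R -> plane -> R).
Hypothesis F : C1_flow c D u1 u1t u11 u12 u2 u2t u21 u22.
Local Notation vel := (velocity u1 u2).
Local Notation B t := (bdry (D t)).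
Local Notation K := (spacetime D).

(** In either direction of time the clearance m between x and the base point decays at most at the
    rate L m, so it stays positive, and a positive clearance forces membership. *)
Lemma no_drop (T eps : R) : 0 < eps -> exists2 h0 : R, 0 < h0 &
  forall (s s' : R) (x : plane), 0 <= s <= T -> 0 <= s' <= T -> `|s' - s| < h0 ->
    D s x -> eps <= dist (B s) x -> D s' x.
Proof.
move=> eps0.
have [d1 d10 [L L0 [HL1 Hstep1]]] := distance_step F (T + 1).
have [U U0 HU] := dist_bdry_time_lip F (T + 1).
have [b [rb rb0 Hb]] := base_point F (T + 1).
pose d0 := Num.min (Num.min d1 eps) rb.
have [d00 d0d1 d0e d0b] : [/\ 0 < d0, d0 <= d1, d0 <= eps & d0 <= rb].
  by rewrite /d0 !lt_min d10 eps0 rb0 !ge_min !lexx !orbT.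
pose cap := d0 / 8.
have cap0 : 0 < cap by rewrite divr_gt0.
have capd : 8 * cap <= d0 by rewrite /cap mulrC divfK.
exists (Num.min (eps / (2 * U)) (2 * L)^-1).
  by rewrite lt_min divr_gt0 ?invr_gt0 ?mulr_gt0.
move=> s s' x sT s'T; rewrite lt_min => /andP[ss1 ss2] Ds ds.
pose l : R := `|s' - s|.
have [l0|ln0] := eqVneq l 0.
  by move/eqP: l0; rewrite normr_eq0 subr_eq0 => /eqP ->.
have l_gt0 : 0 < l by rewrite lt_def ln0 normr_ge0.
have Ul : U * l <= eps / 2.
  by move: ss1; rewrite -/l ltr_pdivlMr ?mulr_gt0// => h; lra.
have Ll : 2 * L * l <= 1.
  by rewrite mulrC -ler_pdivlMr ?mulr_gt0// mul1r; exact: ltW.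
(* The sign of s' - s: as q runs from 0 to l, the time [s + sg * q] runs from s to s', forwards or
   backwards. *)
pose sg := (s' - s) / l.
have sgl : sg * l = s' - s by rewrite /sg divfK.
have sg1 : `|sg| = 1 by rewrite /sg normrM normfV normr_id divff.
have inT (q : R) : 0 <= q <= l -> 0 <= s + sg * q <= T.
  move=> /andP[q0 ql].
  have e1 : s + sg * q = s + (q / l) * (s' - s) by rewrite -sgl; field.
  have q1 : 0 <= q / l by rewrite divr_ge0// ltW.
  have q2 : q / l <= 1 by rewrite ler_pdivrMr// mul1r.
  case/andP: sT => a1 a2; case/andP: s'T => a3 a4; rewrite e1.
  have := mulr_ge0 q1 a3; have : 0 <= (1 - q / l) * s by rewrite mulr_ge0 ?subr_ge0.
  have : q / l * s' <= q / l * T by rewrite ler_wpM2l.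
  have : (1 - q / l) * s <= (1 - q / l) * T by rewrite ler_wpM2l ?subr_ge0.
  by clear -F; lra.
have inT0 (q : R) : 0 < q < l -> 0 < s + sg * q.
  move=> /andP[q0 ql].
  have e1 : s + sg * q = s + (q / l) * (s' - s) by rewrite -sgl; field.
  have q1 : 0 < q / l by rewrite divr_gt0.
  have q2 : q / l < 1 by rewrite ltr_pdivrMr// mul1r.
  case/andP: sT => a1 a2; case/andP: s'T => a3 a4; rewrite e1.
  have [p0|p0] := ltP 0 s.
    have := mulr_ge0 (ltW q1) a3; have : 0 < (1 - q / l) * s by rewrite mulr_gt0 ?subr_gt0.
    by clear -F; lra.
  have s0 : s = 0 by apply/eqP; rewrite eq_le p0.
  have : 0 < s' by rewrite lt_def a3 andbT; apply: contra_neq ln0; rewrite /l s0 => ->; rewrite subrr normr0.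
  by move=> /(mulr_gt0 q1); rewrite s0; clear -F; lra.
have dxq (q : R) : 0 <= q <= l -> eps / 2 <= dist (B (s + sg * q)) x.
  move=> /[dup] q0l /inT /andP[h1 h2].
  have := HU s (s + sg * q) x; rewrite h1 (le_trans h2) ?lerDl//.
  case/andP: sT => a1 a2; rewrite a1 (le_trans a2) ?lerDl// => /(_ isT isT).
  rewrite opprD addrA subrr add0r normrN normrM sg1 mul1r.
  case/andP: q0l => q0 ql; rewrite ger0_norm//.
  have : U * q <= U * l by rewrite ler_pM2l.
  by move: ds Ul; clear -F; lra.
have T1 (t : R) : 0 <= t <= T -> 0 <= t <= T + 1.
  by move=> /andP[-> h]; rewrite (le_trans h)// lerDl.
pose m t := clearance D b x cap t.
have HL : forall (t : R) (x : plane), 0 <= t <= T + 1 -> D t x -> dist (B t) x < d0 -> `|vel t x| <= L.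
  by move=> t y tT Dy dy; exact: (HL1 t y tT Dy (lt_le_trans dy d0d1)).
have Hstep : forall eta : R, 0 < eta -> exists2 h0 : R, 0 < h0 &
  forall (t h : R) (x : plane), 0 < t <= T + 1 -> 0 < t + h <= T + 1 -> `|h| < h0 ->
    D t x -> dist (B t) x < d0 ->
    dist (B t) x - `|h| * (L * dist (B t) x + eta) <= dist (B (t + h)) (x + h *: vel t x).
  move=> eta /Hstep1[h0 h00 H]; exists h0; [exact: h00|move=> t h y tT thT hh Dy dy].
  exact: (H t h y tT thT hh Dy (lt_le_trans dy d0d1)).
have Cstep := clearance_step F b x cap0 U0 L0 d00 capd HU HL Hstep.
have Clip := clearance_lip F b x cap0 HU U0.
(* An affine weight does the work of an exponential of rate L: since [2 * L * q <= 1] on the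
   interval, its logarithmic derivative is at least L. *)
pose phi q := m (s + sg * q) * (1 + 2 * L * q).
have cphi : cont_on [set q | 0 <= q <= l] phi.
  apply: cont_onM.
    move=> q ql e e0; exists (e / U); first by rewrite divr_gt0.
    move=> q' ql' qq'.
    have h1 := Clip _ _ (T1 _ (inT _ ql)) (T1 _ (inT _ ql')).
    have h2 := Clip _ _ (T1 _ (inT _ ql')) (T1 _ (inT _ ql)).
    have e1 a a' : `|s + sg * a - (s + sg * a')| = `|a - a'|.
      by rewrite opprD addrACA subrr add0r -mulrBr normrM sg1 mul1r.
    rewrite !e1 in h1 h2; rewrite (distrC q' q) in h2.
    have : U * `|q - q'| < e by rewrite mulrC -ltr_pdivlMr.
    by rewrite ltr_distl /m => h3; apply/andP; split; move: h1 h2 h3; clear -F; lra.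
  apply: cont_onD; first exact: cont_on_cst.
  by apply: cont_onM; [exact: cont_on_cst|exact: cont_on_id].
have s0 : 0 <= s by case/andP: sT.
have s'0 : 0 <= s' by case/andP: s'T.
have ms : 0 < m s by apply: (clearance_gt0 F) => //; have [] := Hb s (T1 _ sT).
suff : phi 0 <= phi l.
  rewrite /phi !mulr0 !addr0 mulr1 sgl [s + _]addrC subrK => h.
  have hp : 0 < 1 + 2 * L * l by rewrite addr_gt0// !mulr_gt0.
  have : 0 < m s' by rewrite -(pmulr_lgt0 _ hp); exact: lt_le_trans h.
  by apply: (clearance_in F) => //; have [] := Hb s' (T1 _ s'T).
apply: dini_nondecreasing => [|//|q /[dup] ql /andP[q0 qltl] e e0]; first exact: ltW.
have e80 : 0 < e / 8 by rewrite divr_gt0.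
have [k1 k10 Hk] := Cstep _ e80.
pose k0 := Num.min (Num.min k1 (l - q)) (e / (4 * (L * L * cap))).
have LLc : 0 < 4 * (L * L * cap) by rewrite !mulr_gt0.
exists k0; first by rewrite /k0 !lt_min k10 subr_gt0 qltl divr_gt0.
move=> k /andP[kgt0]; rewrite /k0 !lt_min => /andP[/andP[kk1 kl] ke].
have qk : 0 < q + k < l by apply/andP; split; move: q0 kgt0 kl; clear -F; lra.
have qI : 0 <= q <= l by rewrite !ltW.
have qkI : 0 <= q + k <= l by case/andP: qk => h1 h2; rewrite !ltW.
have tq := inT0 _ ql; have tqk := inT0 _ qk.
have tI := T1 _ (inT _ qI); have tkI := T1 _ (inT _ qkI).
have := Hk (s + sg * q) (sg * k).
rewrite -addrA -mulrDr normrM sg1 mul1r (gtr0_norm kgt0).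
rewrite tq tqk; case/andP: tI => _ ->; case/andP: tkI => tk0 ->.
have d2 : d0 <= 2 * dist (B (s + sg * q)) x.
  by have := dxq _ qI; move: d0e; clear -F; lra.
have [Dbq dbq] := Hb _ (T1 _ (inT _ qI)).
have d3 : d0 <= 2 * dist (B (s + sg * q)) b by move: d0b dbq rb0; clear -F; lra.
move=> /(_ isT isT kk1 Dbq d3 d2); rewrite -/(m _) -/(m _) /phi.
set M := m (s + sg * q); set M' := m (s + sg * (q + k)) => h.
have M0 : 0 <= M by apply: (clearance_ge0 F) => //; exact: ltW.
have Mc : M <= cap by apply: (clearance_le_cap F) => //; exact: ltW.
have A1 : 2 * L * q <= 2 * L * l by rewrite ler_pM2l ?mulr_gt0// ltW.
have A2 : 2 * L * (q + k) <= 2 * L * l by rewrite ler_pM2l ?mulr_gt0//; case/andP: qkI.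
have A3 : 0 <= 2 * L * (q + k) by rewrite !mulr_ge0 ?(ltW L0)//; case/andP: qkI.
have : (M - k * (L * M + e / 8)) * (1 + 2 * L * (q + k)) <= M' * (1 + 2 * L * (q + k)).
  by rewrite ler_wpM2r// addr_ge0.
apply: le_trans.
have kLM : 0 <= k * (L * M) by rewrite !mulr_ge0// ltW.
have b1 : k * (L * M) * (2 * L * q) <= k * (L * M) * 1.
  by rewrite ler_wpM2l//; exact: le_trans Ll.
have b2 : k * (4 * (L * L * M)) <= e.
  apply: (@le_trans _ _ (k * (4 * (L * L * cap)))).
    by rewrite ler_pM2l// ler_pM2l// ler_pM2l// mulr_gt0.
  by rewrite -ler_pdivlMr// ltW.
have b3 : k * (k * (4 * (L * L * M))) <= k * e by rewrite ler_pM2l.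
have b4 : k * e * (2 * L * (q + k)) <= k * e * 1.
  by rewrite ler_wpM2l ?mulr_ge0 ?(ltW kgt0) ?(ltW e0)//; exact: le_trans Ll.
have ke0 : 0 < k * e by rewrite mulr_gt0.
by move: b1 b3 b4 ke0; clear -F; lra.
Qed.

(** Above the highest boundary point, a vertical half-line starting in the fluid would stay in it,
    against boundedness; by compactness the height of the surface is bounded uniformly in t. *)
Lemma domain_height (T : R) : exists2 Y : R, 1 <= Y & forall (t : R) (x : plane),
  0 <= t <= T -> closure (D t) x -> [/\ 0 <= x.1 <= 1 & 0 <= x.2 <= Y].
Proof.
have cS : cont_on [set q : R * R | 0 <= q.1 <= T /\ 0 <= q.2 <= 1] (fun q => (c q.1 q.2).2).
  apply: (@cont_on_comp _ _ _ _ _ setT (fun q : R * R => c q.1 q.2) snd) => //.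
    by apply: cont_onS (flow_curve F) => q [/andP[]].
  exact: cont_on_snd.
have [M M0 HM] := cont_on_bounded (@compact_rect R 0 T 0 1) cS.
pose Y := 1 + M; have Y1 : 1 <= Y by rewrite lerDl ltW.
exists Y => // t x tT cx; have tn : 0 <= t by case/andP: tT.
have BY y : B t y -> y.2 <= Y.
  rewrite (flow_bdry F tn) => -[[_ /andP[_ h] _]|[a /=]]; first exact: le_trans Y1.
  rewrite in_itv /= => a01 <-.
  have := HM (t, a) (conj tT a01) => /= h.
  by apply: le_trans (le_trans (ler_norm _) h) _; rewrite /Y lerDr.
have DY y : D t y -> y.2 <= Y.
  move=> Dy; rewrite leNgt; apply/negP => Yy.
  have sub : [set z : plane | z.1 = y.1 /\ y.2 <= z.2] `<=` D t.
    apply: connected_in_open; first exact: flow_open F _ tn.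
    - apply: convex_connected => p q s [p1 p2] [q1 q2] /andP[s0 s1]; split => /=.
        by rewrite p1 q1 subrr scaler0 addr0.
      rewrite -[_ *: _]/(_ * _).
      have : 0 <= s * (q.2 - y.2) by rewrite mulr_ge0// subr_ge0.
      have : 0 <= (1 - s) * (p.2 - y.2) by rewrite mulr_ge0// subr_ge0.
      by clear -F; lra.
    - by move=> z [_ yz] /BY zY; have := lt_le_trans Yy (le_trans yz zY); rewrite ltxx.
    - by exists y.
  have [[_ _ [N [_ HN]] _ _] _] := flow_domain F tn.
  have := HN (`|N| + 1) _; rewrite (le_lt_trans (ler_norm _))// ?ltrDl// => /(_ isT).
  move=> /(_ (y.1, y.2 + `|N| + 1)) /= h.
  have : `|(y.1, y.2 + `|N| + 1)| <= `|N| + 1.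
    by apply: h; apply: sub; split => //=; rewrite -addrA lerDl addr_ge0.
  rewrite norm_pair_le /= => /andP[_] /(le_trans (ler_norm _)).
  by have : 0 < y.2 by [apply: lt_trans Yy; apply: lt_le_trans Y1]; clear -F; lra.
have H y : D t y -> [/\ 0 <= y.1 <= 1 & 0 <= y.2 <= Y].
  move=> Dy; have [/andP[h1 h2] h3] := flow_strip F tn Dy.
  by split; rewrite ltW//= ?DY// ltW.
have lim e : 0 < e -> exists2 y, [/\ 0 <= y.1 <= 1 & 0 <= y.2 <= Y] & `|x - y| < e.
  by move=> e0; have [y /H] := proj1 (closure_normP _ _) cx e e0; exists y.
have red (a b : R) (f : plane -> R) : (forall y, `|f x - f y| <= `|x - y|) ->
    (forall y, [/\ 0 <= y.1 <= 1 & 0 <= y.2 <= Y] -> a <= f y <= b) -> a <= f x <= b.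
  move=> lf Hf; apply/andP; split; apply/ler_addgt0Pr => e /lim[y /Hf/andP[h1 h2]] xy.
    by have := le_lt_trans (lf y) xy; rewrite ltr_distl => /andP[]; move: h1; clear -F; lra.
  by have := le_lt_trans (lf y) xy; rewrite ltr_distl => /andP[]; move: h2; clear -F; lra.
split.
  by apply: (red _ _ fst) => [y|y []//]; exact: (norm_fst (x - y)).
by apply: (red _ _ snd) => [y|y []//]; exact: (norm_snd (x - y)).
Qed.

Definition slab (T : R) : set (R * plane) := [set z | 0 <= z.1 <= T /\ closure (D z.1) z.2].

(** Closedness is the issue. If x had a distance r from [D t], fluid points near x at a nearby time
    would be far from the boundary, and [no_drop] would put them into [D t]. *)
Lemma slab_compact (T : R) : compact (slab T).
Proof.
have [Y Y1 HY] := domain_height T.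
pose box := [set z : R * plane | 0 <= z.1 <= T /\ (0 <= z.2.1 <= 1 /\ 0 <= z.2.2 <= Y)].
have cbox : compact box.
  have -> : box = `[0, T] `*` [set x : plane | 0 <= x.1 <= 1 /\ 0 <= x.2 <= Y].
    by apply/seteqP; split => z /=; rewrite in_itv.
  by apply: compact_setX; [exact: segment_compact|exact: compact_rect].
have sub : slab T `<=` box by move=> [t x] [/= tT /(HY _ _ tT)[]].
apply: subclosed_compact cbox sub.
move=> [t x] /closure_normP cl.
have tT : 0 <= t <= T.
  apply/andP; split; apply/ler_addgt0Pr => e /cl[[s y] [/= /andP[s0 sT] _]];
    rewrite norm_pair_lt /= ltr_distl => /andP[/andP[h1 h2] _]; move: h1 h2 s0 sT; clear -F; lra.
split => //=; have tn : 0 <= t by case/andP: tT.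
apply: contrapT => ncl.
have [r r0 Hr] : exists2 r : R, 0 < r & forall y, D t y -> r <= `|x - y|.
  apply: contrapT => H; apply: ncl; apply/closure_normP => r r0.
  apply: contrapT => H'; apply: H; exists r => // y Dy.
  by rewrite leNgt; apply/negP => xy; apply: H'; exists y.
have rd : r <= dist (B t) x.
  apply: dist_ge; first exact: bdry_neq0 F _ tn.
  move=> y [cy _]; apply/ler_addgt0Pr => e /(proj1 (closure_normP _ _) cy)[z /Hr xz yz].
  by have := ler_distD y x z; move: xz yz; clear -F; lra.
have [U U0 HU] := dist_bdry_time_lip F T.
have r40 : 0 < r / 4 by rewrite divr_gt0.
have [h0 h00 Hh] := no_drop T r40.
pose e := Num.min (Num.min (r / (2 * U)) h0) (r / 8).
have [e0 e1 e2 e3] : [/\ 0 < e, e <= r / (2 * U), e <= h0 & e <= r / 8].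
  by rewrite /e !lt_min h00 !divr_gt0 ?mulr_gt0// !ge_min !lexx !orbT.
have [[s y] [/= sT cy]] := cl e e0.
rewrite norm_pair_lt /= => /andP[ts xy].
have r80 : 0 < r / 8 by rewrite divr_gt0.
have [y' Dy' yy'] := proj1 (closure_normP _ _) cy _ r80.
have sn : 0 <= s by case/andP: sT.
have dsx := HU t s x tT sT.
have Uts : U * `|t - s| <= r / 2.
  have : `|t - s| * (2 * U) < r by rewrite -ltr_pdivlMr ?mulr_gt0//; exact: lt_le_trans e1.
  by clear -F; lra.
have xy' : `|x - y'| < r / 4.
  by have := ler_distD y x y'; move: xy e3 yy'; clear -F; lra.
have := dist_lip x y' (bdry_neq0 F sn) => dxy'.
have : D t y'.
  apply: (Hh s t y' sT tT (lt_le_trans ts e2) Dy').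
  by move: dxy' dsx Uts xy' rd; clear -F; lra.
by move=> /Hr; move: xy' r0; clear -F; lra.
Qed.

Lemma slab_spacetime (T : R) : slab T `<=` K.
Proof. by move=> [t x] [/= /andP[]]. Qed.

Lemma field_bounded (f : R -> plane -> R) (T : R) : cont_on K (fun z => f z.1 z.2) ->
  exists2 M : R, 0 < M & forall (t : R) (x : plane), 0 <= t <= T -> closure (D t) x -> `|f t x| <= M.
Proof.
move=> cf.
have cS : compact (slab T) by exact: slab_compact.
have [M M0 H] := cont_on_bounded cS (cont_onS (@slab_spacetime T) cf).
by exists M => // t x tT cx; exact: (H (t, x)).
Qed.

Lemma field_unif (f : R -> plane -> R) (T e : R) : cont_on K (fun z => f z.1 z.2) -> 0 < e ->
  exists2 r : R, 0 < r & forall (t s : R) (x y : plane), 0 <= t <= T -> 0 <= s ->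
    closure (D t) x -> closure (D s) y -> `|t - s| < r -> `|x - y| < r -> `|f t x - f s y| < e.
Proof.
move=> cf e0; have cS : compact (slab T) by exact: slab_compact.
have [r r0 H] := cont_on_compact_unif cS (@slab_spacetime T) cf e0.
exists r => // t s x y tT s0 cx cy ts xy; apply: (H (t, x) (s, y)) => //.
by rewrite norm_pair_lt ts.
Qed.

End Compactness.

(** * Integration over planar open sets *)

Section PlaneMeasure.
Variable R : realType.
Local Notation plane := (R * R)%type.
Local Notation mu := (@lebesgue_measure R).
Local Notation mu2 := (@lebesgue_measure R \x @lebesgue_measure R)%E.

(** Measurability for the product structure comes from writing the set as a countable union of
    squares with rational centre and radius. *)
Lemma open_plane_measurable (A : set plane) : open A -> measurable A.
Proof.
move=> oA.
pose box (q : rat * rat * rat) : set plane :=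
  `](ratr q.1.1 - ratr q.2 : R), (ratr q.1.1 + ratr q.2 : R)[ `*`
  `](ratr q.1.2 - ratr q.2 : R), (ratr q.1.2 + ratr q.2 : R)[.
pose E n : set plane := if unpickle n is Some q then
  (if `[< box q `<=` A >] then box q else set0) else set0.
have -> : A = \bigcup_n E n.
  apply/seteqP; split => [[x y] Axy|z [n _]]; last first.
    rewrite /E; case: unpickle => // q; case: ifPn => // /asboolP h.
    by move=> Eq; exact: h.
  have [r r0 H] := proj1 (open_normP _) oA (x, y) Axy.
  have r20 : 0 < r / 2 by rewrite divr_gt0.
  have [q3] := rat_in_itvoo r20; rewrite in_itv /= => /andP[q30 q3r].
  have near (w : R) : exists q, `|w - ratr q| < ratr q3.
    have [|q] := @rat_in_itvoo R (w - ratr q3) (w + ratr q3); first by lra.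
    by rewrite in_itv /= => h; exists q; rewrite distrC ltr_distl.
  have [q1 h1] := near x; have [q2 h2] := near y.
  pose q := (q1, q2, q3); have [n nq] : exists n, unpickle n = Some q by eexists; exact: (pickleK q).
  exists n; first exact: I.
  rewrite /E nq.
  have -> : `[< box q `<=` A >].
    apply/asboolP => -[x' y'] [/=]; rewrite !in_itv /= => a1 a2; apply: H.
    rewrite norm_pair_lt /=; move: h1 h2; rewrite !ltr_distl => /andP[? ?] /andP[? ?].
    by case/andP: a1 => ? ?; case/andP: a2 => ? ?; apply/andP; split; apply/andP; split; lra.
  split => /=; rewrite in_itv /=; [move: h1|move: h2]; rewrite ltr_distl => /andP[? ?];
    by apply/andP; split; lra.
apply: bigcupT_measurable => n; rewrite /E; case: unpickle => // q.
by case: ifPn => // _; apply: measurableX.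
Qed.

Lemma open_cont_measurable_fun (A : set plane) (f : plane -> R) :
  open A -> cont_on A f -> measurable_fun A f.
Proof.
move=> oA cf; apply: (measurability _ (measurable_realfun.RGenOInfty.measurableE R)) => //.
move=> _ [_ [a ->] <-]; apply: open_plane_measurable.
apply/open_normP => x [Ax] /=; rewrite in_itv /= andbT => fx.
have [r r0 H] := proj1 (open_normP _) oA x Ax.
have fa : 0 < f x - a by rewrite subr_gt0.
have [s s0 Hs] := cf x Ax _ fa.
exists (Num.min r s); first by rewrite lt_min r0.
move=> y; rewrite lt_min => /andP[/H Ay xs]; split => //=.
by have := Hs y Ay xs; rewrite in_itv /= andbT ltr_distl; lra.
Qed.

Lemma box_measure (a b d e : R) : a <= b -> d <= e ->
  mu2 (`[a, b] `*` `[d, e]) = ((b - a) * (e - d))%:E.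
Proof.
have len (p q : R) : p <= q -> (mu `[p, q] = (q - p)%:E)%E.
  move=> pq; rewrite lebesgue_measure_itv /= lte_fin -EFinB.
  by move: pq; rewrite le_eqVlt => /predU1P[->|->]//; rewrite ltxx subrr.
move=> ab de; rewrite EFinM -len// -len//.
by apply: product_measure1E; exact: measurable_itv.
Qed.

Lemma bounded_open_measure (A : set plane) (Y : R) : open A ->
  (forall x, A x -> 0 <= x.1 <= 1 /\ 0 <= x.2 <= Y) -> (mu2 A < +oo)%E.
Proof.
move=> oA AY; have [Y0|Y0] := leP 0 Y; last first.
  rewrite (_ : A = set0) ?measure0//; apply/seteqP; split => // x /AY[_ /andP[h1 h2]].
  by have := lt_le_trans Y0 (le_trans h1 h2); rewrite ltxx.
apply: (@le_lt_trans _ _ (mu2 (`[0, 1] `*` `[0, Y]))); last first.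
  by rewrite box_measure// ltry.
apply: le_measure; rewrite ?inE.
- exact: open_plane_measurable.
- by apply: measurableX; exact: measurable_itv.
- by move=> x /AY[h1 h2]; split => /=; rewrite in_itv.
Qed.

Lemma integrable_open (A : set plane) (Y M : R) (f : plane -> R) : open A ->
  (forall x, A x -> 0 <= x.1 <= 1 /\ 0 <= x.2 <= Y) -> cont_on A f ->
  (forall x, A x -> `|f x| <= M) -> mu2.-integrable A (EFin \o f).
Proof.
move=> oA AY cf fM; apply: measurable_bounded_integrable.
- exact: open_plane_measurable.
- exact: bounded_open_measure oA AY.
- exact: open_cont_measurable_fun.
- exists M; split; first exact: num_real.
  by move=> N MN x Ax; apply: le_trans (fM x Ax) (ltW MN).
Qed.

Lemma integral_slices1 (A : set plane) (f : plane -> R) (phi : R -> \bar R) :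
  measurable A -> mu2.-integrable A (EFin \o f) ->
  (forall y, (\int[mu]_x (((f \_ A) (x, y))%:E) = phi y)%E) ->
  (\int[mu2]_(z in A) (f z)%:E = \int[mu]_y phi y)%E.
Proof.
move=> mA fi H.
have fi' : mu2.-integrable setT (EFin \o (f \_ A)).
  by rewrite -restrict_EFin; apply/integrable_restrict => //; rewrite setTI.
rewrite integral_mkcond restrict_EFin -(integral21_prod_meas1 fi').
by apply: eq_integral => y _; rewrite -H.
Qed.

Lemma integral_slices2 (A : set plane) (f : plane -> R) (phi : R -> \bar R) :
  measurable A -> mu2.-integrable A (EFin \o f) ->
  (forall x, (\int[mu]_y (((f \_ A) (x, y))%:E) = phi x)%E) ->
  (\int[mu2]_(z in A) (f z)%:E = \int[mu]_y phi y)%E.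
Proof.
move=> mA fi H.
have fi' : mu2.-integrable setT (EFin \o (f \_ A)).
  by rewrite -restrict_EFin; apply/integrable_restrict => //; rewrite setTI.
rewrite integral_mkcond restrict_EFin -(integral12_prod_meas1 fi').
by apply: eq_integral => y _; rewrite -H.
Qed.

Lemma integral_supported (a b : R) (k : R -> R) :
  (forall x, ~~ (a <= x <= b) -> k x = 0) ->
  (\int[mu]_x (k x)%:E = \int[mu]_(x in `[a, b]) (k x)%:E)%E.
Proof.
move=> H; rewrite [RHS]integral_mkcond; apply: eq_integral => x _.
rewrite patchE; case: ifPn => // /negP h; rewrite H//.
by apply/negP => ab; apply: h; apply/mem_set; rewrite /= in_itv.
Qed.

Lemma FTC (F f : R -> R) (a b : R) : a < b ->
  (forall x, a <= x <= b -> is_derive x 1 F (f x)) ->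
  cont_on [set x | a <= x <= b] f ->
  (\int[mu]_(x in `[a, b]) (f x)%:E = (F b - F a)%:E)%E.
Proof.
move=> ab dF cf.
have cF x : a <= x <= b -> {for x, continuous F}.
  move=> /dF[dFx _]; apply: differentiable_continuous.
  by apply/derivable1_diffP.
rewrite (@continuous_FTC2 R f F) ?EFinB//.
- exact/cont_on_itv.
- split.
  + move=> x; rewrite in_itv /= => /andP[h1 h2].
    by have [] := dF x; rewrite ?ltW.
  + apply: cvg_at_right_filter; apply: cF; rewrite lexx; exact: ltW.
  + apply: cvg_at_left_filter; apply: cF; rewrite lexx andbT; exact: ltW.
- move=> x; rewrite in_itv /= => /andP[h1 h2].
  have dFx : is_derive x 1 F (f x) by apply: dF; rewrite !ltW.
  by rewrite derive1E derive_val.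
Qed.

Lemma antiderivative (g : R -> R) (N : R) : continuous g ->
  exists G : R -> R, forall x : R, `|x| < N -> is_derive x 1 G (g x).
Proof.
move=> cg; exists (fun x => (\int[mu]_(t in `[(- N), x]) g t)%R) => x.
rewrite -[x in `|x|]subr0 ltr_distl sub0r add0r => /andP[Nx xN].
have [||d e] := @continuous_FTC1_closed R g (- N) x N xN _ Nx.
- apply: continuous_compact_integrable; first exact: segment_compact.
  exact: continuous_subspaceT.
- exact: cg.
- by apply: DeriveDef; [exact: d|rewrite -e derive1E].
Qed.

Lemma near_is_derive (f g : R -> R) (x l r : R) : 0 < r ->
  (forall z, `|x - z| < r -> f z = g z) -> is_derive x 1 f l -> is_derive x 1 g l.
Proof.
move=> r0 fg; apply: near_eq_is_derive.
by apply/nbhs_normP; exists r => // z /=; exact: fg.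
Qed.

Lemma chain_rule (f g : R -> R) (x a b : R) : is_derive x 1 g b ->
  is_derive (g x) 1 f a -> is_derive x 1 (f \o g) (a * b).
Proof.
move=> [dg gb] [df fa]; apply: DeriveDef.
  apply/derivable1_diffP; apply: differentiable_comp; exact/derivable1_diffP.
by have := derive1_comp dg df; rewrite !derive1E fa gb.
Qed.

(* Away from the support of [g], the function H (x + h v x) - H x, where H' = g,
   vanishes: it extends by zero to a C^1 function, no matter how wild O is. *)
Lemma slice_substitution (O : set R) (g v a : R -> R) (rho h N : R) :
  open O -> (forall x, O x -> `|x| <= N) ->
  (forall x, O x -> is_derive x 1 v (a x)) -> cont_on O a ->
  continuous g -> 0 < rho ->
  (forall y z, g y != 0 -> `|y - z| < rho -> O z) ->
  (forall x, O x -> `|h * v x| < rho / 2) ->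
  (\int[mu]_x (((fun x => g (x + h * v x)%R * (1 + h * a x) - g x)%R \_ O) x)%:E = 0)%E.
Proof.
move=> oO ON dv ca cg rho0 supp hv.
set k := fun x => (g (x + h * v x) * (1 + h * a x) - g x).
pose N' := `|N| + 1.
have N'0 : 0 < N' by rewrite /N' ltr_wpDl.
have ON' x : O x -> `|x| < N'.
  by move=> /ON xN; rewrite /N' ltr_pwDr// (le_trans xN)// ler_norm.
have [H dH] := antiderivative (N' + rho) cg.
pose K x := if x \in O then H (x + h * v x) - H x else 0.
have zone x z : ~ O x -> `|x - z| < rho -> g z = 0.
  move=> nOx xz; apply/eqP; apply: contra_notT nOx => gz.
  by apply: supp gz _; rewrite distrC.
have rho20 : 0 < rho / 2 by rewrite divr_gt0.
have K0 x z : ~ O x -> `|x - z| < rho / 2 -> K z = 0.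
  move=> nOx xz; rewrite /K; case: ifPn => // /set_mem Oz.
  have zN := ON' _ Oz; have hvz := hv _ Oz.
  have [w|w [w1 _ ->]] := @mean_value R H g z (z + h * v z).
    rewrite [z + _ - z]addrC addKr => w1 _; apply: dH.
    have := ler_normD (w - z) z; rewrite subrK.
    by move: w1 hvz zN rho0; lra.
  rewrite (zone x w) ?mul0r//.
  move: w1; rewrite [z + _ - z]addrC addKr => w1.
  by have := ler_distD z x w; rewrite (distrC z w); move: xz w1 hvz; lra.
have k0 x z : ~ O x -> `|x - z| < rho / 2 -> (k \_ O) z = 0.
  move=> nOx xz; rewrite patchE; case: ifPn => // /set_mem Oz.
  have hvz := hv _ Oz; rewrite /k (zone x z)// ?subr0; last by move: xz rho0; lra.
  rewrite (zone x (z + h * v z)) ?mul0r//.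
  have e1 : z - (z + h * v z) = - (h * v z) by rewrite opprD addNKr.
  have := ler_distD z x (z + h * v z); rewrite e1 normrN.
  by move: xz hvz; lra.
have dK (x : R) : `|x| <= N' -> is_derive x 1 K ((k \_ O) x).
  move=> xN; have [Ox|nOx] := pselect (O x); last first.
    rewrite (k0 x x nOx) ?subrr ?normr0//.
    apply: (@near_is_derive (fun=> 0) K x 0 (rho / 2)) => // z xz.
    by rewrite (K0 x z).
  rewrite patchE mem_set//.
  have [r r0 Hr] := proj1 (open_normP _) oO x Ox.
  have [xN' hvx] := (ON' _ Ox, hv _ Ox).
  have d1 : is_derive (x + h * v x) 1 H (g (x + h * v x)).
    apply: dH; have := ler_normD x (h * v x); move: xN' hvx rho0; lra.
  have d2 : is_derive x 1 H (g x) by apply: dH; rewrite (lt_trans xN')// ltrDl.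
  have d3 := dv _ Ox.
  have d4 : is_derive x 1 (fun z => z + h * v z) (1 + h * a x).
    by apply: is_derive_eq.
  have d5 := chain_rule d4 d1.
  apply: (@near_is_derive (fun z => H (z + h * v z) - H z) K x _ r) => // z /Hr Oz.
  by rewrite /K mem_set.
have ck : cont_on setT (k \_ O).
  move=> x _ e e0; have [Ox|nOx] := pselect (O x); last first.
    exists (rho / 2) => // z _ xz; rewrite (k0 x z)// (k0 x x) ?subrr ?normr0//.
  have cgT : cont_on setT g by apply/within_cont_on; exact: continuous_subspaceT.
  have cv : cont_on O v.
    move=> y Oy; have [dvy _] := dv _ Oy.
    move/derivable1_diffP/differentiable_continuous: dvy => cvy e' e'0.
    have /cvgrPdist_lt/(_ e' e'0)/nbhs_normP[s s0 Hs] := cvy.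
    by exists s => // w _; exact: Hs.
  have ck : cont_on O k.
    apply: cont_onB; last exact: cont_onS cgT.
    apply: cont_onM.
      apply: (cont_on_comp (K := setT)) cgT => //.
      apply: cont_onD; first exact: cont_on_id.
      by apply: cont_onM => //; exact: cont_on_cst.
    apply: cont_onD; first exact: cont_on_cst.
    by apply: cont_onM => //; exact: cont_on_cst.
  have [r r0 Hr] := proj1 (open_normP _) oO x Ox.
  have [s s0 Hs] := ck x Ox e e0.
  exists (Num.min r s); first by rewrite lt_min r0.
  move=> z _; rewrite lt_min => /andP[/Hr Oz xz].
  by rewrite !patchE !mem_set//; exact: Hs.
have notO x : N' <= `|x| -> ~ O x by move=> Nx /ON'; rewrite ltNge Nx.
rewrite (@integral_supported (- N') N'); last first.
  move=> x; rewrite -ler_norml -ltNge => /ltW/notO nOx.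
  by rewrite patchE memNset.
have KN : K N' = 0 by rewrite /K memNset//; apply: notO; rewrite ger0_norm// ltW.
have KN2 : K (- N') = 0 by rewrite /K memNset//; apply: notO; rewrite normrN ger0_norm// ltW.
transitivity ((K N' - K (- N'))%:E); last by rewrite KN KN2 subrr.
apply: FTC.
- by rewrite gtrN.
- by move=> x; rewrite -ler_norml; exact: dK.
- exact: cont_onS ck.
Qed.

End PlaneMeasure.

Lemma cont_onT (R : realType) (V W : normedModType R) (f : V -> W) :
  cont_on setT f -> continuous f.
Proof.
move=> cf x; apply/cvgrPdist_lt => e e0; have [r r0 H] := cf x I e e0.
by apply/nbhs_normP; exists r => // y; exact: H.
Qed.

(** * Change of variables by two shears *)

Section PlaneSubstitution.
Variable R : realType.
Local Notation plane := (R * R)%type.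
Local Notation mu2 := (@lebesgue_measure R \x @lebesgue_measure R)%E.
Definition bounded_cont (E : set plane) (f : plane -> R) : Prop :=
  cont_on E f /\ exists M : R, forall x, E x -> `|f x| <= M.

Variables (E : set plane) (Y : R).
Hypothesis oE : open E.
Hypothesis EY : forall x, E x -> 0 <= x.1 <= 1 /\ 0 <= x.2 <= Y.

Lemma plane_shift1 (g v a : plane -> R) (rho h M N : R) :
  (forall x, E x -> is_derive x.1 (1 : R) (fun s => v (s, x.2)) (a x)) ->
  cont_on E v -> cont_on E a -> (forall x, E x -> `|a x| <= M) ->
  cont_on setT g -> (forall x, `|g x| <= N) -> 0 < rho ->
  (forall y z, g y != 0 -> `|y - z| < rho -> E z) ->
  (forall x, E x -> `|h * v x| < rho / 2) ->
  let k x := g (x.1 + h * v x, x.2) * (1 + h * a x) - g x in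
  mu2.-integrable E (EFin \o k) /\ (\int[mu2]_(x in E) (k x)%:E = 0)%E.
Proof.
move=> dv cv ca aM cg gN rho0 supp hv k.
have ki : mu2.-integrable E (EFin \o k).
  apply: (@integrable_open R E Y (N * (1 + `|h| * M) + N) k) => //.
    apply: cont_onB; last exact: cont_onS cg.
    apply: cont_onM.
      apply: (cont_on_comp (K := setT)) cg => //.
      apply: cont_on_pair; last exact: cont_on_snd.
      apply: cont_onD; first exact: cont_on_fst.
      by apply: cont_onM => //; exact: cont_on_cst.
    apply: cont_onD; first exact: cont_on_cst.
    by apply: cont_onM => //; exact: cont_on_cst.
  move=> x Ex; rewrite (le_trans (ler_normB _ _))// lerD// normrM ler_pM//.
  by rewrite (le_trans (ler_normD _ _))// normr1 lerD2l normrM ler_wpM2l// aM.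
split => //.
rewrite (integral_slices1 (phi := fun=> 0%E) (open_plane_measurable oE) ki) ?integral0// => y.
have cp : cont_on setT (fun x : R => (x, y)).
  by apply: cont_on_pair; [exact: cont_on_id|exact: cont_on_cst].
have cgy : continuous (fun x => g (x, y)).
  by apply: cont_onT; exact: (cont_on_comp (K := setT) _ cp cg).
have oO : open [set x | E (x, y)].
  apply/open_normP => x /= Exy; have [r r0 H] := proj1 (open_normP _) oE _ Exy.
  by exists r => // x' xx'; apply: H; rewrite norm_pair_lt /= xx' subrr normr0.
have := @slice_substitution R [set x | E (x, y)] (fun x => g (x, y)) (fun x => v (x, y)) (fun x => a (x, y)) rho h 1 oO _ _ _ cgy rho0.
move=> H; rewrite -[RHS]H.
- by apply: eq_integral => x _; rewrite !patchE /k.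
- by move=> x /EY[/= /andP[x0 x1] _]; rewrite ger0_norm.
- apply: (cont_on_comp (K := E)) ca => //.
  by apply: cont_on_pair; [exact: cont_on_id|exact: cont_on_cst].
- move=> x z gx xz; apply: supp gx _.
  by rewrite norm_pair_lt /= xz subrr normr0.
- by move=> x /hv.
Qed.

Lemma plane_shift2 (g v a : plane -> R) (rho h M N : R) :
  (forall x, E x -> is_derive x.2 (1 : R) (fun s => v (x.1, s)) (a x)) ->
  cont_on E v -> cont_on E a -> (forall x, E x -> `|a x| <= M) ->
  cont_on setT g -> (forall x, `|g x| <= N) -> 0 < rho ->
  (forall y z, g y != 0 -> `|y - z| < rho -> E z) ->
  (forall x, E x -> `|h * v x| < rho / 2) ->
  let k x := g (x.1, x.2 + h * v x) * (1 + h * a x) - g x in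
  mu2.-integrable E (EFin \o k) /\ (\int[mu2]_(x in E) (k x)%:E = 0)%E.
Proof.
move=> dv cv ca aM cg gN rho0 supp hv k.
have ki : mu2.-integrable E (EFin \o k).
  apply: (@integrable_open R E Y (N * (1 + `|h| * M) + N) k) => //.
    apply: cont_onB; last exact: cont_onS cg.
    apply: cont_onM.
      apply: (cont_on_comp (K := setT)) cg => //.
      apply: cont_on_pair; first exact: cont_on_fst.
      apply: cont_onD; first exact: cont_on_snd.
      by apply: cont_onM => //; exact: cont_on_cst.
    apply: cont_onD; first exact: cont_on_cst.
    by apply: cont_onM => //; exact: cont_on_cst.
  move=> x Ex; rewrite (le_trans (ler_normB _ _))// lerD// normrM ler_pM//.
  by rewrite (le_trans (ler_normD _ _))// normr1 lerD2l normrM ler_wpM2l// aM.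
split => //.
rewrite (integral_slices2 (phi := fun=> 0%E) (open_plane_measurable oE) ki) ?integral0// => y.
have cp : cont_on setT (fun x : R => (y, x)).
  by apply: cont_on_pair; [exact: cont_on_cst|exact: cont_on_id].
have cgy : continuous (fun x => g (y, x)).
  by apply: cont_onT; exact: (cont_on_comp (K := setT) _ cp cg).
have oO : open [set x | E (y, x)].
  apply/open_normP => x /= Exy; have [r r0 H] := proj1 (open_normP _) oE _ Exy.
  by exists r => // x' xx'; apply: H; rewrite norm_pair_lt /= xx' subrr normr0 r0.
have := @slice_substitution R [set x | E (y, x)] (fun x => g (y, x)) (fun x => v (y, x)) (fun x => a (y, x)) rho h `|Y| oO _ _ _ cgy rho0.
move=> H; rewrite -[RHS]H.
- by apply: eq_integral => x _; rewrite !patchE /k.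
- by move=> x /EY[/= _ /andP[x0 x1]]; rewrite ger0_norm// (le_trans x1)// ler_norm.
- apply: (cont_on_comp (K := E)) ca => //.
  exact: cont_onS cp.
- move=> x z gx xz; apply: supp gx _.
  by rewrite norm_pair_lt /= xz subrr normr0 rho0.
- by move=> x /hv.
Qed.

(* The map x |-> x + h v(x) is replaced by two successive shears, each of which
   is a one-dimensional change of variables on every slice. *)
Lemma plane_substitution (G v1 v2 a b : plane -> R) (rho h M N : R) :
  (forall x, E x -> is_derive x.1 (1 : R) (fun s => v1 (s, x.2)) (a x)) ->
  (forall x, E x -> is_derive x.2 (1 : R) (fun s => v2 (x.1, s)) (b x)) ->
  cont_on E v1 -> cont_on E v2 -> cont_on E a -> cont_on E b ->
  (forall x, E x -> `|a x| <= M) -> (forall x, E x -> `|b x| <= M) ->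
  cont_on setT G -> (forall x, `|G x| <= N) -> 0 < rho -> 0 <= M ->
  (forall y z, G y != 0 -> `|y - z| < rho -> E z) ->
  (forall x, E x -> `|h * v1 x| < rho / 4) ->
  (forall x, E x -> `|h * v2 x| < rho / 4) ->
  let G2 := (fun y => G (y.1, y.2 + h * v2 y) * (1 + h * b y)) \_ E in
  let k x := G2 (x.1 + h * v1 x, x.2) * (1 + h * a x) - G x in
  bounded_cont E k /\ \int[mu2]_(x in E) k x = 0.
Proof.
move=> da db cv1 cv2 ca cb aM bM cG GN rho0 M0 supp hv1 hv2 G2 k.
have N0 : 0 <= N by apply: le_trans (GN (0, 0)).
have rho20 : 0 < rho / 2 by rewrite divr_gt0.
have rho40 : 0 < rho / 4 by rewrite divr_gt0.
have near_self y : E y -> `|y - (y.1, y.2 + h * v2 y)| < rho / 4.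
  by move=> Ey; rewrite norm_pair_lt /= subrr normr0 rho40/= opprD addNKr normrN hv2.
have supp2 y z : G2 y != 0 -> `|y - z| < rho / 2 -> E z.
  rewrite /G2 patchE; case: ifPn => [/set_mem Ey|_]; last by rewrite eqxx.
  move=> Gy yz; apply: (supp (y.1, y.2 + h * v2 y)).
    by apply: contraNneq Gy => ->; rewrite mul0r.
  have := ler_distD y (y.1, y.2 + h * v2 y) z; rewrite (distrC _ y).
  have := near_self _ Ey; move: yz rho0; clear -E; lra.
have cG2E : cont_on E (fun y => G (y.1, y.2 + h * v2 y) * (1 + h * b y)).
  apply: cont_onM.
    apply: (cont_on_comp (K := setT)) cG => //.
    apply: cont_on_pair; first exact: cont_on_fst.
    apply: cont_onD; first exact: cont_on_snd.
    by apply: cont_onM => //; exact: cont_on_cst.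
  apply: cont_onD; first exact: cont_on_cst.
  by apply: cont_onM => //; exact: cont_on_cst.
have cG2 : cont_on setT G2.
  move=> x _ e e0; have [Ex|nEx] := pselect (E x).
    have [r r0 Hr] := proj1 (open_normP _) oE x Ex.
    have [s s0 Hs] := cG2E x Ex e e0.
    exists (Num.min r s); first by rewrite lt_min r0.
    move=> z _; rewrite lt_min => /andP[/Hr Ez xz].
    by rewrite /G2 !patchE !mem_set//; exact: Hs.
  exists (rho / 2) => // z _ xz.
  have -> : G2 x = 0 by rewrite /G2 patchE memNset.
  suff -> : G2 z = 0 by rewrite subrr normr0.
  apply/eqP/negPn/negP => G2z; apply: nEx; apply: supp2 G2z _.
  by rewrite distrC.
have G2N x : `|G2 x| <= N * (1 + `|h| * M).
  rewrite /G2 patchE; case: ifPn => [/set_mem Ex|_]; last first.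
    by rewrite normr0 mulr_ge0// addr_ge0// mulr_ge0.
  rewrite normrM ler_pM// (le_trans (ler_normD _ _))// normr1 lerD2l normrM.
  by rewrite ler_wpM2l// bM.
have lt42 : rho / 4 <= rho / 2 / 2 by lra.
have [i1 e1] := plane_shift1 da cv1 ca aM cG2 G2N rho20 supp2
  (fun x Ex => lt_le_trans (hv1 x Ex) lt42).
have lt2 : rho / 4 <= rho / 2 by lra.
have [i2 e2] := plane_shift2 db cv2 cb bM cG GN rho0 supp
  (fun x Ex => lt_le_trans (hv2 x Ex) lt2).
have mE := open_plane_measurable oE.
pose k1 x := G2 (x.1 + h * v1 x, x.2) * (1 + h * a x) - G2 x.
pose k2 x := G (x.1, x.2 + h * v2 x) * (1 + h * b x) - G x.
(* Telescoping through [G2] splits the integrand into two one-directional shears, each of integral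
   zero. *)
have kE x : E x -> k x = k1 x + k2 x.
  move=> Ex; rewrite /k /k1 /k2 {3}/G2 patchE mem_set//.
  by rewrite addrA subrK.
split.
  split.
    apply: cont_onB; last exact: cont_onS cG.
    apply: cont_onM.
      apply: (cont_on_comp (K := setT)) cG2 => //.
      apply: cont_on_pair; last exact: cont_on_snd.
      apply: cont_onD; first exact: cont_on_fst.
      by apply: cont_onM => //; exact: cont_on_cst.
    apply: cont_onD; first exact: cont_on_cst.
    by apply: cont_onM => //; exact: cont_on_cst.
  exists (N * (1 + `|h| * M) * (1 + `|h| * M) + N) => x Ex.
  rewrite (le_trans (ler_normB _ _))// lerD// normrM ler_pM//.
  by rewrite (le_trans (ler_normD _ _))// normr1 lerD2l normrM ler_wpM2l// aM.
rewrite /Rintegral.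
suff -> : (\int[mu2]_(x in E) (k x)%:E = 0)%E by [].
transitivity (\int[mu2]_(x in E) ((k1 x)%:E + (k2 x)%:E))%E.
  by apply: eq_integral => x /set_mem Ex; rewrite kE.
rewrite integralD//.
by rewrite [X in (X + _)%E]e1 [X in (_ + X)%E]e2 add0e.
Qed.

End PlaneSubstitution.

Section PlaneIntegral.
Variable R : realType.
Local Notation plane := (R * R)%type.
Local Notation mu2 := (@lebesgue_measure R \x @lebesgue_measure R)%E.

Variables (E : set plane) (Y : R).
Hypothesis oE : open E.
Hypothesis EY : forall x, E x -> 0 <= x.1 <= 1 /\ 0 <= x.2 <= Y.
Implicit Types f g : plane -> R.

Lemma bounded_cont_integrable f : bounded_cont E f -> mu2.-integrable E (EFin \o f).
Proof. by move=> [cf [M fM]]; exact: integrable_open EY cf fM. Qed.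

Lemma bounded_contD f g : bounded_cont E f -> bounded_cont E g ->
  bounded_cont E (fun x => f x + g x).
Proof.
move=> [cf [M fM]] [cg [N gN]]; split; first exact: cont_onD.
by exists (M + N) => x Ex; rewrite (le_trans (ler_normD _ _))// lerD ?fM ?gN.
Qed.

Lemma bounded_contN f : bounded_cont E f -> bounded_cont E (fun x => - f x).
Proof.
move=> [cf [M fM]]; split; first exact: cont_onN.
by exists M => x Ex; rewrite normrN fM.
Qed.

Lemma bounded_contB f g : bounded_cont E f -> bounded_cont E g ->
  bounded_cont E (fun x => f x - g x).
Proof. by move=> bf bg; apply: bounded_contD => //; exact: bounded_contN. Qed.

Lemma bounded_contM f g : bounded_cont E f -> bounded_cont E g ->
  bounded_cont E (fun x => f x * g x).
Proof.
move=> [cf [M fM]] [cg [N gN]]; split; first exact: cont_onM.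
by exists (M * N) => x Ex; rewrite normrM ler_pM ?fM ?gN.
Qed.

Lemma bounded_cont_cst (a : R) : bounded_cont E (fun=> a).
Proof. by split; [exact: cont_on_cst|exists `|a|]. Qed.

Local Notation I f := (\int[mu2]_(x in E) f x).

Lemma pintD f g : bounded_cont E f -> bounded_cont E g ->
  I (fun x => f x + g x) = I f + I g.
Proof.
move=> /bounded_cont_integrable fi /bounded_cont_integrable gi.
by rewrite RintegralD//; exact: open_plane_measurable.
Qed.

Lemma pintB f g : bounded_cont E f -> bounded_cont E g ->
  I (fun x => f x - g x) = I f - I g.
Proof.
move=> /bounded_cont_integrable fi /bounded_cont_integrable gi.
by rewrite RintegralB//; exact: open_plane_measurable.
Qed.

Lemma pintZ (a : R) f : bounded_cont E f -> I (fun x => a * f x) = a * I f.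
Proof.
move=> /bounded_cont_integrable fi.
by rewrite RintegralZl//; exact: open_plane_measurable.
Qed.

Lemma le_pint f g : bounded_cont E f -> bounded_cont E g ->
  (forall x, E x -> f x <= g x) -> I f <= I g.
Proof.
move=> /bounded_cont_integrable fi /bounded_cont_integrable gi fg.
by apply: le_Rintegral => //; exact: open_plane_measurable.
Qed.

Lemma eq_pint f g : (forall x, E x -> f x = g x) -> I f = I g.
Proof. by move=> fg; apply: eq_Rintegral => x /set_mem/fg. Qed.

Lemma norm_pint_le f g : bounded_cont E f -> bounded_cont E g ->
  (forall x, E x -> `|f x| <= g x) -> `|I f| <= I g.
Proof.
move=> bf bg fg; rewrite ler_norml -[- I g]mulN1r -pintZ// !le_pint//.
- by move=> x /fg; rewrite ler_norml => /andP[].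
- by apply: bounded_contM => //; exact: bounded_cont_cst.
- by move=> x /fg; rewrite ler_norml mulN1r => /andP[].
Qed.

End PlaneIntegral.

(** * The area of the boundary layer *)

Section Layer.
Variable R : realType.
Local Notation plane := (R * R)%type.
Local Notation mu2 := (@lebesgue_measure R \x @lebesgue_measure R)%E.
Variables (c : R -> R -> plane) (D : R -> set plane).
Variables (u1 u1t u11 u12 u2 u2t u21 u22 : R -> plane -> R).
Hypothesis F : C1_flow c D u1 u1t u11 u12 u2 u2t u21 u22.
Local Notation B t := (bdry (D t)).

Lemma bcurve_lip (T : R) : exists2 L : R, 0 <= L &
  forall (i : nat) (t s s' : R), 0 <= t <= T -> 0 <= s <= 1 -> 0 <= s' <= 1 ->
    `|bcurve c i t s - bcurve c i t s'| <= L * `|s - s'|.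
Proof.
have [L L0 HL] := flow_curve_lip F T.
exists (L + 1); first by rewrite addr_ge0.
move=> i t s s' tT s01 s'01.
have : `|bcurve c i t s - bcurve c i t s'| <= L * `|s - s'| \/
       `|bcurve c i t s - bcurve c i t s'| <= `|s - s'|.
  case: i => [|[|[|i]]] /=; first by left; exact: HL.
  - by right; rewrite norm_pair_le /= subrr normr0 normr_ge0 lexx.
  - by right; rewrite norm_pair_le /= subrr normr0 normr_ge0 lexx.
  - by right; rewrite norm_pair_le /= subrr normr0 normr_ge0 lexx.
have := mulr_ge0 L0 (normr_ge0 (s - s')); have := normr_ge0 (s - s').
by clear -F; lra.
Qed.

Lemma flow_box (T : R) : exists2 Y : R, 1 <= Y & forall t : R, 0 <= t <= T ->
  forall x, D t x -> 0 <= x.1 <= 1 /\ 0 <= x.2 <= Y.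
Proof.
have [Y Y1 HY] := domain_height F T; exists Y => // t tT x Dx.
by have [] := HY t x tT (subset_closure Dx).
Qed.

Lemma dist_ramp_cont (t a b : R) (A : set plane) : 0 <= t ->
  bounded_cont A (fun x => ramp (a - b * dist (B t) x)).
Proof.
move=> t0; split; last first.
  exists 1 => x _; have /andP[h1 h2] := ramp01 (a - b * dist (B t) x).
  by rewrite ger0_norm.
apply: (cont_on_comp (K := setT)) (@ramp_cont R) => //.
apply: cont_onB; first exact: cont_on_cst.
apply: cont_onM; first exact: cont_on_cst.
exact: cont_onS (dist_cont (bdry_neq0 F t0)).
Qed.

(** The boundary consists of four Lipschitz curves, so about 1 / eps squares of radius r = (5 + L)
    eps on each of them cover the support of the ramp. With n + 1 <= 3 / eps the total area 4 (n +
    1) (2 r)^2 is at most 48 (5 + L)^2 eps. *)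
Lemma layer_integral (T : R) : exists2 C : R, 0 < C &
  forall t eps : R, 0 <= t <= T -> 0 < eps <= 1 ->
  \int[mu2]_(x in D t) ramp (5 - eps^-1 * dist (B t) x) <= C * eps.
Proof.
have [L L0 HL] := bcurve_lip T.
exists (48 * (5 + L) ^+ 2); first by rewrite mulr_gt0// exprn_gt0//; lra.
move=> t eps tT /andP[eps0 eps1]; have t0 : 0 <= t by case/andP: tT.
have oD := flow_open F t0.
pose n := (Num.truncn eps^-1).+1.
have epsV0 : 0 < eps^-1 by rewrite invr_gt0.
have n1 : eps^-1 < n%:R by exact: truncnS_gt.
have epsV1 : 1 <= eps^-1 by rewrite invf_ge1.
have n2 : n%:R + 1 <= 3 * eps^-1.
  rewrite /n -natr1; have : (Num.truncn eps^-1)%:R <= eps^-1 by rewrite truncn_le ltW.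
  by move: epsV1; clear -F; lra.
have n0 : 0 < n%:R :> R by rewrite ltr0n.
have nV : n%:R^-1 <= eps by rewrite -[eps]invrK lef_pV2 ?posrE// ltW.
pose r := (5 + L) * eps.
have r0 : 0 < r by rewrite mulr_gt0//; lra.
(* One index encodes the boundary piece as its remainder mod 4 and the sample as its quotient. There
   are n + 1 samples on each piece, the last one for the parameter s = 1. *)
pose z (k : nat) := bcurve c (k %% 4) t ((k %/ 4)%:R / n%:R).
pose A (k : nat) : set plane :=
  `[(z k).1 - r, (z k).1 + r] `*` `[(z k).2 - r, (z k).2 + r].
pose S := \big[setU/set0]_(k < (4 * n.+1)%N) A k.
have mA k : measurable (A k) by apply: measurableX; exact: measurable_itv.
have mS : measurable S by apply: bigsetU_measurable.
have muA k : mu2 (A k) = ((2 * r) ^+ 2)%:E.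
  by rewrite /A box_measure; [congr EFin; ring| |]; lra.
have muS : (mu2 S <= ((4 * n.+1)%N%:R * (2 * r) ^+ 2)%:E)%E.
  have := @content_subadditive _ _ _ mu2 S A (4 * n.+1)%N (fun k _ => mA k) mS (@subset_refl _ _).
  rewrite (eq_bigr (fun=> ((2 * r) ^+ 2)%:E)) => [|k _]; last exact: muA.
  move=> /le_trans; apply; rewrite sumEFin lee_fin sumr_const card_ord -[leLHS]mulr_natl.
  exact: lexx.
have cover x : D t x -> dist (B t) x < 5 * eps -> S x.
  move=> Dx dx; have [y By xy] := dist_lt (bdry_neq0 F t0) dx.
  have [i i4 [s /[dup] s01 /andP[s0 s1] yE]] := bdry_bcurve F t0 By.
  pose j := Num.truncn (s * n%:R).
  have sn0 : 0 <= s * n%:R by rewrite mulr_ge0// ltW.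
  have j1 : j%:R <= s * n%:R by rewrite truncn_le.
  have j2 : s * n%:R < j.+1%:R by exact: truncnS_gt.
  have jn : (j <= n)%N by rewrite -(ler_nat R) (le_trans j1)// ger_pMl.
  rewrite /S -bigcup_mkord; exists (i + j * 4)%N.
    by rewrite /= (mulnS 4 n) [(4 * n)%N]mulnC -addSn leq_add// leq_mul2r jn orbT.
  have jn01 : 0 <= (j%:R / n%:R : R) <= 1.
    by rewrite divr_ge0//= ler_pdivrMr// mul1r ler_nat.
  have zE : z (i + j * 4)%N = bcurve c i t (j%:R / n%:R).
    by rewrite /z addnC modnMDl modn_small// divnMDl// divn_small// addn0.
  have sj : `|s - j%:R / n%:R| <= eps.
    apply: le_trans nV; rewrite ger0_norm ?subr_ge0 ?ler_pdivrMr//.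
    rewrite -(ler_pM2r n0) mulrBl divfK ?gt_eqF// mulVf ?gt_eqF//.
    by move: j2; rewrite -natr1; clear -F; lra.
  have yz : `|y - z (i + j * 4)%N| <= L * eps.
    rewrite zE yE (le_trans (HL i t s _ tT s01 jn01))//.
    by rewrite ler_wpM2l.
  have : `|x - z (i + j * 4)%N| < r.
    apply: le_lt_trans (ler_distD y _ _) _; rewrite /r mulrDl.
    by apply: ltr_leD.
  rewrite norm_pair_lt /= !ltr_distl => /andP[/andP[h1 h2] /andP[h3 h4]].
  by split => /=; rewrite in_itv /=; apply/andP; split; exact: ltW.
pose f x := ramp (5 - eps^-1 * dist (B t) x).
have f01 x : 0 <= f x <= 1 := ramp01 _.
have [Y Y1 HY] := flow_box T.
have fi : mu2.-integrable (D t) (EFin \o f).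
  apply: (@bounded_cont_integrable R (D t) Y oD (HY t tT) f).
  exact: dist_ramp_cont.
have mD := open_plane_measurable oD.
have le1 : (\int[mu2]_(x in D t) (f x)%:E <= mu2 S)%E.
  apply: (@le_trans _ _ (\int[mu2]_(x in D t) (\1_S x)%:E)%E).
    apply: ge0_le_integral => //.
    - by move=> x _; rewrite lee_fin; case/andP: (f01 x).
    - by have /integrableP[] := fi.
    - by apply/measurable_EFinP; exact: measurable_indic.
    - move=> x Dx; rewrite lee_fin indicE.
      have [/cover Sx|dx] := ltP (dist (B t) x) (5 * eps).
        by rewrite mem_set; [case/andP: (f01 x)|exact: Sx].
      rewrite /f ramp0 ?ler0n// subr_le0 mulrC ler_pdivlMr//.
  rewrite integral_indic//; apply: le_measure; rewrite ?inE//.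
  exact: measurableI.
rewrite /Rintegral -lee_fin fineK; last exact: integrable_fin_num.
apply: le_trans le1 _; apply: le_trans muS _; rewrite lee_fin.
have -> : (4 * n.+1)%N%:R * (2 * r) ^+ 2 = 16 * r ^+ 2 * (n%:R + 1) :> R.
  by rewrite natrM -natr1; ring.
apply: (@le_trans _ _ (16 * r ^+ 2 * (3 * eps^-1))).
  by rewrite ler_pM2l// mulr_gt0// exprn_gt0.
rewrite /r le_eqVlt; apply/orP; left; apply/eqP; field.
by rewrite gt_eqF.
Qed.

End Layer.

(** * Transport of integrals over the moving domain *)

Section Transport.
Variable R : realType.
Local Notation plane := (R * R)%type.
Variables (c : R -> R -> plane) (D : R -> set plane).
Variables (u1 u1t u11 u12 u2 u2t u21 u22 : R -> plane -> R).
Hypothesis F : C1_flow c D u1 u1t u11 u12 u2 u2t u21 u22.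
Local Notation vel := (velocity u1 u2).
Local Notation B t := (bdry (D t)).

Lemma C1_field_bounded (T : R) f ft f1 f2 : C1_field D f ft f1 f2 ->
  exists2 M : R, 0 < M & forall (t : R) (x : plane), 0 <= t <= T -> closure (D t) x ->
    [/\ `|f t x| <= M, `|ft t x| <= M, `|f1 t x| <= M & `|f2 t x| <= M].
Proof.
move=> [[c0 c1 c2 c3] _].
have [M0 M00 H0] := field_bounded F T c0; have [M1 M10 H1] := field_bounded F T c1.
have [M2 M20 H2] := field_bounded F T c2; have [M3 M30 H3] := field_bounded F T c3.
exists (M0 + M1 + M2 + M3); first by rewrite !addr_gt0.
move=> t x tT cx.
have b0 := H0 t x tT cx; have b1 := H1 t x tT cx.
have b2 := H2 t x tT cx; have b3 := H3 t x tT cx.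
split; move: b0 b1 b2 b3 M00 M10 M20 M30; clear -F; lra.
Qed.

Lemma C1_field_unif (T e : R) f ft f1 f2 : C1_field D f ft f1 f2 -> 0 < e ->
  exists2 r : R, 0 < r & forall (t s : R) (x y : plane), 0 <= t <= T -> 0 <= s ->
    closure (D t) x -> closure (D s) y -> `|t - s| < r -> `|x - y| < r ->
    [/\ `|f t x - f s y| < e, `|ft t x - ft s y| < e,
        `|f1 t x - f1 s y| < e & `|f2 t x - f2 s y| < e].
Proof.
move=> [[c0 c1 c2 c3] _] e0.
have [r0 r00 H0] := field_unif F T c0 e0; have [r1 r10 H1] := field_unif F T c1 e0.
have [r2 r20 H2] := field_unif F T c2 e0; have [r3 r30 H3] := field_unif F T c3 e0.
exists (Num.min (Num.min r0 r1) (Num.min r2 r3)).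
  by rewrite !lt_min r00 r10 r20 r30.
move=> t s x y tT s0 cx cy; rewrite !lt_min => /andP[/andP[a0 a1] /andP[a2 a3]].
move=> /andP[/andP[b0 b1] /andP[b2 b3]].
by split; [exact: H0|exact: H1|exact: H2|exact: H3].
Qed.

Lemma tube (T rho : R) : 0 < rho -> exists2 h0 : R, 0 < h0 &
  forall (t s : R) (x : plane), 0 <= t <= T -> 0 <= s <= T -> `|s - t| < h0 ->
    D t x -> rho <= dist (B t) x -> forall z, `|x - z| < rho / 2 -> D s z.
Proof.
move=> rho0; have rho20 : 0 < rho / 2 by rewrite divr_gt0.
have [h0 h00 H] := no_drop F T rho20.
exists h0 => // t s x tT sT ts Dx dx z xz; have t0 : 0 <= t by case/andP: tT.
apply: (H t s z tT sT ts).
  apply: (in_ball_open (flow_open F t0) Dx (bdry_neq0 F t0) dx).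
  by move: xz rho0; clear -F; lra.
by have := dist_lip x z (bdry_neq0 F t0); move: dx xz; clear -F; lra.
Qed.

(** The displacement (a, b) is left free: it is the fluid velocity in the transport formula and the
    constant velocity of a moving frame in the maximum principle. *)
Lemma expansion (T rho e f0 : R) f ft f1 f2 : C1_field D f ft f1 f2 -> 0 < rho -> 0 < e -> 0 < f0 ->
  exists2 h0 : R, 0 < h0 & forall (t h a b : R) (x : plane), 0 < t <= T -> 0 < h < h0 ->
    D t x -> rho <= dist (B t) x -> `|a| <= f0 -> `|b| <= f0 ->
    `|f (t + h) (x.1 + h * a, x.2 + h * b) - f t x -
      h * (ft t x + a * f1 t x + b * f2 t x)| <= e * h.
Proof.
move=> Cf rho0 e0 f00.
have [h1 h10 Htube] := tube (T + 1) rho0.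
pose e1 := e / (1 + 2 * f0).
have den0 : 0 < 1 + 2 * f0 by rewrite addr_gt0// mulr_gt0.
have e10 : 0 < e1 by rewrite divr_gt0.
have [r r0 Hr] := C1_field_unif T Cf e10.
pose h0 := Num.min (Num.min (Num.min h1 1) (r / (1 + f0))) (rho / (4 * (1 + f0))).
have f10 : 0 < 1 + f0 by rewrite addr_gt0.
exists h0; first by rewrite /h0 !lt_min h10 ltr01 !divr_gt0// mulr_gt0.
move=> t h a b x /andP[t0 tT] /andP[hp]; rewrite /h0 !lt_min.
move=> /andP[/andP[/andP[hh1 hl1] hr] hrho] Dx dx af bf.
have hf : h * (1 + f0) < r by rewrite -ltr_pdivlMr.
have hf2 : h * (1 + f0) * 4 < rho.
  by rewrite mulrAC -mulrA -ltr_pdivlMr ?mulr_gt0// [4 * _]mulrC in hrho *.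
have tn := ltW t0.
have th0 : 0 < t + h by rewrite addr_gt0.
have tI : 0 <= t <= T + 1 by rewrite tn (le_trans tT)// lerDl.
have hfb : 0 <= h * f0 by rewrite mulr_ge0// ltW.
have inD s z : t <= s <= t + h -> `|x - z| <= h * f0 -> D s z /\ (`|t - s| < r /\ `|x - z| < r).
  move=> /andP[ts sh] xz.
  have s1 : `|s - t| <= h by rewrite ger0_norm ?subr_ge0// lerBlDl.
  split; last first.
    by rewrite distrC; split; [move: s1 hf hfb|move: xz hf hp]; clear -F; lra.
  apply: (Htube t s x) => //.
  - rewrite (le_trans tn ts)/=; move: sh tT hl1; clear -F; lra.
  - exact: le_lt_trans hh1.
  - by move: xz hf2 hp hfb rho0; clear -F; lra.
have unif s z : t <= s <= t + h -> `|x - z| <= h * f0 ->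
    [/\ `|ft t x - ft s z| < e1, `|f1 t x - f1 s z| < e1 & `|f2 t x - f2 s z| < e1].
  move=> ts xz; have [Dz [tr xr]] := inD s z ts xz.
  have s0 : 0 <= s by case/andP: ts => h1' _; exact: le_trans h1'.
  have tT' : 0 <= t <= T by rewrite tn.
  by have [] := Hr t s x z tT' s0 (subset_closure Dx) (subset_closure Dz) tr xr.
have [_ Hd] := Cf.
have btw p q z : `|z - p| <= `|p + h * q - p| -> `|q| <= f0 -> `|p - z| <= h * f0.
  rewrite [p + _ - p]addrC addKr distrC => h2 h3; apply: le_trans h2 _.
  by rewrite normrM (gtr0_norm hp) ler_wpM2l// ltW.
have [s h2|s [hs1 hs2 Es]] := @mean_value R (fun s => f s x) (fun s => ft s x) t (t + h).
  rewrite [t + h - t]addrC addKr in h2 *; rewrite (gtr0_norm hp) in h2 * => h3.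
  have ts : t <= s <= t + h.
    by move: h2 h3; rewrite !ler_distl; clear -F; lra.
  have [Ds _] : D s x /\ (`|t - s| < r /\ `|x - x| < r).
    by apply: inD => //; rewrite subrr normr0.
  have s0 : 0 < s by case/andP: ts => h1' _; exact: lt_le_trans h1'.
  by have [] := Hd s x s0 Ds.
rewrite [t + h - t]addrC addKr (gtr0_norm hp) in hs1 hs2 Es.
have ts : t <= s <= t + h by move: hs1 hs2; rewrite !ler_distl; clear -F; lra.
have tth : t <= t + h <= t + h by rewrite lexx lerDl ltW.
case: x Dx dx inD unif s ts Es {hs1 hs2} => x1 x2 Dx dx inD unif s ts Es.
have [p p1 p2|p [p1 p2 Ep]] := @mean_value R (fun p => f (t + h) (p, x2)) (fun p => f1 (t + h) (p, x2)) x1 (x1 + h * a).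
  have [Dp _] : D (t + h) (p, x2) /\ (`|t - (t + h)| < r /\ `|(x1, x2) - (p, x2)| < r).
    by apply: inD => //; rewrite norm_pair_le /= subrr normr0 hfb (btw x1 a).
  by have [] := Hd _ (p, x2) th0 Dp.
have [q q1 q2|q [q1 q2 Eq]] := @mean_value R (fun q => f (t + h) (x1 + h * a, q)) (fun q => f2 (t + h) (x1 + h * a, q)) x2 (x2 + h * b).
  have [Dp _] : D (t + h) (x1 + h * a, q) /\ (`|t - (t + h)| < r /\ `|(x1, x2) - (x1 + h * a, q)| < r).
    apply: inD => //; rewrite norm_pair_le /= (btw x2 b)// andbT.
    by rewrite opprD addNKr normrN normrM (gtr0_norm hp) ler_wpM2l// ltW.
  by have [] := Hd _ (x1 + h * a, q) th0 Dp.
rewrite [x1 + _ - x1]addrC addKr in Ep; rewrite [x2 + _ - x2]addrC addKr in Eq.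
have [U1 _ _] := unif s (x1, x2) ts (ltac:(by rewrite subrr normr0)).
have [_ U2 _] := unif (t + h) (p, x2) tth (ltac:(by rewrite norm_pair_le /= subrr normr0 hfb (btw x1 a))).
have [_ _ U3] := unif (t + h) (x1 + h * a, q) tth (ltac:(by rewrite norm_pair_le /= (btw x2 b)// andbT opprD addNKr normrN normrM (gtr0_norm hp) ler_wpM2l// ltW)).
have E : f (t + h) (x1 + h * a, x2 + h * b) - f t (x1, x2) -
    h * (ft t (x1, x2) + a * f1 t (x1, x2) + b * f2 t (x1, x2)) =
    - h * ((ft t (x1, x2) - ft s (x1, x2)) + a * (f1 t (x1, x2) - f1 (t + h) (p, x2)) +
      b * (f2 t (x1, x2) - f2 (t + h) (x1 + h * a, q))).
  have -> : f (t + h) (x1 + h * a, x2 + h * b) - f t (x1, x2) =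
    (f (t + h) (x1 + h * a, x2 + h * b) - f (t + h) (x1 + h * a, x2)) +
    (f (t + h) (x1 + h * a, x2) - f (t + h) (x1, x2)) + (f (t + h) (x1, x2) - f t (x1, x2)) by ring.
  by rewrite Es Ep Eq; ring.
rewrite /= E normrM normrN (gtr0_norm hp) mulrC ler_pM2r//.
apply: le_trans (ler_normD _ _) _.
have n1 := ler_normD (ft t (x1, x2) - ft s (x1, x2)) (a * (f1 t (x1, x2) - f1 (t + h) (p, x2))).
have n2 : `|a * (f1 t (x1, x2) - f1 (t + h) (p, x2))| <= f0 * e1.
  by rewrite normrM ler_pM// ltW.
have n3 : `|b * (f2 t (x1, x2) - f2 (t + h) (x1 + h * a, q))| <= f0 * e1.
  by rewrite normrM ler_pM// ltW.
have ee : e1 + 2 * f0 * e1 = e by rewrite /e1; field; rewrite gt_eqF.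
by move: n1 n2 n3 U1 ee; clear -F; lra.
Qed.

Definition cutoff (eps t : R) (x : plane) : R := ramp (eps^-1 * dist (B t) x - 1).

(** The cut-off has slope 1 / eps, but within 5 eps of the boundary the distance to it changes by
    only O(h eps) along a particle, by [distance_step]. The quotient is O(h) with a constant, 5 L,
    independent of eps; farther away the cut-off is 1 at both times. *)
Lemma cutoff_step (T : R) : exists2 eps0 : R, 0 < eps0 <= 1 & exists2 C : R, 0 < C &
  forall eps e : R, 0 < eps <= eps0 -> 0 < e ->
  exists2 h0 : R, 0 < h0 & exists2 eta : R, 0 < eta &
  forall (t h : R) (x y : plane), 0 < t <= T -> 0 < h < h0 -> D t x -> eps / 4 <= dist (B t) x ->
    `|y - (x + h *: vel t x)| <= eta * h ->
    D (t + h) y /\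
    `|cutoff eps (t + h) y - cutoff eps t x| <=
      h * (C * ramp (5 - eps^-1 * dist (B t) x) + e).
Proof.
have [d0 d00 [L L0 [_ Hstep]]] := distance_step F (T + 1).
have [U U0 HU] := dist_bdry_time_lip F (T + 1).
have [M1 M10 HM1] := C1_field_bounded (T + 1) (flow_u1 F).
have [M2 M20 HM2] := C1_field_bounded (T + 1) (flow_u2 F).
pose V := M1 + M2.
have V0 : 0 < V by rewrite addr_gt0.
have velV (t : R) (x : plane) : 0 <= t <= T + 1 -> D t x -> `|vel t x| <= V.
  move=> tT Dx; have cx : closure (D t) x by exact: subset_closure.
  have [h1 _ _ _] := HM1 t x tT cx; have [h2 _ _ _] := HM2 t x tT cx.
  by rewrite norm_pair_le /= /V; apply/andP; split; move: h1 h2 M10 M20; clear -F; lra.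
(* Distances up to 5 eps then stay in the range d0 where [distance_step] holds. *)
exists (Num.min 1 (d0 / 10)); first by rewrite lt_min ltr01 divr_gt0//= ge_min lexx.
exists (5 * L); first by rewrite mulr_gt0.
move=> eps e /andP[eps0]; rewrite le_min => /andP[eps1 epsd] e0.
pose eta := Num.min 1 (eps * e / 3).
have [eta0 eta1 eta3] : [/\ 0 < eta, eta <= 1 & 3 * eta <= eps * e].
  rewrite /eta lt_min ltr01 divr_gt0 ?mulr_gt0// ge_min lexx; split => //.
  by rewrite mulrC -ler_pdivlMr// ge_min lexx orbT.
have [h1 h10 H1] := Hstep _ eta0.
have eps40 : 0 < eps / 4 by rewrite divr_gt0.
have [h2 h20 H2] := tube (T + 1) eps40.
have [r1 r10 Hr1] := C1_field_unif (T + 1) (flow_u1 F) eta0.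
have [r2 r20 Hr2] := C1_field_unif (T + 1) (flow_u2 F) eta0.
pose W := U + V + 1.
have W0 : 0 < W by rewrite /W !addr_gt0.
pose h0 := Num.min (Num.min (Num.min h1 h2) (Num.min (r1 / W) (r2 / W))) (Num.min 1 (eps / (10 * W))).
exists h0.
  by rewrite /h0 !lt_min h10 h20 ltr01 !divr_gt0 ?mulr_gt0.
exists eta => // t h x y /andP[t0 tT] /andP[hp]; rewrite /h0 !lt_min.
move=> /andP[/andP[/andP[hh1 hh2] /andP[hr1 hr2]] /andP[hl1 heps]] Dx dx yx.
rewrite ltr_pdivlMr// in hr1; rewrite ltr_pdivlMr// in hr2.
have hW : h * W * 10 < eps by rewrite ltr_pdivlMr ?mulr_gt0// in heps; rewrite -mulrA [W * 10]mulrC.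
have tn := ltW t0; have thp : 0 < t + h by rewrite addr_gt0.
have thn := ltW thp.
have tI : 0 < t <= T + 1 by rewrite t0 (le_trans tT)// lerDl.
have thT : t + h <= T + 1 by rewrite lerD// ltW.
have thI : 0 < t + h <= T + 1 by rewrite thp thT.
have tI' : 0 <= t <= T + 1 by rewrite tn; case/andP: tI.
have thI' : 0 <= t + h <= T + 1 by rewrite thn thT.
have hU0 : 0 < h * U by rewrite mulr_gt0.
have hV0 : 0 < h * V by rewrite mulr_gt0.
have WE : h * W = h * U + h * V + h by rewrite /W; ring.
have etah : eta * h <= h by rewrite ger_pMl.
have hv : `|h *: vel t x| <= h * V.
  by rewrite normrZ (gtr0_norm hp) ler_wpM2l ?(ltW hp)// velV.
have xy : `|x - y| <= h * V + eta * h.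
  have := ler_distD (x + h *: vel t x) x y; rewrite (distrC (x + _) y).
  have -> : x - (x + h *: vel t x) = - (h *: vel t x) by rewrite opprD addNKr.
  by rewrite normrN; move: hv yx; clear -F; lra.
have nh : `|t + h - t| = h by rewrite [t + h - t]addrC addKr gtr0_norm.
have Dy : D (t + h) y.
  apply: (H2 t (t + h) x) => //; first by rewrite nh.
  by move: xy hW WE hU0 hp etah eps0; clear -F; lra.
split => //.
have B0 := bdry_neq0 F tn; have Bh0 := bdry_neq0 F thn.
set d := dist (B t) x in dx *; set d' := dist (B (t + h)) y.
have epsV : 0 < eps^-1 by rewrite invr_gt0.
have dd1 : d <= d' + h * W.
  have := dist_lip x y B0; have := HU t (t + h) y tI' thI'.
  by rewrite distrC nh -/d -/d'; move: xy WE etah; clear -F; lra.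
have dd2 : d' <= d + h * W.
  have := dist_lip y x Bh0; have := HU (t + h) t x thI' tI'.
  by rewrite nh -/d -/d' (distrC y); move: xy WE etah; clear -F; lra.
have hWp : 0 < h * W by rewrite mulr_gt0.
have /andP[ra0 ra1] := ramp01 (5 - eps^-1 * d).
have [dlarge|dsmall] := leP (4 * eps) d.
  have big w : 2 * eps <= w -> ramp (eps^-1 * w - 1) = 1.
    move=> ew; apply: ramp1; rewrite lerBrDr mulrC ler_pdivlMr//.
  have bd : ramp (eps^-1 * d - 1) = 1 by apply: big; move: dlarge eps0; clear -F; lra.
  have bd' : ramp (eps^-1 * d' - 1) = 1.
    by apply: big; move: dlarge eps0 dd1 hW; clear -F; lra.
  rewrite /cutoff -/d -/d' bd bd' subrr normr0.
  by rewrite mulr_ge0 ?(ltW hp)// addr_ge0 ?(ltW e0)// !mulr_ge0// ltW.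
have -> : ramp (5 - eps^-1 * d) = 1.
  apply: ramp1; rewrite lerBrDr addrC -lerBrDr mulrC ler_pdivrMr//.
  by move: dsmall; clear -F; lra.
rewrite mulr1.
have dd0 : d < d0 by move: dsmall epsd eps0; clear -F; lra.
have d'5 : d' < 5 * eps by move: dsmall dd2 hW eps0; clear -F; lra.
have d'd0 : d' < d0 by move: d'5 epsd eps0 d00; clear -F; lra.
have lo := H1 t h x tI thI; rewrite (gtr0_norm hp) -/d in lo.
have {}lo := lo hh1 Dx dd0.
have lo2 := dist_lip (x + h *: vel t x) y Bh0; rewrite -/d' (distrC (x + _) y) in lo2.
(* The upper bound on the new distance is the lower bound for the step backwards in time from y. *)
have up := H1 (t + h) (- h) y thI; rewrite addrK normrN (gtr0_norm hp) -/d' in up.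
have {}up := up tI hh1 Dy d'd0.
have vv : `|vel t x - vel (t + h) y| <= eta.
  have th : `|t - (t + h)| = h by rewrite distrC.
  have a1 : `|t - (t + h)| < r1 by rewrite th; move: hr1 hU0 hV0 WE; clear -F; lra.
  have a2 : `|t - (t + h)| < r2 by rewrite th; move: hr2 hU0 hV0 WE; clear -F; lra.
  have b1 : `|x - y| < r1 by move: xy etah hr1 hU0 WE; clear -F; lra.
  have b2 : `|x - y| < r2 by move: xy etah hr2 hU0 WE; clear -F; lra.
  have [k1 _ _ _] := Hr1 t (t + h) x y tI' thn (subset_closure Dx) (subset_closure Dy) a1 b1.
  have [k2 _ _ _] := Hr2 t (t + h) x y tI' thn (subset_closure Dx) (subset_closure Dy) a2 b2.
  by rewrite norm_pair_le /= !ltW.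
have back : `|y + - h *: vel (t + h) y - x| <= 2 * eta * h.
  have -> : y + - h *: vel (t + h) y - x =
      (y - (x + h *: vel t x)) + h *: (vel t x - vel (t + h) y).
    by rewrite scaleNr scalerBr opprD !addrA subrK addrAC.
  apply: le_trans (ler_normD _ _) _; rewrite normrZ (gtr0_norm hp).
  have : h * `|vel t x - vel (t + h) y| <= h * eta by rewrite ler_wpM2l// ltW.
  by move: yx; clear -F; lra.
have up2 := dist_lip (y + - h *: vel (t + h) y) x B0; rewrite -/d in up2.
have hL : 0 < h * L by rewrite mulr_gt0.
have hLd : h * L * d <= h * L * (5 * eps) by rewrite (ler_pM2l hL); move: dsmall eps0; clear -F; lra.
have hLd' : h * L * d' <= h * L * (5 * eps) by rewrite (ler_pM2l hL) ltW.
have dd : `|d' - d| <= h * (5 * eps * L + 3 * eta).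
  rewrite ler_norml; apply/andP; split.
    have heta0 := mulr_gt0 hp eta0.
    by move: lo lo2 yx hLd heta0; clear -F; lra.
  by move: up up2 back hLd'; clear -F; lra.
apply: le_trans (ramp_lip _ _) _; rewrite -/d -/d'.
have -> : eps^-1 * d' - 1 - (eps^-1 * d - 1) = eps^-1 * (d' - d) by ring.
rewrite normrM (gtr0_norm epsV) mulrC ler_pdivrMr//; apply: le_trans dd _.
have : h * (3 * eta) <= h * (eps * e) by rewrite ler_pM2l.
by clear -F; lra.
Qed.

End Transport.

Section CutTransport.
Variable R : realType.
Local Notation plane := (R * R)%type.

Lemma perturbed_product (f f' chi chi' j P lam h M C e : R) : 0 < h -> 0 <= lam -> 0 <= C -> 0 <= e ->
  `|f'| <= M -> 0 <= chi <= 1 -> 0 <= chi' <= 1 -> `|f' - f - h * P| <= e * h ->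
  `|chi' - chi| <= h * (C * lam + e) -> `|j - 1| <= e * h ->
  `|f' * chi' * j - f * chi - h * P * chi| <= h * (M * C * lam + (2 * M + 1) * e).
Proof.
move=> h0 l0 C0 e0 fM /andP[c0 c1] /andP[c'0 c'1] H1 H2 H3.
have -> : f' * chi' * j - f * chi - h * P * chi =
  f' * (chi' * (j - 1)) + f' * (chi' - chi) + (f' - f - h * P) * chi by ring.
have M0 : 0 <= M by apply: le_trans fM.
have n1 : `|f' * (chi' * (j - 1))| <= M * (e * h).
  rewrite normrM ler_pM// normrM (ger0_norm c'0) -[leRHS]mul1r ler_pM//.
have n2 : `|f' * (chi' - chi)| <= M * (h * (C * lam + e)) by rewrite normrM ler_pM.
have n3 : `|(f' - f - h * P) * chi| <= e * h * 1.
  by rewrite normrM (ger0_norm c0) ler_pM.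
have := ler_normD (f' * (chi' * (j - 1)) + f' * (chi' - chi)) ((f' - f - h * P) * chi).
have := ler_normD (f' * (chi' * (j - 1))) (f' * (chi' - chi)).
have -> : h * (M * C * lam + (2 * M + 1) * e) =
  M * (e * h) + M * (h * (C * lam + e)) + e * h * 1 by ring.
by move: n1 n2 n3; lra.
Qed.

Variables (c : R -> R -> plane) (D : R -> set plane).
Variables (u1 u1t u11 u12 u2 u2t u21 u22 : R -> plane -> R).
Hypothesis F : C1_flow c D u1 u1t u11 u12 u2 u2t u21 u22.
Local Notation vel := (velocity u1 u2).
Local Notation B t := (bdry (D t)).
Local Notation cutoff := (cutoff D).

(** Extended by zero outside the fluid, so that integrals at different times are over one and the
    same plane. *)
Definition cutf (eps : R) (f : R -> plane -> R) (t : R) : plane -> R :=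
  (fun x => f t x * cutoff eps t x) \_ (D t).

Definition material (ft f1 f2 : R -> plane -> R) (t : R) (x : plane) : R :=
  ft t x + u1 t x * f1 t x + u2 t x * f2 t x.

Lemma cutoff_layer (eps t : R) (x : plane) :
  1 - cutoff eps t x <= ramp (5 - eps^-1 * dist (B t) x).
Proof.
rewrite /cutoff; case: (leP (eps^-1 * dist (B t) x) 4) => h.
  have /andP[h0 _] := ramp01 (eps^-1 * dist (B t) x - 1).
  rewrite (_ : ramp (5 - _) = 1); first by move: h0; clear -F; lra.
  by apply: ramp1; move: h; clear -F; lra.
rewrite ramp1; last by move: h; clear -F; lra.
by rewrite subrr; case/andP: (ramp01 (5 - eps^-1 * dist (B t) x)).
Qed.

Lemma cut_neq0 (eps : R) f (t : R) (x : plane) : 0 < eps -> cutf eps f t x != 0 ->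
  D t x /\ eps <= dist (B t) x.
Proof.
move=> eps0; rewrite /cutf patchE; case: ifPn => [/set_mem Dx|_]; last by rewrite eqxx.
rewrite mulf_eq0 negb_or => /andP[_ h]; split => //.
rewrite leNgt; apply/negP => dx; move/negP: h; apply.
rewrite /cutoff ramp0// subr_le0 mulrC ler_pdivrMr// mul1r; exact: ltW.
Qed.

Lemma cut_in (eps : R) f (t : R) (x : plane) : D t x -> cutf eps f t x = f t x * cutoff eps t x.
Proof. by move=> Dx; rewrite /cutf patchE mem_set. Qed.

(** The cut field at time t + h after the vertical shear of [plane_substitution], times its
    Jacobian. Composed with the horizontal shear, it is the field pulled back along the flow, up to
    o(h). *)
Definition pushed (eps : R) (f : R -> plane -> R) (t h : R) : plane -> R :=
  (fun y => cutf eps f (t + h) (y.1, y.2 + h * u2 t y) * (1 + h * u22 t y)) \_ (D t).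

(** The pulled-back cut field grows at the rate of the material derivative. In the boundary layer
    the error is only O(h), but the ramp records where this happens and its integral is O(eps). *)
Lemma cut_step (T : R) f ft f1 f2 : C1_field D f ft f1 f2 ->
  exists2 eps0 : R, 0 < eps0 <= 1 & exists2 C : R, 0 < C &
  forall eps e : R, 0 < eps <= eps0 -> 0 < e -> exists2 h0 : R, 0 < h0 &
  forall (t h : R) (x : plane), 0 < t <= T -> 0 < h < h0 -> D t x ->
    `|pushed eps f t h (x.1 + h * u1 t x, x.2) * (1 + h * u11 t x) - cutf eps f t x -
      h * material ft f1 f2 t x| <= h * (C * ramp (5 - eps^-1 * dist (B t) x) + e).
Proof.
move=> Cf.
have [eps0 eps01 [C1 C10 Hchi]] := cutoff_step F T.
have [U U0 HU] := dist_bdry_time_lip F (T + 1).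
have [M1 M10 HM1] := C1_field_bounded F (T + 1) (flow_u1 F).
have [M2 M20 HM2] := C1_field_bounded F (T + 1) (flow_u2 F).
have [M3 M30 HM3] := C1_field_bounded F (T + 1) Cf.
pose M := M1 + M2 + M3.
have M0 : 0 < M by rewrite !addr_gt0.
have HM (t : R) (x : plane) : 0 <= t <= T + 1 -> D t x ->
    [/\ [/\ `|u1 t x| <= M, `|u11 t x| <= M, `|u2 t x| <= M & `|u22 t x| <= M],
        `|f t x| <= M & [/\ `|ft t x| <= M, `|f1 t x| <= M & `|f2 t x| <= M]].
  move=> tT Dx; have cx : closure (D t) x by exact: subset_closure.
  have [a1 _ a2 _] := HM1 t x tT cx; have [b1 _ _ b2] := HM2 t x tT cx.
  have [d1 d2 d3 d4] := HM3 t x tT cx; rewrite /M.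
  by split; [split|idtac|split]; move: a1 a2 b1 b2 d1 d2 d3 d4 M10 M20 M30; clear -F; lra.
exists eps0 => //; exists (M * C1 + (M + 2 * M * M)); first by rewrite !addr_gt0 ?mulr_gt0.
move=> eps e epsI e0; have /andP[eps_gt0 _] := epsI.
pose e1 := e / (2 * M + 1).
have den0 : 0 < 2 * M + 1 by rewrite addr_gt0// mulr_gt0.
have e10 : 0 < e1 by rewrite divr_gt0.
have [h1 h10 [eta eta0 H1]] := Hchi eps e1 epsI e10.
pose e2 := Num.min eta (e1 / (2 * (M + 1))).
have M10' : 0 < 2 * (M + 1) by rewrite mulr_gt0// addr_gt0.
have e20 : 0 < e2 by rewrite lt_min eta0 divr_gt0.
have e2eta : e2 <= eta by rewrite ge_min lexx.
have e2e1 : e2 * (2 * (M + 1)) <= e1 by rewrite -ler_pdivlMr// ge_min lexx orbT.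
have [r r0 Hr] := C1_field_unif F (T + 1) (flow_u2 F) e20.
have eps40 : 0 < eps / 4 by rewrite divr_gt0.
have e120 : 0 < e1 / 2 by rewrite divr_gt0.
have [h2 h20 H2] := tube F (T + 1) eps40.
have [h3 h30 H3] := expansion F T Cf eps40 e120 M0.
pose W := U + M + 1.
have W0 : 0 < W by rewrite !addr_gt0.
pose h0 := Num.min (Num.min (Num.min h1 h2) (Num.min h3 1))
  (Num.min (Num.min (r / W) (eps / (10 * W))) (e1 / (2 * M * M))).
have MM0 : 0 < 2 * M * M by rewrite !mulr_gt0.
have W100 : 0 < 10 * W by rewrite mulr_gt0.
exists h0; first by rewrite /h0 !lt_min h10 h20 h30 ltr01 !divr_gt0.
move=> t h x /andP[t0 tT] /andP[hp]; rewrite /h0 !lt_min.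
move=> /andP[/andP[/andP[hh1 hh2] /andP[hh3 hl1]] /andP[/andP[hr heps] hMM]] Dx.
set G2 := pushed eps f t h.
rewrite ltr_pdivlMr// in hr; rewrite ltr_pdivlMr// in heps; rewrite ltr_pdivlMr// in hMM.
have tn := ltW t0; have hn := ltW hp; have th0 : 0 < t + h by rewrite addr_gt0.
have tI : 0 <= t <= T + 1 by rewrite tn (le_trans tT)// lerDl.
have tI' : 0 <= t + h <= T + 1 by rewrite (ltW th0) lerD// ltW.
have tI2 : 0 < t <= T by rewrite t0.
have WE : h * W = h * U + h * M + h by rewrite /W; ring.
have hU0 : 0 < h * U by rewrite mulr_gt0.
have hM0 : 0 < h * M by rewrite mulr_gt0.
set lam := ramp _.
have /andP[lam0 lam1] : 0 <= lam <= 1 by exact: ramp01.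
have [[a1 a2 a3 a4] a5 [a6 a7 a8]] := HM t x tI Dx.
set P := material ft f1 f2 t x.
have PM : `|P| <= M + 2 * M * M.
  have n1 : `|u1 t x * f1 t x| <= M * M by rewrite normrM ler_pM.
  have n2 : `|u2 t x * f2 t x| <= M * M by rewrite normrM ler_pM.
  have := ler_normD (ft t x + u1 t x * f1 t x) (u2 t x * f2 t x).
  have := ler_normD (ft t x) (u1 t x * f1 t x).
  by rewrite -/P; move: n1 n2 a6; clear -F; lra.
set z := (x.1 + h * u1 t x, x.2).
have hMv v : `|v| <= M -> `|h * v| <= h * M by move=> vM; rewrite normrM gtr0_norm// ler_wpM2l.
have xz : `|x - z| <= h * M.
  rewrite norm_pair_le /= subrr normr0 (ltW hM0) andbT opprD addNKr normrN.
  exact: hMv.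
have Bt0 := bdry_neq0 F tn; have Bth0 := bdry_neq0 F (ltW th0).
have nh : `|t + h - t| = h by rewrite [t + h - t]addrC addKr gtr0_norm.
(* Here x is too close to the boundary for [expansion]. But the cut field vanishes at time t and,
   after a step of length O(h), still does at time t + h, so only the bounded material derivative is
   left. *)
have [dsmall|dlarge] := ltP (dist (B t) x) (eps / 4).
  have cx : cutoff eps t x = 0.
    rewrite /cutoff ramp0// subr_le0 mulrC ler_pdivrMr// mul1r.
    by move: dsmall eps_gt0; clear -F; lra.
  have l1 : lam = 1.
    apply: ramp1; have : eps^-1 * dist (B t) x <= 1.
      by rewrite mulrC ler_pdivrMr// mul1r; move: dsmall eps_gt0; clear -F; lra.
    by clear -F; lra.
  have Gz : G2 z = 0.
    rewrite /G2 /pushed patchE; case: ifPn => [/set_mem Dz|//].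
    set y := (z.1, z.2 + h * u2 t z).
    suff -> : cutf eps f (t + h) y = 0 by rewrite mul0r.
    apply/eqP; apply: contraT => /(cut_neq0 eps_gt0)[Dy dy].
    have [[_ _ b3 _] _ _] := HM t z tI Dz.
    have zy : `|z - y| <= h * M.
      by rewrite norm_pair_le /= subrr normr0 (ltW hM0)/= opprD addNKr normrN hMv.
    have := dist_lip y x Bth0; have := HU (t + h) t x tI' tI; rewrite nh.
    have := ler_distD z y x; rewrite (distrC y z) (distrC z x).
    move: dsmall eps_gt0 dy zy xz heps WE hU0 hM0 hp; clear -F; lra.
  rewrite Gz mul0r cut_in// cx mulr0 subrr sub0r normrN normrM (gtr0_norm hp).
  rewrite ler_pM2l// l1 mulr1; have := mulr_gt0 M0 C10.
  by move: PM e0; clear -F; lra.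
have hW8 : h * M < eps / 4 / 2 by move: heps WE hU0 hp eps_gt0; clear -F; lra.
have Dz : D t z.
  apply: (H2 t t x) => //; first by rewrite subrr normr0.
  exact: le_lt_trans hW8.
have [[_ _ b3 b4] _ _] := HM t z tI Dz.
have [uu _ _ uu2] : [/\ `|u2 t x - u2 t z| < e2, `|u2t t x - u2t t z| < e2,
    `|u21 t x - u21 t z| < e2 & `|u22 t x - u22 t z| < e2].
  apply: Hr => //; [exact: subset_closure|exact: subset_closure|by rewrite subrr normr0|].
  by move: xz hr WE hU0 hp; clear -F; lra.
set y := (z.1, z.2 + h * u2 t z).
have E2 := H3 t h (u1 t x) (u2 t z) x tI2.
have {}E2 := E2 (ltac:(by rewrite hp hh3)) Dx dlarge a1 b3.
rewrite -/y in E2.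
have yx : `|y - (x + h *: vel t x)| <= eta * h.
  rewrite norm_pair_le /= subrr normr0 mulr_ge0 ?(ltW eta0)//=.
  have -> : x.2 + h * u2 t z - (x.2 + h *: u2 t x) = - (h * (u2 t x - u2 t z)).
    by rewrite /GRing.scale /=; ring.
  rewrite normrN normrM (gtr0_norm hp) mulrC ler_wpM2r//.
  by apply: ltW; apply: lt_le_trans e2eta.
have [Dy Echi] := H1 t h x y tI2 (ltac:(by rewrite hp hh1)) Dx dlarge yx.
have [_ fy _] := HM (t + h) y tI' Dy.
have [adiv _] := flow_div_curl F t0 Dx.
have Gz : G2 z = f (t + h) y * cutoff eps (t + h) y * (1 + h * u22 t z).
  by rewrite /G2 /pushed patchE mem_set// cut_in.
rewrite Gz cut_in// -mulrA.
set j := (1 + h * u22 t z) * (1 + h * u11 t x).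
(* Incompressibility cancels the first-order terms of the two Jacobians. *)
have Ej : `|j - 1| <= e1 * h.
  have -> : j - 1 = h * (- (u22 t x - u22 t z) + h * (u22 t z * u11 t x)).
    rewrite /j; have -> : u11 t x = - u22 t x by apply/eqP; rewrite -subr_eq0 opprK adiv.
    ring.
  rewrite normrM (gtr0_norm hp) mulrC ler_wpM2r//.
  have n1 : `|h * (u22 t z * u11 t x)| <= h * (M * M).
    by rewrite normrM (gtr0_norm hp) ler_wpM2l// normrM ler_pM.
  have := ler_normD (- (u22 t x - u22 t z)) (h * (u22 t z * u11 t x)).
  rewrite normrN; have := mulr_gt0 e20 M0.
  by move: n1 uu2 e2e1 hMM e10; clear -F; lra.
have Ef : `|f (t + h) y - f t x - h * P| <= e1 * h.
  set P' := ft t x + u1 t x * f1 t x + u2 t z * f2 t x in E2.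
  have -> : f (t + h) y - f t x - h * P =
    (f (t + h) y - f t x - h * P') + h * ((u2 t z - u2 t x) * f2 t x).
    by rewrite /P /P' /material; ring.
  have n1 : `|h * ((u2 t z - u2 t x) * f2 t x)| <= h * (e2 * M).
    by rewrite normrM (gtr0_norm hp) ler_wpM2l// normrM ler_pM// distrC ltW.
  have := ler_normD (f (t + h) y - f t x - h * P') (h * ((u2 t z - u2 t x) * f2 t x)).
  have : h * (e2 * (2 * (M + 1))) <= h * e1 by rewrite ler_wpM2l.
  by have := mulr_gt0 hp e20; move: n1 E2; clear -F; lra.
have kx : 0 <= cutoff eps t x <= 1 by exact: ramp01.
have ky : 0 <= cutoff eps (t + h) y <= 1 by exact: ramp01.
have Eall := perturbed_product hp lam0 (ltW C10) (ltW e10) fy kx ky Ef Echi Ej.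
have e1e : (2 * M + 1) * e1 = e by rewrite /e1; field; rewrite gt_eqF.
rewrite e1e in Eall.
have splitE (q q' k : R) : q - q' - h * P = (q - q' - h * P * k) - h * (P * (1 - k)) by ring.
rewrite (splitE _ _ (cutoff eps t x)).
have n1 : `|h * (P * (1 - cutoff eps t x))| <= h * ((M + 2 * M * M) * lam).
  rewrite normrM (gtr0_norm hp) ler_wpM2l// normrM ler_pM//.
  have /andP[k0 k1] := kx.
  by rewrite ger0_norm ?subr_ge0//; exact: cutoff_layer.
set q1 := (X in `|X - _|); set q2 := (X in `|_ - X|).
have := ler_normB q1 q2; move: Eall n1; rewrite -/q1 -/q2.
rewrite !mulrDr !mulrDl !mulrDr; clear -F; lra.
Qed.

End CutTransport.

Section Transported.
Variable R : realType.
Local Notation plane := (R * R)%type.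
Local Notation mu2 := (@lebesgue_measure R \x @lebesgue_measure R)%E.

Lemma pint_area (A : set plane) (Y : R) : open A -> 0 <= Y ->
  (forall x, A x -> 0 <= x.1 <= 1 /\ 0 <= x.2 <= Y) -> 0 <= \int[mu2]_(x in A) (1:R) <= Y.
Proof.
move=> oA Y0 AY; have mA := open_plane_measurable oA.
rewrite /Rintegral integral_cst// mul1e.
have le : (mu2 A <= Y%:E)%E.
  have -> : (Y%:E = mu2 (`[0%R, 1%R] `*` `[0%R, Y]))%E.
    by rewrite box_measure// !subr0 mul1r.
  apply: le_measure => [||x /AY[h1 h2]]; last by split; rewrite /= in_itv.
    by rewrite inE.
  by rewrite inE; apply: measurableX; exact: measurable_itv.
have m0 : (0 <= mu2 A)%E by exact: measure_ge0.
have fin : mu2 A \is a fin_num by rewrite ge0_fin_numE// (le_lt_trans le)// ltry.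
by rewrite fine_ge0//= -lee_fin fineK.
Qed.

Variables (c : R -> R -> plane) (D : R -> set plane).
Variables (u1 u1t u11 u12 u2 u2t u21 u22 : R -> plane -> R).
Hypothesis F : C1_flow c D u1 u1t u11 u12 u2 u2t u21 u22.
Local Notation B t := (bdry (D t)).
Local Notation K := (spacetime D).
Local Notation cutoff := (cutoff D).
Local Notation cutf := (cutf D).
Local Notation material := (material u1 u2).

Lemma field_slice (f : R -> plane -> R) (t : R) : cont_on K (fun z => f z.1 z.2) -> 0 <= t ->
  cont_on (closure (D t)) (f t).
Proof.
move=> cf t0; apply: (@cont_on_comp _ _ _ _ _ K (fun x => (t, x)) (fun z => f z.1 z.2)) => //.
by apply: cont_on_pair; [exact: cont_on_cst|exact: cont_on_id].
Qed.

Lemma field_slice_in (f : R -> plane -> R) (t : R) : cont_on K (fun z => f z.1 z.2) -> 0 <= t ->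
  cont_on (D t) (f t).
Proof. by move=> cf t0; apply: cont_onS (field_slice cf t0); exact: subset_closure. Qed.

Lemma field_bounded_cont (f : R -> plane -> R) (t : R) : cont_on K (fun z => f z.1 z.2) ->
  0 <= t -> bounded_cont (D t) (f t).
Proof.
move=> cf t0; split; first exact: field_slice_in.
have [M _ HM] := field_bounded F t cf; exists M => x Dx.
by apply: HM; [rewrite t0/= |exact: subset_closure].
Qed.

Lemma flow_box1 (t : R) : 0 <= t -> exists2 Y : R, 1 <= Y &
  forall x, D t x -> 0 <= x.1 <= 1 /\ 0 <= x.2 <= Y.
Proof.
move=> t0; have [Y Y1 H] := flow_box F t; exists Y => //; apply: H; by rewrite t0/=.
Qed.

Lemma cutoff_cont (eps t : R) : 0 <= t -> cont_on setT (cutoff eps t).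
Proof.
move=> t0; apply: (@cont_on_comp _ _ _ _ _ setT (fun x => eps^-1 * dist (B t) x - 1) (@ramp R)) => //.
  apply: cont_onB; last exact: cont_on_cst.
  by apply: cont_onM; [exact: cont_on_cst|exact: dist_cont (bdry_neq0 F t0)].
exact: ramp_cont.
Qed.

Lemma cut_bound (eps t M : R) f (x : plane) : 0 <= M -> (D t x -> `|f t x| <= M) -> `|cutf eps f t x| <= M.
Proof.
move=> M0 H; rewrite /cutf patchE; case: ifPn => [/set_mem Dx|_]; last by rewrite normr0.
rewrite normrM -[M]mulr1 ler_pM//; first exact: H.
by have /andP[k0 k1] : 0 <= cutoff eps t x <= 1 by [exact: ramp01]; rewrite ger0_norm.
Qed.

Lemma cut_cont (eps t : R) f : 0 < eps -> 0 <= t -> cont_on (D t) (f t) ->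
  cont_on setT (cutf eps f t).
Proof.
move=> eps0 t0 cf x _ e e0.
have [Dx|nDx] := pselect (D t x).
  have [r1 r10 H1] : exists2 r : R, 0 < r & forall y, `|x - y| < r -> D t y.
    by have /open_normP := flow_open F t0; apply.
  have cp : cont_on (D t) (fun x => f t x * cutoff eps t x).
    by apply: cont_onM => //; apply: cont_onS (cutoff_cont eps t0).
  have [r2 r20 H2] := cp x Dx e e0.
  exists (Num.min r1 r2); first by rewrite lt_min r10.
  move=> y _; rewrite lt_min => /andP[xy1 xy2].
  by rewrite !cut_in//; [apply: H2 => //|]; exact: H1.
exists eps => // y _ xy.
have -> : cutf eps f t x = 0 by rewrite /cutf patchE memNset.
suff -> : cutf eps f t y = 0 by rewrite subrr normr0.
apply/eqP; apply: contraT => /(cut_neq0 eps0)[Dy dy].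
case: nDx; apply: in_ball_open (flow_open F t0) Dy (bdry_neq0 F t0) dy _.
by rewrite distrC.
Qed.

Definition Fe (eps : R) (f : R -> plane -> R) (t : R) : R := \int[mu2]_x cutf eps f t x.

Lemma Fe_on (A : set plane) (eps : R) f (t : R) :
  (forall x, cutf eps f t x != 0 -> A x) -> \int[mu2]_(x in A) cutf eps f t x = Fe eps f t.
Proof.
move=> H; rewrite /Fe /Rintegral integral_mkcond; congr fine; apply: eq_integral => x _.
rewrite patchE; case: ifPn => // /negP nA; congr EFin; apply/esym/eqP.
by apply: contraT => /H Ax; case: nA; exact: mem_set.
Qed.

Lemma material_cont ft f1 f2 : cont_on K (fun z => ft z.1 z.2) ->
  cont_on K (fun z => f1 z.1 z.2) -> cont_on K (fun z => f2 z.1 z.2) ->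
  cont_on K (fun z => material ft f1 f2 z.1 z.2).
Proof.
have [[c1 _ _ _] _] := flow_u1 F; have [[c2 _ _ _] _] := flow_u2 F.
by move=> a1 a2 a3; apply: cont_onD; [apply: cont_onD => //|]; exact: cont_onM.
Qed.

Lemma cut_bounded_cont (A : set plane) (eps t : R) f : 0 < eps -> 0 <= t ->
  cont_on K (fun z => f z.1 z.2) -> bounded_cont A (cutf eps f t).
Proof.
move=> eps0 t0 cf; split.
  apply: (@cont_onS _ _ _ _ setT) => //; apply: cut_cont => //; exact: field_slice_in.
have [M M0 HM] := field_bounded F t cf; exists M => x _; apply: cut_bound; first exact: ltW.
by move=> Dx; apply: HM; [rewrite t0/= |exact: subset_closure].
Qed.

(** The change of variables turns the integral at time t + h into one over [D t], where the
    pointwise bound of [cut_step] is integrated. The domain moves with the fluid, hence no boundary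
    flux appears; the layer contributes [C * eps]. *)
Lemma transport (T : R) f ft f1 f2 : C1_field D f ft f1 f2 ->
  exists2 eps0 : R, 0 < eps0 <= 1 & exists2 C : R, 0 < C &
  forall eps t e : R, 0 < eps <= eps0 -> 0 < t <= T -> 0 < e -> exists2 h0 : R, 0 < h0 &
  forall h : R, 0 < h < h0 ->
    `|Fe eps f (t + h) - Fe eps f t - h * \int[mu2]_(x in D t) material ft f1 f2 t x|
      <= h * (C * eps + e).
Proof.
move=> Cf; have [[cf cft cf1 cf2] _] := Cf.
have [eps0 eps01 [C C0 HC]] := cut_step F T Cf.
have [CL CL0 HL] := layer_integral F T.
exists eps0 => //; exists (C * CL); first exact: mulr_gt0.
move=> eps t e epsI /andP[t0 tT] e0; have /andP[eps_gt0 epsle] := epsI.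
have tn := ltW t0; have [Y Y1 EY] := flow_box1 tn; have oE := flow_open F tn.
have tI : 0 <= t <= T by rewrite tn.
have Y0 : 0 <= Y by apply: le_trans Y1.
set A := \int[mu2]_(x in D t) (1 : R).
have /andP[A0 _] : 0 <= A <= Y by exact: pint_area.
have A1 : 0 < 1 + A by rewrite ltr_wpDr.
pose e1 := e / (1 + A); have e10 : 0 < e1 by rewrite divr_gt0.
have [h1 h10 H1] := HC eps e1 epsI e10.
have [h2 h20 H2] := tube F (T + 1) eps_gt0.
have [M1 M10 HM1] := C1_field_bounded F t (flow_u1 F).
have [M2 M20 HM2] := C1_field_bounded F t (flow_u2 F).
pose M := M1 + M2; have M0 : 0 < M by rewrite addr_gt0.
have tt : 0 <= t <= t by rewrite tn/=.
have HM x : D t x -> [/\ `|u1 t x| <= M, `|u11 t x| <= M, `|u2 t x| <= M & `|u22 t x| <= M].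
  move=> Dx; have cx : closure (D t) x by exact: subset_closure.
  have [a1 _ a2 _] := HM1 t x tt cx; have [b1 _ _ b2] := HM2 t x tt cx; rewrite /M.
  by split; move: a1 a2 b1 b2 M10 M20; clear -F; lra.
have M8 : 0 < 8 * M by rewrite mulr_gt0.
exists (Num.min (Num.min h1 h2) (Num.min 1 (eps / (8 * M)))).
  by rewrite !lt_min h10 h20 ltr01 divr_gt0.
move=> h /andP[hp]; rewrite !lt_min => /andP[/andP[hh1 hh2] /andP[hl1 hM]].
rewrite ltr_pdivlMr// in hM.
have thn : 0 <= t + h by rewrite addr_ge0// ltW.
have tI1 : 0 <= t <= T + 1 by rewrite tn (le_trans tT)// lerDl.
have tI2 : 0 <= t + h <= T + 1 by rewrite thn lerD// ltW.
have nh : `|t - (t + h)| = h by rewrite opprD addNKr normrN gtr0_norm.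
pose G := cutf eps f (t + h).
have supp y z : G y != 0 -> `|y - z| < eps / 2 -> D t z.
  move=> /(cut_neq0 eps_gt0)[Dy dy]; apply: (H2 (t + h) t y) => //.
  by rewrite nh.
have eps20 : 0 < eps / 2 by rewrite divr_gt0.
have [[c1 _ c11 _] _] := flow_u1 F; have [[c2 _ _ c22] _] := flow_u2 F.
have [_ d1] := flow_u1 F; have [_ d2] := flow_u2 F.
have bG (E : set plane) : bounded_cont E G by exact: cut_bounded_cont.
have bF (E : set plane) : bounded_cont E (cutf eps f t) by exact: cut_bounded_cont.
have [N HN] := (bG setT).2.
have hv (v : R) : `|v| <= M -> `|h * v| < eps / 2 / 4.
  move=> vM; rewrite normrM (gtr0_norm hp).
  have : h * `|v| <= h * M by rewrite ler_pM2l.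
  by move: hM; clear -F; lra.
have s1 x : D t x -> is_derive x.1 (1 : R) (fun s => u1 t (s, x.2)) (u11 t x).
  by move=> Dx; have [] := d1 t x t0 Dx.
have s2 x : D t x -> is_derive x.2 (1 : R) (fun s => u2 t (x.1, s)) (u22 t x).
  by move=> Dx; have [] := d2 t x t0 Dx.
have [bk k0] := @plane_substitution R (D t) Y oE EY G (u1 t) (u2 t) (u11 t) (u22 t)
  (eps / 2) h M N s1 s2 (field_slice_in c1 tn) (field_slice_in c2 tn) (field_slice_in c11 tn)
  (field_slice_in c22 tn) (fun x Dx => ltac:(by have [] := HM x Dx))
  (fun x Dx => ltac:(by have [] := HM x Dx)) (bG setT).1 (fun x => HN x I) eps20 (ltW M0) supp
  (fun x Dx => ltac:(by have [v _ _ _] := HM x Dx; exact: hv))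
  (fun x Dx => ltac:(by have [_ _ v _] := HM x Dx; exact: hv)).
set k := (fun x => _) in bk k0.
have <- : \int[mu2]_(x in D t) G x = Fe eps f (t + h).
  by apply: Fe_on => x Gx; apply: (supp x) => //; rewrite subrr normr0.
have <- : \int[mu2]_(x in D t) cutf eps f t x = Fe eps f t.
  by apply: Fe_on => x /(cut_neq0 eps_gt0)[].
set P := material ft f1 f2 t.
have bP : bounded_cont (D t) P by exact: field_bounded_cont (material_cont cft cf1 cf2) tn.
have bh := bounded_cont_cst (D t) h.
have bhP : bounded_cont (D t) (fun x => h * P x) by exact: bounded_contM.
have bGk := bounded_contD (bG (D t)) bk.
have bGkF := bounded_contB bGk (bF (D t)).
have bQ := bounded_contB bGkF bhP.
have -> : \int[mu2]_(x in D t) G x - \int[mu2]_(x in D t) cutf eps f t x -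
    h * \int[mu2]_(x in D t) P x =
    \int[mu2]_(x in D t) (G x + k x - cutf eps f t x - h * P x).
  by rewrite (pintB oE EY bGkF bhP) (pintB oE EY bGk (bF _)) (pintD oE EY (bG _) bk) k0
    (pintZ oE EY h bP) addr0.
pose lam x := ramp (5 - eps^-1 * dist (B t) x).
have bl : bounded_cont (D t) lam := dist_ramp_cont F 5 eps^-1 (D t) tn.
have bCl := bounded_contM (bounded_cont_cst (D t) C) bl.
have bs := bounded_contD bCl (bounded_cont_cst (D t) e1).
have bR := bounded_contM bh bs.
apply: le_trans (norm_pint_le oE EY bQ bR _) _.
  move=> x Dx; have tI3 : 0 < t <= T by rewrite t0.
  have hI : 0 < h < h1 by rewrite hp.
  have kE : G x + k x = pushed D u2 u22 eps f t h (x.1 + h * u1 t x, x.2) * (1 + h * u11 t x).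
    by rewrite addrC /k subrK.
  by rewrite kE; exact: (H1 t h x tI3 hI Dx).
rewrite (pintZ oE EY h bs) ler_pM2l// (pintD oE EY bCl (bounded_cont_cst _ _)) (pintZ oE EY C bl).
have -> : \int[mu2]_(x in D t) e1 = e1 * A.
  by rewrite -(pintZ oE EY e1 (bounded_cont_cst _ _)); apply: eq_pint => x _; rewrite mulr1.
have epsI' : 0 < eps <= 1 by rewrite eps_gt0 (le_trans epsle)//; case/andP: eps01.
have le1 : C * \int[mu2]_(x in D t) lam x <= C * (CL * eps) by rewrite ler_pM2l//; exact: HL.
have e1A : e1 * A + e1 = e by rewrite /e1; field; rewrite gt_eqF.
by move: le1 e1A e10; clear -F; lra.
Qed.

Lemma Fe_approx (T : R) f : cont_on K (fun z => f z.1 z.2) -> exists2 C : R, 0 < C &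
  forall eps t : R, 0 < eps <= 1 -> 0 <= t <= T ->
    `|Fe eps f t - \int[mu2]_(x in D t) f t x| <= C * eps.
Proof.
move=> cf; have [CL CL0 HL] := layer_integral F T.
have [M M0 HM] := field_bounded F T cf.
exists (M * CL); first exact: mulr_gt0.
move=> eps t epsI tI; have /andP[eps0 eps1] := epsI; have /andP[tn tT] := tI.
have [Y Y1 EY] := flow_box1 tn; have oE := flow_open F tn.
have <- : \int[mu2]_(x in D t) cutf eps f t x = Fe eps f t.
  by apply: Fe_on => x /(cut_neq0 eps0)[].
have bc : bounded_cont (D t) (cutf eps f t) by exact: cut_bounded_cont.
have bf := field_bounded_cont cf tn.
rewrite -(pintB oE EY bc bf).
pose lam x := ramp (5 - eps^-1 * dist (B t) x).
have bl : bounded_cont (D t) lam := dist_ramp_cont F 5 eps^-1 (D t) tn.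
have bM := bounded_contM (bounded_cont_cst (D t) M) bl.
apply: le_trans (norm_pint_le oE EY (bounded_contB bc bf) bM _) _.
  move=> x Dx; rewrite cut_in// -[X in _ - X]mulr1 -mulrBr normrM ler_pM//.
    by apply: HM => //; exact: subset_closure.
  have /andP[k0 k1] : 0 <= cutoff eps t x <= 1 by exact: ramp01.
  by rewrite distrC ger0_norm ?subr_ge0//; exact: cutoff_layer.
by rewrite (pintZ oE EY M bl) -mulrA ler_pM2l//; exact: HL.
Qed.

Lemma cut_time_unif (T eps e : R) f : cont_on K (fun z => f z.1 z.2) -> 0 < eps -> 0 < e ->
  exists2 h0 : R, 0 < h0 & forall (t s : R) (x : plane), 0 <= t <= T -> 0 <= s <= T ->
    `|t - s| < h0 -> `|cutf eps f t x - cutf eps f s x| <= e.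
Proof.
move=> cf eps0 e0; have [M M0 HM] := field_bounded F T cf.
have [U U0 HU] := dist_bdry_time_lip F T.
have e20 : 0 < e / 2 by rewrite divr_gt0.
have [r r0 Hr] := field_unif F T cf e20.
have eps20 : 0 < eps / 2 by rewrite divr_gt0.
have [h1 h10 H1] := no_drop F T eps20.
have MU0 : 0 < 2 * M * U by rewrite !mulr_gt0.
have U20 : 0 < 2 * U by rewrite !mulr_gt0.
exists (Num.min (Num.min r h1) (Num.min (eps / (2 * U)) (e * eps / (2 * M * U)))).
  by rewrite !lt_min r0 h10 !divr_gt0// mulr_gt0.
move=> t s x tI sI; rewrite !lt_min => /andP[/andP[tr th1] /andP[tU tM]].
rewrite ltr_pdivlMr// in tU; rewrite ltr_pdivlMr// in tM.
have sh1 : `|s - t| < h1 by rewrite distrC.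
have /andP[t0 _] := tI; have /andP[s0 _] := sI.
have [[Dt dt]|nA] := pselect (D t x /\ eps / 2 <= dist (B t) x); last first.
  have -> : cutf eps f t x = 0.
    apply/eqP; apply: contraT => /(cut_neq0 eps0)[Dx dx]; case: nA; split => //.
    by move: dx eps0; clear -F; lra.
  suff -> : cutf eps f s x = 0 by rewrite subrr normr0 ltW.
  apply/eqP; apply: contraT => /(cut_neq0 eps0)[Dx dx]; case: nA; split.
    by apply: (H1 s t) => //; move: dx eps0; clear -F; lra.
  by have := HU s t x sI tI; rewrite distrC; move: tU dx; clear -F; lra.
have Ds : D s x by apply: (H1 t s).
rewrite !cut_in//.
have ft : `|f t x - f s x| < e / 2.
  by apply: Hr => //; [exact: subset_closure|exact: subset_closure|by rewrite subrr normr0].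
have fM : `|f s x| <= M by apply: HM => //; exact: subset_closure.
have -> : f t x * cutoff eps t x - f s x * cutoff eps s x =
  (f t x - f s x) * cutoff eps t x + f s x * (cutoff eps t x - cutoff eps s x) by ring.
apply: le_trans (ler_normD _ _) _.
have n1 : `|(f t x - f s x) * cutoff eps t x| <= e / 2 * 1.
  rewrite normrM ler_pM//; first exact: ltW.
  by have /andP[k0 k1] : 0 <= cutoff eps t x <= 1 by [exact: ramp01]; rewrite ger0_norm.
have epsV : 0 < eps^-1 by rewrite invr_gt0.
have n2 : `|f s x * (cutoff eps t x - cutoff eps s x)| <= M * (eps^-1 * (U * `|t - s|)).
  rewrite normrM ler_pM//; apply: le_trans (ramp_lip _ _) _.
  have -> : eps^-1 * dist (B t) x - 1 - (eps^-1 * dist (B s) x - 1) =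
    eps^-1 * (dist (B t) x - dist (B s) x) by ring.
  rewrite normrM (gtr0_norm epsV) ler_pM2l// ler_norml.
  have := HU t s x tI sI; have := HU s t x sI tI; rewrite (distrC s).
  by clear -F; lra.
have n3 : M * (eps^-1 * (U * `|t - s|)) <= e / 2.
  have -> : M * (eps^-1 * (U * `|t - s|)) = (`|t - s| * (2 * M * U)) / (2 * eps).
    by field; rewrite gt_eqF.
  by rewrite ler_pdivrMr ?mulr_gt0//; move: tM; clear -F; lra.
by move: n1 n2 n3; clear -F; lra.
Qed.

(** Transport is stated for positive times; continuity on the closed interval carries the resulting
    monotonicity down to the initial time. *)
Lemma Fe_cont (T eps : R) f : cont_on K (fun z => f z.1 z.2) -> 0 < eps ->
  cont_on [set t : R | 0 <= t <= T] (Fe eps f).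
Proof.
move=> cf eps0 t tI e e0.
have [Y Y1 HY] := flow_box F T.
have Y0 : 0 < Y by apply: lt_le_trans Y1.
have e10 : 0 < e / (2 * Y) by rewrite divr_gt0// mulr_gt0.
have [h0 h00 H] := cut_time_unif T cf eps0 e10.
exists h0 => // s sI ts.
have /andP[t0 _] := tI; have /andP[s0 _] := sI.
pose E := D t `|` D s.
have oE : open E := openU (flow_open F t0) (flow_open F s0).
have EY x : E x -> 0 <= x.1 <= 1 /\ 0 <= x.2 <= Y by case; exact: HY.
have <- : \int[mu2]_(x in E) cutf eps f t x = Fe eps f t.
  by apply: Fe_on => x /(cut_neq0 eps0)[Dx _]; left.
have <- : \int[mu2]_(x in E) cutf eps f s x = Fe eps f s.
  by apply: Fe_on => x /(cut_neq0 eps0)[Dx _]; right.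
have bt : bounded_cont E (cutf eps f t) by exact: cut_bounded_cont.
have bs : bounded_cont E (cutf eps f s) by exact: cut_bounded_cont.
have b1 := bounded_cont_cst E (1 : R).
have be := bounded_contM (bounded_cont_cst E (e / (2 * Y))) b1.
rewrite -(pintB oE EY bt bs).
apply: le_lt_trans (norm_pint_le oE EY (bounded_contB bt bs) be _) _.
  by move=> x _; rewrite mulr1; exact: H.
rewrite (pintZ oE EY _ b1).
have /andP[_ aY] := pint_area oE (ltW Y0) EY.
have : e / (2 * Y) * \int[mu2]_(x in E) 1 <= e / (2 * Y) * Y by rewrite ler_pM2l.
have -> : e / (2 * Y) * Y = e / 2 by field; rewrite gt_eqF.
by move: e0; clear -F; lra.
Qed.

End Transported.

(** * Fields near the rigid walls *)

Section Increment.
Variable R : realType.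

Definition tends0 (f : R -> R) (l : R) := forall e : R, 0 < e ->
  exists2 r : R, 0 < r & forall k : R, 0 < k < r -> `|f k - l| < e.

Lemma tends0_cst (l : R) : tends0 (fun=> l) l.
Proof. by move=> e e0; exists 1 => // k _; rewrite subrr normr0. Qed.

Lemma tends0_affine (a b : R) : tends0 (fun k => a + k * b) a.
Proof.
move=> e e0; have b1 : 0 < 1 + `|b| by rewrite ltr_wpDr.
exists (e / (1 + `|b|)); first by rewrite divr_gt0.
move=> k /andP[k0]; rewrite ltr_pdivlMr// => ke.
rewrite [a + _]addrC addrK normrM (gtr0_norm k0).
by move: ke k0; lra.
Qed.

(** Mean value estimates on segments inside the fluid pass to a limit segment that may lie in a
    wall, where no derivative is given. *)
Lemma increment_limit (phi gam : R -> R -> R) (a b : R -> R) (a0 b0 A0 B0 g e k0 : R) :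
  0 < k0 -> 0 <= e ->
  (forall k s : R, 0 < k < k0 -> `|s - a k| <= `|b k - a k| -> `|s - b k| <= `|b k - a k| ->
     is_derive s 1 (phi k) (gam k s) /\ `|gam k s - g| <= e) ->
  tends0 a a0 -> tends0 b b0 -> tends0 (fun k => phi k (a k)) A0 ->
  tends0 (fun k => phi k (b k)) B0 ->
  `|B0 - A0 - g * (b0 - a0)| <= e * `|b0 - a0|.
Proof.
move=> k00 e0 H ta tb tA tB; rewrite leNgt; apply/negP => lt.
pose q := `|B0 - A0 - g * (b0 - a0)| - e * `|b0 - a0|; have G0 := normr_ge0 g.
pose d := q / (8 * (1 + e + `|g|)).
have q0 : 0 < q by rewrite /q subr_gt0.
have den : 0 < 8 * (1 + e + `|g|) by move: e0 G0; clear; lra.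
have d0 : 0 < d by rewrite divr_gt0.
have [r1 r10 H1] := ta d d0; have [r2 r20 H2] := tb d d0.
have [r3 r30 H3] := tA d d0; have [r4 r40 H4] := tB d d0.
pose r := Num.min k0 (Num.min (Num.min r1 r2) (Num.min r3 r4)).
have r0 : 0 < r by rewrite !lt_min k00 r10 r20 r30 r40.
pose k := r / 2; have kk : 0 < k by rewrite divr_gt0.
have kr : k < r by rewrite /k; move: r0; lra.
move: kr; rewrite !lt_min => /andP[kk0 /andP[/andP[kr1 kr2] /andP[kr3 kr4]]].
have {}H1 := H1 k (ltac:(by rewrite kk)); have {}H2 := H2 k (ltac:(by rewrite kk)).
have {}H3 := H3 k (ltac:(by rewrite kk)); have {}H4 := H4 k (ltac:(by rewrite kk)).
have kI : 0 < k < k0 by rewrite kk.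
have [s sa sb|s [sa sb Es]] := @mean_value R (phi k) (gam k) (a k) (b k).
  by have [] := H k s kI sa sb.
have [_ gs] := H k s kI sa sb.
have E : `|phi k (b k) - phi k (a k) - g * (b k - a k)| <= e * `|b k - a k|.
  by rewrite Es -mulrBl normrM ler_wpM2r.
have dE : d * (8 * (1 + e + `|g|)) = q by rewrite /d divfK// gt_eqF.
have n0 : `|(b k - a k) - (b0 - a0)| <= 2 * d.
  have -> : (b k - a k) - (b0 - a0) = (b k - b0) - (a k - a0) by ring.
  by have := ler_normB (b k - b0) (a k - a0); move: H1 H2; clear; lra.
have n1 : `|g * ((b k - a k) - (b0 - a0))| <= `|g| * (2 * d) by rewrite normrM ler_wpM2l.
have n2 : e * `|b k - a k| <= e * (`|b0 - a0| + 2 * d).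
  rewrite ler_wpM2l//; have := ler_normD ((b k - a k) - (b0 - a0)) (b0 - a0).
  by rewrite subrK; move: n0; clear; lra.
have Eq : B0 - A0 - g * (b0 - a0) = (phi k (b k) - phi k (a k) - g * (b k - a k))
   - (phi k (b k) - B0) + (phi k (a k) - A0) + g * ((b k - a k) - (b0 - a0)) by ring.
have m1 := ler_normD (phi k (b k) - phi k (a k) - g * (b k - a k) - (phi k (b k) - B0) + (phi k (a k) - A0))
   (g * ((b k - a k) - (b0 - a0))).
have m2 := ler_normD (phi k (b k) - phi k (a k) - g * (b k - a k) - (phi k (b k) - B0)) (phi k (a k) - A0).
have m3 := ler_normB (phi k (b k) - phi k (a k) - g * (b k - a k)) (phi k (b k) - B0).
rewrite -Eq in m1; have qE : q = `|B0 - A0 - g * (b0 - a0)| - e * `|b0 - a0| by [].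
have dg : 0 <= d * `|g| by rewrite mulr_ge0// ltW.
have de : 0 <= d * e by rewrite mulr_ge0// ltW.
by move: m1 m2 m3 n1 n2 E H3 H4 dE qE d0 dg de; clear; lra.
Qed.

End Increment.

Section Walls.
Variable R : realType.
Local Notation plane := (R * R)%type.
Variables (c : R -> R -> plane) (D : R -> set plane).
Variables (u1 u1t u11 u12 u2 u2t u21 u22 : R -> plane -> R).
Hypothesis F : C1_flow c D u1 u1t u11 u12 u2 u2t u21 u22.

Definition strip_closed : set plane := [set x | 0 <= x.1 <= 1 /\ 0 <= x.2].

(** The contraction towards (1/2, 1) moves wall points into the open strip and keeps axis-parallel
    segments axis-parallel, so partial derivatives can be used on the image. *)
Definition inward (k : R) (x : plane) : plane :=
  (x.1 + k * (2^-1 - x.1), x.2 + k * (1 - x.2)).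

Lemma inward_strip (k : R) (x : plane) : 0 < k < 1 -> strip_closed x ->
  0 < (inward k x).1 < 1 /\ 0 < (inward k x).2.
Proof.
move=> /andP[k0 k1] [/andP[x0 x1] x2] /=.
have a1 : 0 <= (1 - k) * x.1 by rewrite mulr_ge0// subr_ge0 ltW.
have a2 : 0 <= (1 - k) * (1 - x.1) by rewrite mulr_ge0// subr_ge0// ltW.
have a3 : 0 <= (1 - k) * x.2 by rewrite mulr_ge0// subr_ge0 ltW.
by move: a1 a2 a3 k0; clear -F; lra.
Qed.

Lemma inward_near (x : plane) (e : R) : 0 < e ->
  exists2 r : R, 0 < r & forall k : R, 0 < k < r -> `|x - inward k x| < e.
Proof.
move=> e0; have [r1 r10 H1] := tends0_affine x.1 (2^-1 - x.1) e0.
have [r2 r20 H2] := tends0_affine x.2 (1 - x.2) e0.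
exists (Num.min r1 r2); first by rewrite lt_min r10.
move=> k /andP[k0]; rewrite lt_min => /andP[k1 k2].
by rewrite norm_pair_lt /= distrC H1 ?k0//= distrC H2 ?k0.
Qed.

Lemma strip_closure (E : set plane) (z x : plane) (r : R) :
  (forall y, `|z - y| < r -> 0 < y.1 < 1 -> 0 < y.2 -> E y) ->
  strip_closed x -> `|z - x| < r -> closure E x.
Proof.
move=> H sx zx; apply/closure_normP => e e0.
have e'0 : 0 < Num.min e (r - `|z - x|) by rewrite lt_min e0 subr_gt0.
have [r1 r10 H1] := inward_near x e'0.
pose k := Num.min r1 1 / 2; have m0 : 0 < Num.min r1 1 by rewrite lt_min r10 ltr01.
have k0 : 0 < k by rewrite divr_gt0.
have km : k < Num.min r1 1 by rewrite /k; move: m0; clear -F; lra.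
move: km; rewrite lt_min => /andP[kr k1].
have := H1 k (ltac:(by rewrite k0)); rewrite lt_min => /andP[n1 n2].
have k01 : 0 < k < 1 by rewrite k0.
exists (inward k x) => //; have [s1 s2] := inward_strip k01 sx.
apply: H => //; have := ler_distD x z (inward k x); move: n2; clear -F; lra.
Qed.

Lemma tends0_inward (f : plane -> R) (A : set plane) (x : plane) (r : R) : 0 < r ->
  cont_on A f -> A x -> (forall k : R, 0 < k < r -> A (inward k x)) ->
  tends0 (fun k => f (inward k x)) (f x).
Proof.
move=> r0 cf Ax H e e0; have [r1 r10 H1] := cf x Ax e e0.
have [r2 r20 H2] := inward_near x r10.
exists (Num.min r r2); first by rewrite lt_min r0.
move=> k /andP[k0]; rewrite lt_min => /andP[k1 k2].
rewrite distrC; apply: H1; first by apply: H; rewrite k0.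
by apply: H2; rewrite k0.
Qed.

Section FixedTime.
Variables (t : R) (z : plane).
Hypotheses (t0 : 0 <= t) (wz : walls z) (z0 : z != (0, 1)) (z1 : z != (1, 1)).

Lemma wall_near (f1 : plane -> R) (e : R) : cont_on (closure (D t)) f1 -> 0 < e ->
  exists2 r : R, 0 < r & forall x, `|z - x| < r ->
    (0 < x.1 < 1 -> 0 < x.2 -> D t x) /\ (closure (D t) x -> `|f1 x - f1 z| <= e).
Proof.
move=> c1 e0; have [r r0 H] := wall_box F t wz z0 z1.
have cz : closure (D t) z by have := flow_bdry F t0 => /seteqP[_]/(_ z (or_introl wz))[].
have [r1 r10 H1] := c1 z cz e e0.
exists (Num.min r r1); first by rewrite lt_min r0.
move=> x; rewrite lt_min => /andP[zx zx1]; split; first by apply: H; rewrite // t0/=.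
by move=> cx; rewrite distrC; apply: ltW; exact: H1.
Qed.

Lemma inward_ball (r : R) (x : plane) : `|z - x| < r ->
  exists2 k0 : R, 0 < k0 <= 1 & forall k, 0 < k < k0 -> `|z - inward k x| < r.
Proof.
move=> zx; have r'0 : 0 < r - `|z - x| by rewrite subr_gt0.
have [r2 r20 H2] := inward_near x r'0.
exists (Num.min r2 1); first by rewrite lt_min r20 ltr01/= ge_min lexx orbT.
move=> k /andP[k0]; rewrite lt_min => /andP[kr _].
have := H2 k (ltac:(by rewrite k0)); have := ler_distD x z (inward k x); clear -F t0 wz z0 z1; lra.
Qed.

Variables (f f1 : plane -> R).
Hypotheses (cf : cont_on (closure (D t)) f) (cf1 : cont_on (closure (D t)) f1).

(** A derivative known inside the fluid persists up to the wall: the segment from x to y is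
    contracted into the fluid, and the mean value estimate passes to the limit. *)
Lemma wall_increment1 : 
  (forall x, D t x -> is_derive x.1 (1 : R) (fun s => f (s, x.2)) (f1 x)) ->
  forall e : R, 0 < e -> exists2 r : R, 0 < r & forall x y, strip_closed x -> strip_closed y ->
    `|z - x| < r -> `|z - y| < r -> x.2 = y.2 ->
    `|f y - f x - f1 z * (y.1 - x.1)| <= e * `|y.1 - x.1|.
Proof.
move=> df e e0; have [r r0 H] := wall_near cf1 e0.
exists r => // x y sx sy zx zy xy.
have HD w : `|z - w| < r -> 0 < w.1 < 1 -> 0 < w.2 -> D t w by move=> /H[].
have [k1 /andP[k10 k11] H1] := inward_ball zx; have [k2 /andP[k20 k21] H2] := inward_ball zy.
pose k0 := Num.min k1 k2; have k00 : 0 < k0 by rewrite lt_min k10.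
have kk (k : R) : 0 < k < k0 -> [/\ 0 < k < 1, `|z - inward k x| < r & `|z - inward k y| < r].
  move=> /andP[p]; rewrite lt_min => /andP[q1 q2].
  by rewrite p (lt_le_trans q1)//; split => //; [apply: H1|apply: H2]; rewrite p.
have iD (k : R) w : 0 < k < 1 -> strip_closed w -> `|z - inward k w| < r -> D t (inward k w).
  by move=> k01 sw zw; have [s1 s2] := inward_strip k01 sw; exact: HD.
pose Fk k s := f (s, (inward k x).2); pose Gk k s := f1 (s, (inward k x).2).
apply: (@increment_limit R Fk Gk (fun k => (inward k x).1) (fun k => (inward k y).1) _ _ _ _ _ _ k0) => //.
- exact: ltW.
- move=> k s kI sa sb; have [k01 zx' zy'] := kk k kI.
  have [p1 p2] := inward_strip k01 sx; have [q1 q2] := inward_strip k01 sy.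
  have zs : `|z - (s, (inward k x).2)| < r.
    move: zx' zy'; rewrite !norm_pair_lt /= => /andP[c1 ->] /andP[d1 _]; rewrite andbT.
    move: c1 d1 sa sb; rewrite /= !ltr_distl !ler_distl; clear -F t0 wz z0 z1 cf cf1.
    by case: (leP ((x.1 + k * (2^-1 - x.1))) ((y.1 + k * (2^-1 - y.1)))) => h; [rewrite ger0_norm ?subr_ge0//|rewrite ltr0_norm ?subr_lt0//]; lra.
  have s01 : 0 < s < 1.
    move: p1 q1 sa sb; rewrite /= !ler_distl; clear -F t0 wz z0 z1 cf cf1.
    by case: (leP ((x.1 + k * (2^-1 - x.1))) ((y.1 + k * (2^-1 - y.1)))) => h; [rewrite ger0_norm ?subr_ge0//|rewrite ltr0_norm ?subr_lt0//]; lra.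
  have Ds : D t (s, (inward k x).2) by exact: HD.
  split; first exact: (df _ Ds).
  by have [_] := H _ zs; apply; exact: subset_closure.
- exact: tends0_affine.
- exact: tends0_affine.
- apply: (@tends0_inward f (closure (D t)) x k0) => //; first exact: strip_closure HD sx zx.
  by move=> k kI; have [k01 zx' _] := kk k kI; apply: subset_closure; exact: iD.
- have -> : (fun k => Fk k (inward k y).1) = (fun k => f (inward k y)).
    by apply/funext => k; rewrite /Fk /inward /= xy.
  apply: (@tends0_inward f (closure (D t)) y k0) => //; first exact: strip_closure HD sy zy.
  by move=> k kI; have [k01 _ zy'] := kk k kI; apply: subset_closure; exact: iD.
Qed.

Lemma wall_increment2 :
  (forall x, D t x -> is_derive x.2 (1 : R) (fun s => f (x.1, s)) (f1 x)) ->
  forall e : R, 0 < e -> exists2 r : R, 0 < r & forall x y, strip_closed x -> strip_closed y ->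
    `|z - x| < r -> `|z - y| < r -> x.1 = y.1 ->
    `|f y - f x - f1 z * (y.2 - x.2)| <= e * `|y.2 - x.2|.
Proof.
move=> df e e0; have [r r0 H] := wall_near cf1 e0.
exists r => // x y sx sy zx zy xy.
have HD w : `|z - w| < r -> 0 < w.1 < 1 -> 0 < w.2 -> D t w by move=> /H[].
have [k1 /andP[k10 k11] H1] := inward_ball zx; have [k2 /andP[k20 k21] H2] := inward_ball zy.
pose k0 := Num.min k1 k2; have k00 : 0 < k0 by rewrite lt_min k10.
have kk (k : R) : 0 < k < k0 -> [/\ 0 < k < 1, `|z - inward k x| < r & `|z - inward k y| < r].
  move=> /andP[p]; rewrite lt_min => /andP[q1 q2].
  by rewrite p (lt_le_trans q1)//; split => //; [apply: H1|apply: H2]; rewrite p.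
have iD (k : R) w : 0 < k < 1 -> strip_closed w -> `|z - inward k w| < r -> D t (inward k w).
  by move=> k01 sw zw; have [s1 s2] := inward_strip k01 sw; exact: HD.
pose Fk k s := f ((inward k x).1, s); pose Gk k s := f1 ((inward k x).1, s).
apply: (@increment_limit R Fk Gk (fun k => (inward k x).2) (fun k => (inward k y).2) _ _ _ _ _ _ k0) => //.
- exact: ltW.
- move=> k s kI sa sb; have [k01 zx' zy'] := kk k kI.
  have [p1 p2] := inward_strip k01 sx; have [q1 q2] := inward_strip k01 sy.
  have zs : `|z - ((inward k x).1, s)| < r.
    move: zx' zy'; rewrite !norm_pair_lt /= => /andP[-> c1] /andP[_ d1] /=.
    move: c1 d1 sa sb; rewrite /= !ltr_distl !ler_distl; clear -F t0 wz z0 z1 cf cf1.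
    by case: (leP ((x.2 + k * (1 - x.2))) ((y.2 + k * (1 - y.2)))) => h; [rewrite ger0_norm ?subr_ge0//|rewrite ltr0_norm ?subr_lt0//]; lra.
  have s01 : 0 < s.
    move: p2 q2 sa sb; rewrite /= !ler_distl; clear -F t0 wz z0 z1 cf cf1.
    by case: (leP ((x.2 + k * (1 - x.2))) ((y.2 + k * (1 - y.2)))) => h; [rewrite ger0_norm ?subr_ge0//|rewrite ltr0_norm ?subr_lt0//]; lra.
  have Ds : D t ((inward k x).1, s) by exact: HD.
  split; first exact: (df _ Ds).
  by have [_] := H _ zs; apply; exact: subset_closure.
- exact: tends0_affine.
- exact: tends0_affine.
- apply: (@tends0_inward f (closure (D t)) x k0) => //; first exact: strip_closure HD sx zx.
  by move=> k kI; have [k01 zx' _] := kk k kI; apply: subset_closure; exact: iD.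
- have -> : (fun k => Fk k (inward k y).2) = (fun k => f (inward k y)).
    by apply/funext => k; rewrite /Fk /inward /= xy.
  apply: (@tends0_inward f (closure (D t)) y k0) => //; first exact: strip_closure HD sy zy.
  by move=> k kI; have [k01 _ zy'] := kk k kI; apply: subset_closure; exact: iD.
Qed.

End FixedTime.

Lemma wall_increment_t (f ft f1 f2 : R -> plane -> R) (t e : R) (z : plane) : C1_field D f ft f1 f2 ->
  0 < t -> walls z -> z != (0, 1) -> z != (1, 1) -> 0 < e ->
  exists2 r : R, 0 < r & forall (s : R) (x : plane), strip_closed x -> `|z - x| < r -> `|s - t| < r ->
    `|f s x - f t x - ft t z * (s - t)| <= e * `|s - t|.
Proof.
move=> [[cf cft _ _] Cf] t0 wz z0 z1 e0.
have [r0 r00 H] := wall_box F (t + t) wz z0 z1.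
have tn := ltW t0; have tI : 0 <= t <= t by rewrite tn/=.
have cz : closure (D t) z by have := flow_bdry F tn => /seteqP[_]/(_ z (or_introl wz))[].
have [r1 r10 H1] := field_unif F t cft e0.
pose r := Num.min t (Num.min r0 r1).
exists r; first by rewrite !lt_min t0 r00.
move=> s x sx; rewrite !lt_min => /andP[_ /andP[zx0 zx1]] /andP[st /andP[_ st1]].
have time s' : `|s' - t| <= `|s - t| -> 0 < s' /\ 0 <= s' <= t + t.
  move=> hs; have := le_lt_trans hs st; rewrite ltr_distl => /andP[h1 h2].
  by split; [|apply/andP; split]; move: h1 h2; clear -F; lra.
have HD s' w : 0 <= s' <= t + t -> `|z - w| < r0 -> 0 < w.1 < 1 -> 0 < w.2 -> D s' w by exact: H.
have [k1 /andP[k10 k11] Hk1] := inward_ball zx0; have [k2 /andP[k20 k21] Hk2] := inward_ball zx1.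
pose k0 := Num.min k1 k2; have k00 : 0 < k0 by rewrite lt_min k10.
have kk (k : R) : 0 < k < k0 -> [/\ 0 < k < 1, `|z - inward k x| < r0 & `|z - inward k x| < r1].
  move=> /andP[p]; rewrite lt_min => /andP[q1 q2].
  by rewrite p (lt_le_trans q1)//; split => //; [apply: Hk1|apply: Hk2]; rewrite p.
have iD s' k : 0 <= s' <= t + t -> 0 < k < k0 -> D s' (inward k x).
  by move=> sI kI; have [k01 zw _] := kk k kI; have [s1 s2] := inward_strip k01 sx; exact: HD.
have lim s' : 0 <= s' <= t + t -> tends0 (fun k => f s' (inward k x)) (f s' x).
  move=> sI; have /andP[s'0 _] := sI.
  apply: (@tends0_inward (f s') (closure (D s')) x k0) => //.
  - exact: field_slice cf s'0.
  - by apply: strip_closure sx zx0 => w; exact: HD.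
  - by move=> k kI; apply: subset_closure; exact: iD.
apply: (@increment_limit R (fun k s => f s (inward k x)) (fun k s => ft s (inward k x)) (fun=> t) (fun=> s) _ _ _ _ _ _ k0) => //.
- exact: ltW.
- move=> k s' kI sa _; have [s'0 s'I] := time s' sa; have [_ _ zx'] := kk k kI.
  have Ds := iD s' k s'I kI.
  split; first by have [] := Cf _ _ s'0 Ds.
  rewrite distrC; apply/ltW/H1 => //; [exact: ltW|exact: subset_closure|].
  by rewrite distrC (le_lt_trans sa).
- exact: tends0_cst.
- exact: tends0_cst.
- by apply: lim; rewrite tn lerDl.
- by apply: lim; have [] := time s (lexx _).
Qed.

Lemma wall_field0 (f ft f1 f2 : R -> plane -> R) (t : R) (z : plane) : C1_field D f ft f1 f2 ->
  0 < t -> walls z -> z != (0, 1) -> z != (1, 1) ->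
  (forall s : R, 0 < s -> f s z = 0) -> ft t z = 0.
Proof.
move=> Cf t0 wz z0 z1 Hf; apply/eqP; rewrite -normr_le0; apply/ler_addgt0Pl => e e0; rewrite addr0.
have [r r0 H] := wall_increment_t Cf t0 wz z0 z1 e0.
have sz : strip_closed z by case: wz => h1 h2 _; split => //; case/andP: h2.
have r20 : 0 < r / 2 by rewrite divr_gt0.
have := H (t + r / 2) z sz; rewrite subrr normr0 [t + _ - t]addrC addKr (gtr0_norm r20).
rewrite !Hf ?addr_gt0// subrr sub0r normrN normrM (gtr0_norm r20) ler_pM2r//.
by apply => //; move: r0; clear -F; lra.
Qed.

(** These three values make the acceleration normal to the wall, hence the normal derivative of the
    pressure, vanish there. Both derivatives are zero because u1 is zero along the wall at all
    times; y < 1 keeps away from the corner at the surface. *)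
Lemma lateral_wall_u1 (t y a : R) : 0 < t -> 0 <= y < 1 -> a = 0 \/ a = 1 ->
  [/\ u1 t (a, y) = 0, u1t t (a, y) = 0 & u12 t (a, y) = 0].
Proof.
move=> t0 /andP[y0 y1] a01; have tn := ltW t0.
have u0 (s y' : R) : 0 <= s -> 0 <= y' <= 1 -> u1 s (a, y') = 0.
  by move=> s0 yI; have [h1 h2] := lateral_wall_rest F s0 yI; case: a01 => ->.
have wz : walls (a, y).
  split => /=; [|by rewrite y0 ltW|by case: a01; [constructor 1|constructor 2]].
  by case: a01 => ->; rewrite ?lexx ler01.
have z0 : (a, y) != (0, 1) by rewrite xpair_eqE negb_and (lt_eqF y1) orbT.
have z1 : (a, y) != (1, 1) by rewrite xpair_eqE negb_and (lt_eqF y1) orbT.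
have yI : 0 <= y <= 1 by rewrite y0 ltW.
split; first exact: u0.
  by apply: (wall_field0 (flow_u1 F)) => // s s0; apply: u0 => //; exact: ltW.
apply/eqP; rewrite -normr_le0; apply/ler_addgt0Pl => e e0; rewrite addr0.
have [[cu1 _ _ c12] d] := flow_u1 F.
have dd x : D t x -> is_derive x.2 (1 : R) (fun s => u1 t (x.1, s)) (u12 t x).
  by move=> Dx; have [] := d t x t0 Dx.
have [r r0 H] := wall_increment2 tn wz z0 z1 (field_slice cu1 tn) (field_slice c12 tn) dd e0.
pose h := Num.min (r / 2) (1 - y).
have h0 : 0 < h by rewrite lt_min divr_gt0// subr_gt0.
have hr : h <= r / 2 by rewrite ge_min lexx.
have hy : h <= 1 - y by rewrite ge_min lexx orbT.
have aI : 0 <= a <= 1 by case: a01 => ->; rewrite ?lexx ler01.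
have := H (a, y) (a, y + h); rewrite /= !u0//; last by move: hy h0 y0; clear -F; lra.
rewrite [y + h - y]addrC addKr subr0 sub0r normrN normrM (gtr0_norm h0) ler_pM2r//; apply => //.
- by split => //=; rewrite addr_ge0// ltW.
- by rewrite subrr normr0.
- rewrite norm_pair_lt /= subrr normr0 r0/= opprD addNKr normrN gtr0_norm//.
  by move: hr r0; clear -F; lra.
Qed.

Lemma bottom_u2 (t x : R) : 0 < t -> 0 < x < 1 ->
  [/\ u2 t (x, 0) = 0, u2t t (x, 0) = 0 & u21 t (x, 0) = 0].
Proof.
move=> t0 /andP[x0 x1]; have tn := ltW t0.
have wz : walls (x, 0).
  by split => /=; [rewrite !ltW|rewrite lexx ler01|constructor 3].
have z0 : (x, 0) != (0, 1) :> plane by rewrite xpair_eqE negb_and (gt_eqF x0).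
have z1 : (x, 0) != (1, 1) :> plane by rewrite xpair_eqE negb_and (lt_eqF x1).
have xI : 0 <= x <= 1 by rewrite !ltW.
split; first exact: (bottom_rest F).
  by apply: (wall_field0 (flow_u2 F)) => // s s0; apply: (bottom_rest F) => //; exact: ltW.
apply/eqP; rewrite -normr_le0; apply/ler_addgt0Pl => e e0; rewrite addr0.
have [[cu _ c2 _] d] := flow_u2 F.
have dd x' : D t x' -> is_derive x'.1 (1 : R) (fun s => u2 t (s, x'.2)) (u21 t x').
  by move=> Dx; have [] := d t x' t0 Dx.
have [r r0 H] := wall_increment1 tn wz z0 z1 (field_slice cu tn) (field_slice c2 tn) dd e0.
pose h := Num.min (r / 2) (1 - x).
have h0 : 0 < h by rewrite lt_min divr_gt0// subr_gt0.
have hr : h <= r / 2 by rewrite ge_min lexx.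
have hy : h <= 1 - x by rewrite ge_min lexx orbT.
have xhI : 0 <= x + h <= 1 by move: hy h0 x0; clear -F; lra.
have := H (x, 0) (x + h, 0); rewrite /= !(bottom_rest F)//.
rewrite [x + h - x]addrC addKr subr0 sub0r normrN normrM (gtr0_norm h0) ler_pM2r//; apply => //.
- by rewrite subrr normr0.
- rewrite norm_pair_lt /= subrr normr0 r0/= andbT opprD addNKr normrN gtr0_norm//.
  by move: hr r0; clear -F; lra.
Qed.

End Walls.

(** * Calculus for the maximum principle *)

Section Calculus.
Variable R : realType.
Local Notation plane := (R * R)%type.
Local Notation mu2 := (@lebesgue_measure R \x @lebesgue_measure R)%E.
Implicit Types f g : R -> R.

Lemma derD f g (x a b : R) : is_derive x 1 f a -> is_derive x 1 g b ->
  is_derive x 1 (fun s => f s + g s) (a + b).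
Proof. by move=> hf hg; exact: (is_deriveD hf hg). Qed.

Lemma derB f g (x a b : R) : is_derive x 1 f a -> is_derive x 1 g b ->
  is_derive x 1 (fun s => f s - g s) (a - b).
Proof. by move=> hf hg; exact: (is_deriveB hf hg). Qed.

Lemma derM f g (x a b : R) : is_derive x 1 f a -> is_derive x 1 g b ->
  is_derive x 1 (fun s => f s * g s) (a * g x + f x * b).
Proof.
by move=> hf hg; apply: is_derive_eq (is_deriveM hf hg) _; rewrite addrC /GRing.scale /= mulrC.
Qed.

Lemma derC (x a : R) : is_derive x 1 (fun=> a) (0 : R).
Proof. exact: is_derive_cst. Qed.

Lemma derI (x : R) : is_derive x 1 (fun s : R => s) (1 : R).
Proof. exact: is_derive_id. Qed.

Lemma derZ f (x a k : R) : is_derive x 1 f a -> is_derive x 1 (fun s => k * f s) (k * a).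
Proof. by move=> hf; apply: is_derive_eq (derM (derC x k) hf) _; rewrite mul0r add0r. Qed.

Lemma derShift f (x a k : R) : is_derive (x + k) 1 f a -> is_derive x 1 (fun s => f (s + k)) a.
Proof.
move=> hf; apply: is_derive_eq (chain_rule (derD (derI x) (derC x k)) hf) _.
by rewrite addr0 mulr1.
Qed.

Lemma cont_on_min (V : normedModType R) (C : set V) (f : V -> R) : compact C -> C !=set0 ->
  cont_on C f -> exists2 x, C x & forall y, C y -> f x <= f y.
Proof.
move=> cC C0 /within_cont_on cf; have [x /set_mem Cx H] := compact_EVT_min C0 cC cf.
by exists x => // y Cy; apply: H; exact: mem_set.
Qed.

Definition pos (s : R) : R := Num.max 0 s.

Lemma pos_ge0 s : 0 <= pos s. Proof. by rewrite /pos le_max lexx. Qed.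
Lemma pos_id s : 0 <= s -> pos s = s. Proof. by rewrite /pos => /max_r. Qed.
Lemma pos_eq0 s : s <= 0 -> pos s = 0. Proof. by rewrite /pos => /max_l. Qed.

Lemma pos_lip s s' : `|pos s - pos s'| <= `|s - s'|.
Proof.
case: (lerP 0 s) => h; case: (lerP 0 s') => h'.
- by rewrite !pos_id.
- by rewrite (pos_id h) (pos_eq0 (ltW h')) subr0 ger0_norm// ger0_norm; lra.
- by rewrite (pos_id h') (pos_eq0 (ltW h)) sub0r normrN ger0_norm// ltr0_norm; lra.
- by rewrite (pos_eq0 (ltW h)) (pos_eq0 (ltW h')) subrr normr0.
Qed.

Lemma cont_on_pos : cont_on setT pos.
Proof. by move=> s _ e e0; exists e => // s' _; exact: le_lt_trans (pos_lip _ _). Qed.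

(** Squaring makes the positive part C^1 across zero: at 0 the difference quotient is bounded by the
    step itself. *)
Lemma derSqpos (s : R) : is_derive s 1 (fun s => pos s ^+ 2) (2 * pos s).
Proof.
have sq (x : R) : is_derive x 1 (fun s : R => s * s) (2 * x).
  by apply: is_derive_eq (derM (derI x) (derI x)) _; ring.
have [s0|s0|->] := ltrgtP s 0.
- apply: (@near_is_derive _ (fun=> 0) _ s _ (- s)); first by rewrite oppr_gt0.
    move=> z; rewrite ltr_distl => h; rewrite pos_eq0 ?expr0n//; lra.
  by rewrite pos_eq0 ?ltW// mulr0; exact: derC.
- apply: (@near_is_derive _ (fun s => s * s) _ s _ s) => //.
    move=> z; rewrite ltr_distl => h; rewrite pos_id ?expr2//; lra.
  by rewrite pos_id ?ltW//; exact: sq.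
- rewrite pos_id// mulr0.
  have dq := sq 0; rewrite mulr0 in dq.
  have small : (fun h : R => h^-1 *: ((fun s => pos s ^+ 2) (h *: 1 + 0) - pos 0 ^+ 2)) @ 0^' --> (0 : R).
    apply/cvgrPdist_lt => e e0; near=> h.
    have h0 : h != 0 by near: h; exact: nbhs_dnbhs_neq.
    have he : `|h| < e by near: h; apply: dnbhs0_lt.
    rewrite /= sub0r normrN (pos_id (lexx 0)) expr0n subr0 addr0 /GRing.scale /= mulr1 normrM normfV.
    have ph : `|pos h| <= `|h| by have := pos_lip h 0; rewrite (pos_id (lexx 0)) !subr0.
    rewrite normrX expr2; apply: le_lt_trans he.
    rewrite ler_pdivrMl ?normr_gt0//; exact: ler_pM.
  apply: DeriveDef; first by apply: cvgP small.
  exact: cvg_lim small.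
Unshelve. all: by end_near.
Qed.

Lemma square_divergence1 (x0 : plane) (r : R) (f f1 : plane -> R) : 0 < r ->
  cont_on [set x | `|x0 - x| < r] f1 ->
  mu2.-integrable [set x | `|x0 - x| < r] (EFin \o f1) ->
  open [set x : plane | `|x0 - x| < r] ->
  (forall x, `|x0 - x| < r -> is_derive x.1 1 (fun s => f (s, x.2)) (f1 x)) ->
  (forall x, `|x0 - x| < r -> r / 2 < `|x0 - x| -> f x = 0 /\ f1 x = 0) ->
  (\int[mu2]_(x in [set x | (`|x0 - x| < r)%R]) (f1 x)%:E = 0)%E.
Proof.
move=> r0 c1 i1 oE d1 supp; set E := [set x | _] in c1 i1 oE *.
rewrite (integral_slices1 (phi := fun=> 0%E) (open_plane_measurable oE) i1) ?integral0// => y.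
(* Endpoints at 3 r / 4 lie strictly inside the square, where the derivative exists, and outside the
   support of f. *)
pose a := x0.1 - 3 / 4 * r; pose b := x0.1 + 3 / 4 * r.
have ab : a < b by rewrite /a /b; lra.
have [yE|yE] := ltP `|x0.2 - y| r; last first.
  rewrite (eq_integral (fun=> 0%E)) ?integral0// => x _.
  rewrite patchE; case: ifPn => // /set_mem; rewrite /E /= norm_pair_lt /= => /andP[_].
  by rewrite ltNge yE.
have inE' x : a <= x <= b -> `|x0 - (x, y)| < r.
  by rewrite norm_pair_lt /= yE andbT ltr_distl /a /b; move: r0; lra.
have outE x : `|x0 - (x, y)| < r -> (x0.1 - r / 2 <= x <= x0.1 + r / 2) \/ f (x, y) = 0 /\ f1 (x, y) = 0.
  move=> xE; case: (lerP `|x0.1 - x| (r / 2)) => h; first by left; move: h; rewrite ler_distl; lra.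
  by right; apply: supp => //; apply: lt_le_trans h _; exact: (norm_fst (x0 - (x, y))).
rewrite (@integral_supported R a b (fun x => (f1 \_ E) (x, y))); last first.
  move=> x nab; rewrite patchE; case: ifPn => // /set_mem xE.
  by case: (outE x xE) => [h|[]//]; case/negP: nab; rewrite /a /b; move: r0 h; lra.
transitivity ((f (b, y) - f (a, y))%:E); first apply: (@FTC R (fun x => f (x, y)) (fun x => (f1 \_ E) (x, y))) => //.
- move=> x xI; rewrite patchE mem_set; last exact: inE'.
  exact: (d1 (x, y) (inE' x xI)).
- apply: (@cont_on_eq _ _ _ _ (fun x => f1 (x, y))).
    by move=> x xI; rewrite patchE mem_set//; exact: inE'.
  apply: (cont_on_comp (K := E)) c1; first by move=> x; exact: inE'.
  by apply: cont_on_pair; [exact: cont_on_id|exact: cont_on_cst].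
- have xa : `|x0 - (a, y)| < r by apply: inE'; rewrite lexx ltW.
  have xb : `|x0 - (b, y)| < r by apply: inE'; rewrite lexx ltW.
  have [->] : f (a, y) = 0 /\ f1 (a, y) = 0 by case: (outE a xa) => //; rewrite /a; move: r0; lra.
  have [->] : f (b, y) = 0 /\ f1 (b, y) = 0 by case: (outE b xb) => //; rewrite /b; move: r0; lra.
  by rewrite subrr.
Qed.

Lemma square_divergence2 (x0 : plane) (r : R) (f f1 : plane -> R) : 0 < r ->
  cont_on [set x | `|x0 - x| < r] f1 ->
  mu2.-integrable [set x | `|x0 - x| < r] (EFin \o f1) ->
  open [set x : plane | `|x0 - x| < r] ->
  (forall x, `|x0 - x| < r -> is_derive x.2 1 (fun s => f (x.1, s)) (f1 x)) ->
  (forall x, `|x0 - x| < r -> r / 2 < `|x0 - x| -> f x = 0 /\ f1 x = 0) ->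
  (\int[mu2]_(x in [set x | (`|x0 - x| < r)%R]) (f1 x)%:E = 0)%E.
Proof.
move=> r0 c1 i1 oE d1 supp; set E := [set x | _] in c1 i1 oE *.
rewrite (integral_slices2 (phi := fun=> 0%E) (open_plane_measurable oE) i1) ?integral0// => y.
pose a := x0.2 - 3 / 4 * r; pose b := x0.2 + 3 / 4 * r.
have ab : a < b by rewrite /a /b; lra.
have [yE|yE] := ltP `|x0.1 - y| r; last first.
  rewrite (eq_integral (fun=> 0%E)) ?integral0// => x _.
  rewrite patchE; case: ifPn => // /set_mem; rewrite /E /= norm_pair_lt /= => /andP[+ _].
  by rewrite ltNge yE.
have inE' x : a <= x <= b -> `|x0 - (y, x)| < r.
  by rewrite norm_pair_lt /= yE/= ltr_distl /a /b; move: r0; lra.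
have outE x : `|x0 - (y, x)| < r -> (x0.2 - r / 2 <= x <= x0.2 + r / 2) \/ f (y, x) = 0 /\ f1 (y, x) = 0.
  move=> xE; case: (lerP `|x0.2 - x| (r / 2)) => h; first by left; move: h; rewrite ler_distl; lra.
  by right; apply: supp => //; apply: lt_le_trans h _; exact: (norm_snd (x0 - (y, x))).
rewrite (@integral_supported R a b (fun x => (f1 \_ E) (y, x))); last first.
  move=> x nab; rewrite patchE; case: ifPn => // /set_mem xE.
  by case: (outE x xE) => [h|[]//]; case/negP: nab; rewrite /a /b; move: r0 h; lra.
transitivity ((f (y, b) - f (y, a))%:E); first apply: (@FTC R (fun x => f (y, x)) (fun x => (f1 \_ E) (y, x))) => //.
- move=> x xI; rewrite patchE mem_set; last exact: inE'.
  exact: (d1 (y, x) (inE' x xI)).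
- apply: (@cont_on_eq _ _ _ _ (fun x => f1 (y, x))).
    by move=> x xI; rewrite patchE mem_set//; exact: inE'.
  apply: (cont_on_comp (K := E)) c1; first by move=> x; exact: inE'.
  by apply: cont_on_pair; [exact: cont_on_cst|exact: cont_on_id].
- have xa : `|x0 - (y, a)| < r by apply: inE'; rewrite lexx ltW.
  have xb : `|x0 - (y, b)| < r by apply: inE'; rewrite lexx ltW.
  have [->] : f (y, a) = 0 /\ f1 (y, a) = 0 by case: (outE a xa) => //; rewrite /a; move: r0; lra.
  have [->] : f (y, b) = 0 /\ f1 (y, b) = 0 by case: (outE b xb) => //; rewrite /b; move: r0; lra.
  by rewrite subrr.
Qed.

Lemma pint_pos (E : set plane) (Y : R) (f : plane -> R) (x0 : plane) : open E ->
  (forall x, E x -> 0 <= x.1 <= 1 /\ 0 <= x.2 <= Y) -> bounded_cont E f ->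
  (forall x, E x -> 0 <= f x) -> E x0 -> 0 < f x0 -> 0 < \int[mu2]_(x in E) f x.
Proof.
move=> oE EY bf f0 Ex0 fx0.
have fi := bounded_cont_integrable oE EY bf; have mE := open_plane_measurable oE.
have f20 : 0 < f x0 / 2 by rewrite divr_gt0.
have [r1 r10 H1] := bf.1 x0 Ex0 _ f20.
have [r2 r20 H2] := (open_normP _).1 oE x0 Ex0.
pose r := Num.min r1 r2 / 2; have m0 : 0 < Num.min r1 r2 by rewrite lt_min r10.
have rm : r < Num.min r1 r2 by rewrite /r; move: m0; lra.
have r0 : 0 < r by rewrite divr_gt0.
move: rm; rewrite lt_min => /andP[rr1 rr2].
pose Q := (`[x0.1 - r, x0.1 + r] `*` `[x0.2 - r, x0.2 + r])%classic.
have mQ : measurable Q by apply: measurableX; exact: measurable_itv.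
have QE x : Q x -> `|x0 - x| <= r.
  by move=> [] /=; rewrite !in_itv /= norm_pair_le /= !ler_distl; lra.
have QE' : Q `<=` E by move=> x /QE h; apply: H2; exact: le_lt_trans rr2.
rewrite /Rintegral; apply: fine_gt0; apply/andP; split; last first.
  have : (\int[mu2]_(x in E) (f x)%:E)%E \is a fin_num by exact: integrable_fin_num.
  by rewrite fin_numElt => /andP[].
have mf : measurable_fun E (EFin \o f) by exact: measurable_int fi.
apply: (@lt_le_trans _ _ (\int[mu2]_(x in Q) (f x)%:E)%E); last first.
  by apply: ge0_subset_integral => // x /f0; rewrite lee_fin.
apply: (@lt_le_trans _ _ (\int[mu2]_(x in Q) (f x0 / 2)%:E)%E).
  have mQE : mu2 Q = ((x0.1 + r - (x0.1 - r)) * (x0.2 + r - (x0.2 - r)))%:E.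
    by apply: box_measure; lra.
  rewrite integral_cst// [X in (_ < _ * X)%E]mQE.
  rewrite -EFinM lte_fin mulr_gt0// mulr_gt0//; lra.
apply: ge0_le_integral => //.
- by move=> x _; rewrite lee_fin ltW.
- exact: measurable_funS mf.
- move=> x Qx; rewrite lee_fin.
  have := H1 x (QE' _ Qx) (le_lt_trans (QE _ Qx) rr1); rewrite ltr_distl.
  by move=> /andP[_]; move: fx0; lra.
Qed.

End Calculus.

(** * Nonnegativity of the pressure *)

Section PressureSign.
Variable R : realType.
Local Notation plane := (R * R)%type.
Local Notation mu2 := (@lebesgue_measure R \x @lebesgue_measure R)%E.
Variables (c : R -> R -> plane) (D : R -> set plane).
Variables (u1 u1t u11 u12 u2 u2t u21 u22 : R -> plane -> R).

Record flow_pressure (p : R -> plane -> R) : Prop := {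
  pressure_cont : forall t : R, 0 < t -> cont_on (closure (D t)) (p t) ;
  pressure_surface : forall t a : R, 0 < t -> 0 <= a <= 1 -> p t (c t a) = 0 ;
  pressure_grad : forall (t : R) (x : plane), 0 < t -> D t x ->
    is_derive x.1 (1 : R) (fun s => p t (s, x.2)) (- material u1 u2 u1t u11 u12 t x) /\
    is_derive x.2 (1 : R) (fun s => p t (x.1, s)) (- material u1 u2 u2t u21 u22 t x)
}.

Hypothesis F : C1_flow c D u1 u1t u11 u12 u2 u2t u21 u22.
Variable p : R -> plane -> R.
Hypothesis P : flow_pressure p.
Local Notation B t := (bdry (D t)).
Local Notation q1 t x := (- material u1 u2 u1t u11 u12 t x).
Local Notation q2 t x := (- material u1 u2 u2t u21 u22 t x).

(* Its Laplacian is -2. *)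
Definition barrier (x : plane) : R := (x.1 - 2^-1) ^+ 2 - 2 * x.2 ^+ 2 - x.2.

Lemma grad_slice (t : R) : 0 < t ->
  cont_on (closure (D t)) (fun x => q1 t x) /\ cont_on (closure (D t)) (fun x => q2 t x).
Proof.
move=> t0; have tn := ltW t0.
have [[_ a1 a2 a3] _] := flow_u1 F; have [[_ b1 b2 b3] _] := flow_u2 F.
by split; apply: cont_onN; apply: field_slice tn; exact: (material_cont F).
Qed.

Lemma wall_pt_closure (t : R) (z : plane) : 0 <= t -> walls z -> closure (D t) z.
Proof. by move=> t0 wz; have := flow_bdry F t0 => /seteqP[_]/(_ z (or_introl wz))[]. Qed.

(* On the walls away from the free surface the normal derivative of the pressure
   vanishes, while that of the barrier points outward. *)
Lemma wall_not_min (t e : R) (z : plane) : 0 < t -> 0 < e -> walls z ->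
  z != (0, 1) -> z != (1, 1) ->
  exists2 y, closure (D t) y & p t y + e * barrier y < p t z + e * barrier z.
Proof.
move=> t0 e0 wz z0 z1; have tn := ltW t0.
have [c1 c2] := grad_slice t0; have cp := pressure_cont P t0.
have [r0 r00 H0] := wall_box F t wz z0 z1.
have tI : 0 <= t <= t by rewrite tn/=.
have HD y : `|z - y| < r0 -> 0 < y.1 < 1 -> 0 < y.2 -> D t y by exact: H0.
have e40 : 0 < e / 4 by rewrite divr_gt0.
have d1 x : D t x -> is_derive x.1 (1 : R) (fun s => p t (s, x.2)) (q1 t x).
  by move=> Dx; have [] := pressure_grad P t0 Dx.
have d2 x : D t x -> is_derive x.2 (1 : R) (fun s => p t (x.1, s)) (q2 t x).
  by move=> Dx; have [] := pressure_grad P t0 Dx.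
have [r1 r10 H1] := wall_increment1 F tn wz z0 z1 cp c1 d1 e40.
have [r2 r20 H2] := wall_increment2 F tn wz z0 z1 cp c2 d2 e40.
pose h := Num.min (Num.min r0 (2^-1)) (Num.min r1 r2) / 2.
have m0 : 0 < Num.min (Num.min r0 (2^-1)) (Num.min r1 r2).
  by rewrite !lt_min r00 r10 r20 invr_gt0 ltr0n.
have h0 : 0 < h by rewrite divr_gt0.
have hm : h < Num.min (Num.min r0 (2^-1)) (Num.min r1 r2) by rewrite /h; move: m0; clear -F P; lra.
move: hm; rewrite !lt_min => /andP[/andP[hr0 h12] /andP[hr1 hr2]].
have sz : strip_closed z by case: wz => i1 i2 _; split => //; case/andP: i2.
have hh : 0 < e * h by rewrite mulr_gt0.
have ehh : e * (h * h) <= e * h * 2^-1 by rewrite mulrA ler_pM2l// ltW.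
have zr (r : R) : 0 < r -> `|z - z| < r by rewrite subrr normr0.
have n1 k : `|k| < r0 -> `|z - (z.1 + k, z.2)| < r0.
  by rewrite norm_pair_lt /= subrr normr0 r00 andbT opprD addNKr normrN.
have n1' k : `|k| < r1 -> `|z - (z.1 + k, z.2)| < r1.
  by rewrite norm_pair_lt /= subrr normr0 r10 andbT opprD addNKr normrN.
have n2 k : `|k| < r0 -> `|z - (z.1, z.2 + k)| < r0.
  by rewrite norm_pair_lt /= subrr normr0 r00/= opprD addNKr normrN.
have n2' k : `|k| < r2 -> `|z - (z.1, z.2 + k)| < r2.
  by rewrite norm_pair_lt /= subrr normr0 r20/= opprD addNKr normrN.
case: (wz) => /andP[z10 z11] /andP[z20 z21] zor.
have lateral : z.1 = 0 \/ z.1 = 1 -> exists2 y, closure (D t) y & p t y + e * barrier y < p t z + e * barrier z.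
  move=> zw.
  have z21' : z.2 < 1.
    rewrite lt_neqAle z21 andbT; apply/eqP => E.
    by move: z0 z1; rewrite (surjective_pairing z) E; case: zw => ->; rewrite eqxx.
  have q0 : q1 t z = 0.
    have zI : 0 <= z.2 < 1 by rewrite z20.
    have := lateral_wall_u1 F t0 zI zw; rewrite -surjective_pairing => -[k1 k2 k3].
    by rewrite /material k1 k2 k3 mul0r mulr0 !addr0 oppr0.
  (* One step of length h away from the wall: the barrier changes by h^2 - h <= - h / 2, and e times
     this beats a pressure increment of at most e h / 4. *)
  have main k : `|k| = h -> 0 <= z.1 + k <= 1 -> (z.1 + k - 2^-1) ^+ 2 - (z.1 - 2^-1) ^+ 2 = h * h - h ->
     exists2 y, closure (D t) y & p t y + e * barrier y < p t z + e * barrier z.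
    move=> kh kI kE; exists (z.1 + k, z.2).
      by apply: (strip_closure HD) => //; apply: n1; rewrite kh.
    have := H1 z (z.1 + k, z.2) sz; rewrite q0 mul0r subr0 [(z.1 + k, z.2).1 - _]addrC addKr kh.
    move=> H1'; have {}H1' : `|p t (z.1 + k, z.2) - p t z| <= e / 4 * h.
      by apply: H1' => //; [exact: zr|apply: n1'; rewrite kh].
    move: H1'; rewrite ler_norml => /andP[_ H1'].
    have -> : barrier (z.1 + k, z.2) = barrier z + (h * h - h) by rewrite -kE /barrier /=; ring.
    by rewrite mulrDr mulrBr; move: H1' hh ehh; clear -F P; lra.
  case: zw => E.
    apply: (main h); [exact: gtr0_norm|rewrite E; move: h0 h12; clear -F P; lra|rewrite E !expr2; lra].
  apply: (main (- h)); [by rewrite normrN gtr0_norm|rewrite E; move: h0 h12; clear -F P; lra|rewrite E !expr2; lra].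
case: zor => [E|E|z2E]; [by apply: lateral; left|by apply: lateral; right|].
have [E|zn0] := eqVneq z.1 0; first by apply: lateral; left.
have [E|zn1] := eqVneq z.1 1; first by apply: lateral; right.
have zI : 0 < z.1 < 1 by rewrite lt_neqAle eq_sym zn0 z10 lt_neqAle zn1.
have q0 : q2 t z = 0.
  have zE : (z.1, 0) = z by rewrite -z2E -surjective_pairing.
  have := bottom_u2 F t0 zI; rewrite zE => -[k1 k2 k3].
  by rewrite /material k1 k2 k3 mul0r mulr0 !addr0 oppr0.
exists (z.1, z.2 + h).
  apply: (strip_closure HD); last by apply: n2; rewrite gtr0_norm.
  by split => /=; rewrite ?z10 ?z11// addr_ge0// ltW.
have := H2 z (z.1, z.2 + h) sz; rewrite q0 mul0r subr0 [(z.1, z.2 + h).2 - _]addrC addKr (gtr0_norm h0).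
move=> H2'; have {}H2' : `|p t (z.1, z.2 + h) - p t z| <= e / 4 * h.
  apply: H2' => //; [|exact: zr|by apply: n2'; rewrite gtr0_norm].
  by split => /=; rewrite ?z10 ?z11// addr_ge0// ltW.
move: H2'; rewrite ler_norml => /andP[_ H2'].
have -> : barrier (z.1, z.2 + h) = barrier z - (2 * (h * h) + h) by rewrite /barrier /= z2E; ring.
have ehp : 0 <= e * (h * h) by rewrite mulr_ge0 ?mulr_ge0// ltW.
by rewrite mulrBr mulrDr; move: H2' hh ehp; clear -F P; lra.
Qed.

(* In a frame moving with the velocity at x0 the pressure gradient is, up to the
   gradient of |u - u0|^2/2, the acceleration, i.e. a limit of divergence-free
   difference quotients; this stands in for the missing second derivatives. *)
Lemma interior_not_min (t e : R) (x0 : plane) : 0 < t -> 0 < e -> D t x0 ->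
  (forall y, D t y -> p t x0 + e * barrier x0 <= p t y + e * barrier y) -> False.
Proof.
move=> t0 e0 Dx0 wmin; have tn := ltW t0.
have oD := flow_open F tn; have Bt0 := bdry_neq0 F tn.
have [Y Y1 DY] := flow_box1 F tn.
pose r := dist (B t) x0 / 4.
have r0 : 0 < r by rewrite divr_gt0//; exact: (dist_gt0 oD Dx0 Bt0).
have d4 : dist (B t) x0 = 4 * r by rewrite /r; field.
pose E := [set x : plane | `|x0 - x| < r].
have ED x : E x -> D t x /\ 2 * r <= dist (B t) x.
  move=> Ex; split; first by apply: (in_ball_open oD Dx0 Bt0 _ Ex); rewrite d4; move: r0; clear -F P; lra.
  by have := dist_lip x0 x Bt0; rewrite d4; move: Ex r0; rewrite /E /=; clear -F P; lra.
have oE : open E.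
  apply/open_normP => x Ex; exists (r - `|x0 - x|); first by rewrite subr_gt0.
  by move=> y xy; have := ler_distD x x0 y; move: xy; rewrite /E /=; clear -F P; lra.
have EY x : E x -> 0 <= x.1 <= 1 /\ 0 <= x.2 <= Y by move=> /ED[/DY].
have Ex0 : E x0 by rewrite /E /= subrr normr0.
set a0 := u1 t x0; set b0 := u2 t x0.
(* The quadratic term makes the minimum strict; its Laplacian 4 eta = e leaves - e out of the - 2 e
   of the barrier. *)
pose eta := e / 4; have eta0 : 0 < eta by rewrite divr_gt0.
pose W (x : plane) : R := p t x + ((u1 t x - a0) ^+ 2 + (u2 t x - b0) ^+ 2) / 2 + e * barrier x +
  eta * ((x.1 - x0.1) ^+ 2 + (x.2 - x0.2) ^+ 2).
pose L1 (x : plane) : R := 2 * e * (x.1 - 2^-1) + 2 * eta * (x.1 - x0.1).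
pose L2 (x : plane) : R := - e * (4 * x.2 + 1) + 2 * eta * (x.2 - x0.2).
pose W1 (x : plane) : R := L1 x - (u1t t x + a0 * u11 t x + b0 * u12 t x).
pose W2 (x : plane) : R := L2 x - (u2t t x + a0 * u21 t x + b0 * u22 t x).
have dW1 x : E x -> is_derive x.1 1 (fun s => W (s, x.2)) (W1 x).
  move=> /ED[Dx _]; have [_ f1] := flow_u1 F; have [_ f2] := flow_u2 F.
  have [_ g1 _] := f1 t x t0 Dx; have [_ g2 _] := f2 t x t0 Dx.
  have [gp _] := pressure_grad P t0 Dx; have [_ curl] := flow_div_curl F t0 Dx.
  have h1 := derB g1 (derC x.1 a0); have h2 := derB g2 (derC x.1 b0).
  have h3 := derB (derI x.1) (derC x.1 2^-1); have h4 := derB (derI x.1) (derC x.1 x0.1).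
  have k1 := derD gp (derZ 2^-1 (derD (derM h1 h1) (derM h2 h2))).
  have k2 := derZ e (derB (derM h3 h3) (derC x.1 (2 * x.2 ^+ 2 + x.2))).
  have k3 := derZ eta (derD (derM h4 h4) (derC x.1 ((x.2 - x0.2) ^+ 2))).
  have k4 := derD (derD k1 k2) k3.
  have EW : (fun s => W (s, x.2)) = fun s => p t (s, x.2) +
    2^-1 * ((u1 t (s, x.2) - a0) * (u1 t (s, x.2) - a0) + (u2 t (s, x.2) - b0) * (u2 t (s, x.2) - b0)) +
    e * ((s - 2^-1) * (s - 2^-1) - (2 * x.2 ^+ 2 + x.2)) +
    eta * ((s - x0.1) * (s - x0.1) + (x.2 - x0.2) ^+ 2).
    by apply/funext => s; rewrite /W /barrier /=; field.
  rewrite EW; apply: is_derive_eq k4 _.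
  by rewrite -!surjective_pairing /W1 /L1 /material -curl; field.
have dW2 x : E x -> is_derive x.2 1 (fun s => W (x.1, s)) (W2 x).
  move=> /ED[Dx _]; have [_ f1] := flow_u1 F; have [_ f2] := flow_u2 F.
  have [_ _ g1] := f1 t x t0 Dx; have [_ _ g2] := f2 t x t0 Dx.
  have [_ gp] := pressure_grad P t0 Dx; have [_ curl] := flow_div_curl F t0 Dx.
  have h1 := derB g1 (derC x.2 a0); have h2 := derB g2 (derC x.2 b0).
  have h3 := derB (derC x.2 ((x.1 - 2^-1) ^+ 2)) (derD (derZ 2 (derM (derI x.2) (derI x.2))) (derI x.2)).
  have h4 := derB (derI x.2) (derC x.2 x0.2).
  have k1 := derD gp (derZ 2^-1 (derD (derM h1 h1) (derM h2 h2))).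
  have k3 := derZ eta (derD (derC x.2 ((x.1 - x0.1) ^+ 2)) (derM h4 h4)).
  have k4 := derD (derD k1 (derZ e h3)) k3.
  have EW : (fun s => W (x.1, s)) = fun s => p t (x.1, s) +
    2^-1 * ((u1 t (x.1, s) - a0) * (u1 t (x.1, s) - a0) + (u2 t (x.1, s) - b0) * (u2 t (x.1, s) - b0)) +
    e * ((x.1 - 2^-1) ^+ 2 - (2 * (s * s) + s)) +
    eta * ((x.1 - x0.1) ^+ 2 + (s - x0.2) * (s - x0.2)).
    by apply/funext => s; rewrite /W /barrier /=; field.
  rewrite EW; apply: is_derive_eq k4 _.
  by rewrite -!surjective_pairing /W2 /L2 /material curl; field.
(* Outside the half square W exceeds its value at x0 by at least delta, so the test function [m] is
   supported in the half square. *)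
pose delta := eta * (r / 2) ^+ 2.
have delta0 : 0 < delta by rewrite mulr_gt0// exprn_gt0// divr_gt0.
pose m (x : plane) : R := pos (delta - (W x - W x0)).
have Wge x : E x -> W x0 + eta * ((x.1 - x0.1) ^+ 2 + (x.2 - x0.2) ^+ 2) <= W x.
  move=> /ED[Dx _]; have := wmin x Dx.
  have -> : W x0 = p t x0 + e * barrier x0 by rewrite /W /a0 /b0; field.
  rewrite /W; have := sqr_ge0 (u1 t x - a0); have := sqr_ge0 (u2 t x - b0).
  by clear -F P; lra.
have m0 x : E x -> r / 2 < `|x0 - x| -> m x = 0.
  move=> Ex xr; apply: pos_eq0; have := Wge x Ex.
  have sq (y y' : R) : r / 2 < `|y - y'| -> (r / 2) ^+ 2 <= (y' - y) ^+ 2.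
    move=> h; rewrite -[leRHS]real_normK ?num_real// distrC; apply: lerXn2r; rewrite ?nnegrE//.
      by rewrite divr_ge0// ltW.
    exact: ltW.
  have : (r / 2) ^+ 2 <= (x.1 - x0.1) ^+ 2 + (x.2 - x0.2) ^+ 2.
    have s1 := sqr_ge0 (x.1 - x0.1); have s2 := sqr_ge0 (x.2 - x0.2).
    have : ~~ (`|x0 - x| <= r / 2) by rewrite -ltNge.
    rewrite norm_pair_le negb_and -!ltNge /= => /orP[] /sq; move: s1 s2; clear -F P; lra.
  rewrite -(ler_pM2l eta0) -/delta; clear -F P; lra.
have cslice (f : R -> plane -> R) : cont_on (spacetime D) (fun z => f z.1 z.2) -> bounded_cont E (f t).
  move=> cf; have [k [M HM]] := field_bounded_cont F cf tn.
  split; first by apply: cont_onS k => x /ED[].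
  by exists M => x /ED[/HM].
have bC (k : R) : bounded_cont E (fun=> k) by exact: bounded_cont_cst.
have bx1 : bounded_cont E (fun x => x.1).
  split; first exact: cont_on_fst.
  by exists 1 => x /EY[/andP[h1 h2] _]; rewrite ger0_norm.
have bx2 : bounded_cont E (fun x => x.2).
  split; first exact: cont_on_snd.
  by exists Y => x /EY[_ /andP[h1 h2]]; rewrite ger0_norm.
have bD := @bounded_contD R E; have bB := @bounded_contB R E; have bM := @bounded_contM R E.
have bL1 : bounded_cont E L1 by exact: (bD _ _ (bM _ _ (bC _) (bB _ _ bx1 (bC _))) (bM _ _ (bC _) (bB _ _ bx1 (bC _)))).
have bL2 : bounded_cont E L2.
  exact: (bD _ _ (bM _ _ (bC _) (bD _ _ (bM _ _ (bC _) bx2) (bC _))) (bM _ _ (bC _) (bB _ _ bx2 (bC _)))).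
have [[c1 c1t c11 c12] _] := flow_u1 F; have [[c2 c2t c21 c22] _] := flow_u2 F.
have bW1 : bounded_cont E W1.
  exact: (bB _ _ bL1 (bD _ _ (bD _ _ (cslice _ c1t) (bM _ _ (bC _) (cslice _ c11))) (bM _ _ (bC _) (cslice _ c12)))).
have bW2 : bounded_cont E W2.
  exact: (bB _ _ bL2 (bD _ _ (bD _ _ (cslice _ c2t) (bM _ _ (bC _) (cslice _ c21))) (bM _ _ (bC _) (cslice _ c22)))).
have bp : bounded_cont E (p t).
  split; first by apply: cont_onS (pressure_cont P t0) => x /ED[/subset_closure].
  have cc : compact (closure (D t)).
    have [Y2 _ HY2] := domain_height F t.
    apply: subclosed_compact (@closed_closure _ _) (@compact_rect R 0 1 0 Y2) _ => x cx.
    by have [] := HY2 t x (ltac:(by rewrite tn/=)) cx.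
  have [M _ HM] := cont_on_bounded cc (pressure_cont P t0).
  by exists M => x /ED[Dx _]; apply: HM; exact: subset_closure.
have bv1 := bB _ _ (cslice _ c1) (bC a0); have bv2 := bB _ _ (cslice _ c2) (bC b0).
have by1 := bB _ _ bx1 (bC x0.1); have by2 := bB _ _ bx2 (bC x0.2).
have by3 := bB _ _ bx1 (bC 2^-1).
have bW : bounded_cont E W.
  exact: (bD _ _ (bD _ _ (bD _ _ bp (bM _ _ (bD _ _ (bM _ _ bv1 bv1) (bM _ _ bv2 bv2)) (bC 2^-1)))
    (bM _ _ (bC e) (bB _ _ (bB _ _ (bM _ _ by3 by3) (bM _ _ (bC 2) (bM _ _ bx2 bx2))) bx2)))
    (bM _ _ (bC eta) (bD _ _ (bM _ _ by1 by1) (bM _ _ by2 by2)))).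
have bm : bounded_cont E m.
  have [k [M HM]] := bB _ _ (bC delta) (bB _ _ bW (bC (W x0))).
  split; first exact: (cont_on_comp (K := setT) _ k (@cont_on_pos R)).
  exists M => x Ex; apply: le_trans (HM x Ex).
  by have := pos_lip (delta - (W x - W x0)) 0; rewrite (pos_id (lexx 0)) !subr0.
have bm2 := bM _ _ bm bm.
set Phi := \int[mu2]_(x in E) (m x * m x).
have Phi0 : 0 < Phi.
  apply: (pint_pos oE EY bm2 _ Ex0); first by move=> x _; rewrite mulr_ge0// pos_ge0.
  by rewrite /m subrr subr0 pos_id ?(ltW delta0)// mulr_gt0.
set Mm := \int[mu2]_(x in E) m x.
have Mm0 : 0 <= Mm.
  have : \int[mu2]_(x in E) (0 : R) <= Mm.
    by apply: (le_pint oE EY (bC 0) bm) => x _; exact: pos_ge0.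
  by rewrite /Rintegral integral0.
have [N1 HN1] := bW1.2; have [N2 HN2] := bW2.2.
have N10 : 0 <= N1 by apply: le_trans (HN1 x0 Ex0).
have N20 : 0 <= N2 by apply: le_trans (HN2 x0 Ex0).
(* Chosen so that the error made by replacing grad W with difference quotients,
   [2 * kap * (N1 + N2) * Mm] after integration, stays below [e * Phi]. *)
pose kap := e * Phi / (4 * (1 + N1 + N2) * (1 + Mm)).
have den0 : 0 < 4 * (1 + N1 + N2) * (1 + Mm).
  by rewrite mulr_gt0 ?mulr_gt0//; move: N10 N20 Mm0; clear -F P; lra.
have kap0 : 0 < kap by rewrite divr_gt0// mulr_gt0.
pose V0 := 1 + `|a0| + `|b0|.
have V00 : 0 < V0 by rewrite /V0 ltr_wpDr// ltr_wpDr.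
have rho0 : 0 < 2 * r by rewrite mulr_gt0.
have [h1 h10 H1] := expansion F t (flow_u1 F) rho0 kap0 V00.
have [h2 h20 H2] := expansion F t (flow_u2 F) rho0 kap0 V00.
have [h3 h30 H3] := tube F (t + 1) rho0.
pose hm := Num.min (Num.min h1 h2) (Num.min (Num.min h3 1) (r / V0)).
have hm0 : 0 < hm by rewrite !lt_min h10 h20 h30 ltr01 divr_gt0.
pose h := hm / 2; have hp : 0 < h by rewrite divr_gt0.
have : h < hm by rewrite /h; move: hm0; clear -F P; lra.
rewrite !lt_min => /andP[/andP[hh1 hh2] /andP[/andP[hh3 hl1] hV]].
rewrite ltr_pdivlMr// in hV.
have thn : 0 <= t + h by rewrite addr_ge0// ltW.
have th0 : 0 < t + h by rewrite addr_gt0.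
pose sh (x : plane) : plane := (x.1 + h * a0, x.2 + h * b0).
have aV : `|a0| <= V0 by rewrite /V0; have := normr_ge0 b0; clear -F P; lra.
have bV : `|b0| <= V0 by rewrite /V0; have := normr_ge0 a0; clear -F P; lra.
have shD x : E x -> D (t + h) (sh x).
  move=> /ED[Dx dx]; apply: (H3 t (t + h) x _ _ _ Dx dx).
  - by rewrite tn lerDl ler01.
  - by rewrite thn lerD2l ltW.
  - by rewrite [t + h - t]addrC addKr gtr0_norm.
  - have hv (v : R) : `|v| <= V0 -> `|h * v| < 2 * r / 2.
      move=> vV; rewrite normrM (gtr0_norm hp).
      have : h * `|v| <= h * V0 by rewrite ler_pM2l.
      by move: hV; clear -F P; lra.
    by rewrite norm_pair_lt /= !opprD !addNKr !normrN !hv.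
have bsh (f : R -> plane -> R) : cont_on (spacetime D) (fun z => f z.1 z.2) ->
    bounded_cont E (fun x => f (t + h) (sh x)).
  move=> cf; have [k [M HM]] := field_bounded_cont F cf thn.
  split; last by exists M => x /shD/HM.
  apply: (cont_on_comp (K := D (t + h)) (f := sh)) k => //.
  apply: cont_on_pair; (apply: cont_onD; last exact: cont_on_cst).
    exact: cont_on_fst.
  exact: cont_on_snd.
have bE (f : R -> plane -> R) : cont_on (spacetime D) (fun z => f z.1 z.2) ->
    bounded_cont E (fun x => h^-1 * (f (t + h) (sh x) - f t x)).
  by move=> cf; exact: (bM _ _ (bC _) (bB _ _ (bsh _ cf) (cslice _ cf))).
(* The field (A1, A2) is within kap of grad W in each component and has divergence exactly - e,
   since the difference quotients, taken along a constant displacement, are divergence free. *)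
pose A1 (x : plane) : R := L1 x - h^-1 * (u1 (t + h) (sh x) - u1 t x).
pose A2 (x : plane) : R := L2 x - h^-1 * (u2 (t + h) (sh x) - u2 t x).
pose A11 (x : plane) : R := (2 * e + 2 * eta) - h^-1 * (u11 (t + h) (sh x) - u11 t x).
pose A22 (x : plane) : R := (- e * 4 + 2 * eta) - h^-1 * (u22 (t + h) (sh x) - u22 t x).
have near1 x : E x -> `|A1 x - W1 x| <= kap.
  move=> /ED[Dx dx].
  have := H1 t h a0 b0 x (ltac:(by rewrite t0 lexx)) (ltac:(by rewrite hp hh1)) Dx dx aV bV.
  have -> : A1 x - W1 x = - (h^-1 * (u1 (t + h) (sh x) - u1 t x - h * (u1t t x + a0 * u11 t x + b0 * u12 t x))).
    by rewrite /A1 /W1; field; rewrite gt_eqF.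
  by rewrite normrN normrM gtr0_norm ?invr_gt0// ler_pdivrMl// [h * kap]mulrC.
have near2 x : E x -> `|A2 x - W2 x| <= kap.
  move=> /ED[Dx dx].
  have := H2 t h a0 b0 x (ltac:(by rewrite t0 lexx)) (ltac:(by rewrite hp hh2)) Dx dx aV bV.
  have -> : A2 x - W2 x = - (h^-1 * (u2 (t + h) (sh x) - u2 t x - h * (u2t t x + a0 * u21 t x + b0 * u22 t x))).
    by rewrite /A2 /W2; field; rewrite gt_eqF.
  by rewrite normrN normrM gtr0_norm ?invr_gt0// ler_pdivrMl// [h * kap]mulrC.
have dA1 x : E x -> is_derive x.1 1 (fun s => A1 (s, x.2)) (A11 x).
  move=> Ex; have [Dx _] := ED x Ex; have [_ f1] := flow_u1 F.
  have [_ g1 _] := f1 t x t0 Dx; have [_ g2 _] := f1 (t + h) (sh x) th0 (shD x Ex).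
  have k1 := derB (derShift g2) g1.
  have k2 := derB (derI x.1) (derC x.1 2^-1); have k3 := derB (derI x.1) (derC x.1 x0.1).
  have k4 := derB (derD (derZ (2 * e) k2) (derZ (2 * eta) k3)) (derZ h^-1 k1).
  by apply: is_derive_eq k4 _; rewrite /A11 !subr0 !mulr1.
have dA2 x : E x -> is_derive x.2 1 (fun s => A2 (x.1, s)) (A22 x).
  move=> Ex; have [Dx _] := ED x Ex; have [_ f1] := flow_u2 F.
  have [_ _ g1] := f1 t x t0 Dx; have [_ _ g2] := f1 (t + h) (sh x) th0 (shD x Ex).
  have k1 := derB (derShift g2) g1.
  have k2 := derD (derZ 4 (derI x.2)) (derC x.2 1); have k3 := derB (derI x.2) (derC x.2 x0.2).
  have k4 := derB (derD (derZ (- e) k2) (derZ (2 * eta) k3)) (derZ h^-1 k1).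
  by apply: is_derive_eq k4 _; rewrite /A22 !subr0 !addr0 !mulr1.
have bA1 : bounded_cont E A1 by exact: bB _ _ bL1 (bE _ c1).
have bA2 : bounded_cont E A2 by exact: bB _ _ bL2 (bE _ c2).
have bA11 : bounded_cont E A11 by exact: bB _ _ (bC _) (bE _ c11).
have bA22 : bounded_cont E A22 by exact: bB _ _ (bC _) (bE _ c22).
have dm (w : R -> R) (s w' : R) : is_derive s 1 w w' ->
    is_derive s 1 (fun s => pos (delta - (w s - W x0)) ^+ 2) (2 * pos (delta - (w s - W x0)) * - w').
  move=> dw; have := derB (derC s delta) (derB dw (derC s (W x0))).
  rewrite subr0 sub0r => k; exact: (chain_rule k (derSqpos _)).
(* [f1 + f2] is the divergence of m^2 (A1, A2), whose integral vanishes by compact support.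
   Expanded, it is - e m^2 minus a term that is nonnegative up to the error in kap. *)
pose f1 (x : plane) : R := A11 x * (m x * m x) + A1 x * (2 * m x * - W1 x).
pose f2 (x : plane) : R := A22 x * (m x * m x) + A2 x * (2 * m x * - W2 x).
have bf1 : bounded_cont E f1.
  exact: (bD _ _ (bM _ _ bA11 bm2) (bM _ _ bA1 (bM _ _ (bM _ _ (bC 2) bm) (bounded_contN bW1)))).
have bf2 : bounded_cont E f2.
  exact: (bD _ _ (bM _ _ bA22 bm2) (bM _ _ bA2 (bM _ _ (bM _ _ (bC 2) bm) (bounded_contN bW2)))).
have I1 : \int[mu2]_(x in E) f1 x = 0.
  suff S : (\int[mu2]_(x in E) (f1 x)%:E = 0)%E by rewrite /Rintegral S.
  have ii := bounded_cont_integrable oE EY bf1.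
  have dd (x : plane) : `|x0 - x| < r ->
      is_derive x.1 1 (fun s => A1 (s, x.2) * m (s, x.2) ^+ 2) (f1 x).
    move=> Ex; have := derM (dA1 x Ex) (dm _ _ _ (dW1 x Ex)).
    by rewrite -!surjective_pairing [pos _ ^+ 2]expr2.
  have ss (x : plane) : `|x0 - x| < r -> r / 2 < `|x0 - x| -> A1 x * m x ^+ 2 = 0 /\ f1 x = 0.
    by move=> Ex xr; rewrite /f1 m0// expr0n /= !(mulr0, mul0r) addr0.
  exact: (square_divergence1 (f := fun x => A1 x * m x ^+ 2) r0 bf1.1 ii oE dd ss).
have I2 : \int[mu2]_(x in E) f2 x = 0.
  suff S : (\int[mu2]_(x in E) (f2 x)%:E = 0)%E by rewrite /Rintegral S.
  have ii := bounded_cont_integrable oE EY bf2.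
  have dd (x : plane) : `|x0 - x| < r ->
      is_derive x.2 1 (fun s => A2 (x.1, s) * m (x.1, s) ^+ 2) (f2 x).
    move=> Ex; have := derM (dA2 x Ex) (dm _ _ _ (dW2 x Ex)).
    by rewrite -!surjective_pairing [pos _ ^+ 2]expr2.
  have ss (x : plane) : `|x0 - x| < r -> r / 2 < `|x0 - x| -> A2 x * m x ^+ 2 = 0 /\ f2 x = 0.
    by move=> Ex xr; rewrite /f2 m0// expr0n /= !(mulr0, mul0r) addr0.
  exact: (square_divergence2 (f := fun x => A2 x * m x ^+ 2) r0 bf2.1 ii oE dd ss).
have bR := bD _ _ (bM _ _ (bC (- e)) bm2) (bM _ _ (bC (2 * kap * (N1 + N2))) bm).
have := le_pint oE EY (bD _ _ bf1 bf2) bR.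
rewrite (pintD oE EY bf1 bf2) I1 I2 addr0 (pintD oE EY (bM _ _ (bC (- e)) bm2) (bM _ _ (bC _) bm)).
rewrite (pintZ oE EY _ bm2) (pintZ oE EY _ bm) -/Phi -/Mm => Hfin.
have {Hfin} : 0 <= - e * Phi + 2 * kap * (N1 + N2) * Mm.
  apply: Hfin => x Ex; have [Dx _] := ED x Ex.
  have div0 : u11 t x + u22 t x = 0 by have [] := flow_div_curl F t0 Dx.
  have div1 : u11 (t + h) (sh x) + u22 (t + h) (sh x) = 0.
    by have [] := flow_div_curl F th0 (shD x Ex).
  have divA : A11 x + A22 x = - e.
    have -> : A11 x + A22 x = - 2 * e + 4 * eta -
      h^-1 * ((u11 (t + h) (sh x) + u22 (t + h) (sh x)) - (u11 t x + u22 t x)).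
      by rewrite /A11 /A22; ring.
    by rewrite div0 div1 subrr mulr0 subr0 /eta; field.
  have -> : f1 x + f2 x = - e * (m x * m x) - 2 * m x * (A1 x * W1 x + A2 x * W2 x).
    by rewrite -divA /f1 /f2; ring.
  rewrite lerD2l; have mx0 : 0 <= m x by exact: pos_ge0.
  have n1 : - (kap * N1) <= (A1 x - W1 x) * W1 x.
    have : `|(A1 x - W1 x) * W1 x| <= kap * N1 by rewrite normrM ler_pM// ?near1// HN1.
    by rewrite ler_norml => /andP[].
  have n2 : - (kap * N2) <= (A2 x - W2 x) * W2 x.
    have : `|(A2 x - W2 x) * W2 x| <= kap * N2 by rewrite normrM ler_pM// ?near2// HN2.
    by rewrite ler_norml => /andP[].
  have s1 := sqr_ge0 (W1 x); have s2 := sqr_ge0 (W2 x).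
  have key : - (kap * (N1 + N2)) <= A1 x * W1 x + A2 x * W2 x.
    have -> : A1 x * W1 x + A2 x * W2 x = W1 x ^+ 2 + W2 x ^+ 2 + (A1 x - W1 x) * W1 x + (A2 x - W2 x) * W2 x by ring.
    by move: n1 n2 s1 s2; clear -F P; lra.
  have : 0 <= 2 * m x * (A1 x * W1 x + A2 x * W2 x + kap * (N1 + N2)).
    by rewrite mulr_ge0 ?mulr_ge0//; move: key; clear -F P; lra.
  by clear -F P; lra.
have -> : - e * Phi + 2 * kap * (N1 + N2) * Mm =
  - (e * Phi) * (1 - (N1 + N2) * Mm / (2 * (1 + N1 + N2) * (1 + Mm))).
  rewrite /kap; field; apply/andP; split; rewrite gt_eqF//; move: N10 N20 Mm0; clear -F P; lra.
have den1 : 0 < 2 * (1 + N1 + N2) * (1 + Mm).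
  by rewrite mulr_gt0 ?mulr_gt0//; move: N10 N20 Mm0; clear -F P; lra.
apply/negP; rewrite -ltNge mulNr oppr_lt0 mulr_gt0 ?mulr_gt0// subr_gt0 ltr_pdivrMr// mul1r.
have : 0 <= (N1 + N2) * Mm by rewrite mulr_ge0// addr_ge0.
by move: N10 N20 Mm0; clear -F P; lra.
Qed.

(** Minimise p plus e times the barrier over the closure of the fluid. If p were negative somewhere,
    the minimum would avoid the surface, where p = 0; the walls are excluded by [wall_not_min] and
    the interior by [interior_not_min]. *)
Lemma pressure_ge0 (t : R) (x : plane) : 0 < t -> closure (D t) x -> 0 <= p t x.
Proof.
move=> t0 cx; have tn := ltW t0; rewrite leNgt; apply/negP => px.
have [Y Y1 HY0] := domain_height F t.
have HY y : closure (D t) y -> 0 <= y.1 <= 1 /\ 0 <= y.2 <= Y.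
  by move=> cy; have [] := HY0 t y (ltac:(by rewrite tn/=)) cy.
have cc : compact (closure (D t)).
  exact: subclosed_compact (@closed_closure _ _) (@compact_rect R 0 1 0 Y) HY.
pose G := 1 + 3 * Y * Y.
have Y0 : 0 < Y by apply: lt_le_trans Y1.
have G0 : 0 < G by rewrite /G; have := mulr_gt0 Y0 Y0; clear -F P; lra.
have gG y : closure (D t) y -> `|barrier y| <= G.
  move=> /HY[/andP[y10 y11] /andP[y20 y2Y]].
  have s1 : (y.1 - 2^-1) ^+ 2 <= 1.
    have -> : (y.1 - 2^-1) ^+ 2 = 4^-1 - y.1 * (1 - y.1) by field.
    have : 0 <= y.1 * (1 - y.1) by rewrite mulr_ge0// subr_ge0.
    by clear -F P; lra.
  have s2 : y.2 * y.2 <= Y * Y by rewrite ler_pM.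
  have s3 : Y <= Y * Y by rewrite ler_peMl// ltW.
  have s4 := sqr_ge0 (y.1 - 2^-1); have s5 : 0 <= y.2 * y.2 by rewrite mulr_ge0.
  by rewrite /barrier /G expr2 ler_norml; move: s1 s2 s3 s4 s5 y20 y2Y; rewrite !expr2; clear -F P; lra.
(* As the barrier is bounded by G, its contribution is at most a quarter of the size of [p t x], so
   p is still negative at the minimum. *)
pose e := - p t x / (4 * G).
have e0 : 0 < e by rewrite divr_gt0 ?oppr_gt0 ?mulr_gt0.
have eG : e * G * 4 = - p t x by rewrite /e; field; rewrite gt_eqF.
have cw : cont_on (closure (D t)) (fun y => p t y + e * barrier y).
  apply: cont_onD; first exact: (pressure_cont P t0).
  apply: cont_onM; first exact: cont_on_cst.
  have c1 : cont_on (closure (D t)) (fun y => y.1 - 2^-1 : R).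
    by apply: cont_onB; [exact: cont_on_fst|exact: cont_on_cst].
  have c2 : cont_on (closure (D t)) (fun y => y.2 : R) by exact: cont_on_snd.
  apply: cont_onB => //; apply: cont_onB; first exact: cont_onM.
  by apply: cont_onM; [exact: cont_on_cst|exact: cont_onM].
have [z cz zmin] := cont_on_min cc (ex_intro _ x cx) cw.
have zx := zmin x cx.
have egG y : closure (D t) y -> `|e * barrier y| <= e * G.
  by move=> cy; rewrite normrM (gtr0_norm e0) ler_pM2l//; exact: gG.
have pz : p t z < 0.
  have := egG z cz; have := egG x cx; rewrite !ler_norml => /andP[h1 h2] /andP[h3 h4].
  by move: zx eG px h1 h2 h3 h4; clear -F P; lra.
have notsurf a : 0 <= a <= 1 -> z <> c t a.
  by move=> aI zE; move: pz; rewrite zE (pressure_surface P t0 aI) ltxx.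
have [Dz|nDz] := pselect (D t z).
  apply: (interior_not_min t0 e0 Dz) => y Dy; apply: zmin; exact: subset_closure.
have : B t z.
  by split => // /interior_subset.
rewrite (flow_bdry F tn) => -[wz|[a /=]]; last first.
  by rewrite in_itv /= => aI /esym; exact: notsurf.
have [c0 c1 _] := flow_surface F tn.
have z0 : z != (0, 1).
  by apply/eqP => E; apply: (notsurf 0); rewrite ?lexx ?ler01// c0.
have z1 : z != (1, 1).
  by apply/eqP => E; apply: (notsurf 1); rewrite ?lexx ?ler01// c1.
have [y cy] := wall_not_min t0 e0 wz z0 z1.
by rewrite ltNge zmin.
Qed.

End PressureSign.

(** * The pressure on the right wall *)

Section LineIntegral.
Variable R : realType.
Local Notation mu := (@lebesgue_measure R).
Local Notation seg := [set s : R | 0 <= s <= 1].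
Implicit Types f g : R -> R.

Lemma integral_on (d : measure_display) (T : measurableType d) (nu : {measure set T -> \bar R})
    (A : set T) (k : T -> R) : (forall x, ~ A x -> k x = 0) ->
  (\int[nu]_x (k x)%:E = \int[nu]_(x in A) (k x)%:E)%E.
Proof.
move=> H; rewrite [RHS]integral_mkcond; apply: eq_integral => x _.
by rewrite patchE; case: ifPn => // /negP nA; rewrite H// => Ax; apply: nA; exact: mem_set.
Qed.

Lemma bounded_cvg (d : measure_display) (T : measurableType d) (nu : {measure set T -> \bar R})
    (A : set T) (fn : nat -> T -> R) (f : T -> R) (M : R) : measurable A ->
  (forall n, measurable_fun A (fn n)) -> measurable_fun A f ->
  (forall x, A x -> (fun n => fn n x) @ \oo --> f x) ->
  nu.-integrable A (EFin \o (fun=> M)) -> (forall n x, A x -> `|fn n x| <= M) ->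
  (fun n => (\int[nu]_(x in A) (fn n x)%:E)%E) @ \oo --> (\int[nu]_(x in A) (f x)%:E)%E.
Proof.
move=> mA mfn mf lim iM fM.
have [] // := @dominated_convergence _ T R nu A mA (fun n => EFin \o fn n) (EFin \o f) (EFin \o (fun=> M)).
- by move=> n; exact/measurable_EFinP.
- exact/measurable_EFinP.
- by apply: aeW => x Ax; apply: cvg_EFin; [exact: nearW|exact: lim].
- by apply: aeW => x n Ax /=; rewrite lee_fin fM.
Qed.

Lemma seg_integrable f : cont_on seg f -> mu.-integrable `[0, 1] (EFin \o f).
Proof.
by move=> /cont_on_itv cf; apply: continuous_compact_integrable => //; exact: segment_compact.
Qed.

Local Notation I f := (\int[mu]_(s in `[0, 1]) f s).

Lemma lintD f g : cont_on seg f -> cont_on seg g -> I (fun s => f s + g s) = I f + I g.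
Proof. by move=> /seg_integrable fi /seg_integrable gi; rewrite RintegralD. Qed.

Lemma lintB f g : cont_on seg f -> cont_on seg g -> I (fun s => f s - g s) = I f - I g.
Proof. by move=> /seg_integrable fi /seg_integrable gi; rewrite RintegralB. Qed.

Lemma lintZ (a : R) f : cont_on seg f -> I (fun s => a * f s) = a * I f.
Proof. by move=> /seg_integrable fi; rewrite RintegralZl. Qed.

Lemma le_lint f g : cont_on seg f -> cont_on seg g -> (forall s, 0 <= s <= 1 -> f s <= g s) ->
  I f <= I g.
Proof.
move=> /seg_integrable fi /seg_integrable gi fg; exact: le_Rintegral.
Qed.

Lemma eq_lint f g : (forall s, 0 <= s <= 1 -> f s = g s) -> I f = I g.
Proof. by move=> fg; apply: eq_Rintegral => s /set_mem /=; rewrite in_itv /=; exact: fg. Qed.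

Lemma lint_cst (a : R) : I (fun=> a) = a.
Proof.
rewrite /Rintegral integral_cst//= lebesgue_measure_itv /= lte_fin ltr01.
by rewrite oppr0 adde0 mule1.
Qed.

Lemma norm_lint_le f (M : R) : cont_on seg f -> (forall s, 0 <= s <= 1 -> `|f s| <= M) -> `|I f| <= M.
Proof.
move=> cf fM; have cM : cont_on seg (fun=> M) by exact: cont_on_cst.
have cN : cont_on seg (fun=> - M) by exact: cont_on_cst.
rewrite ler_norml -{1}(lint_cst (- M)) -[X in _ <= _ <= X](lint_cst M); apply/andP.
by split; apply: le_lint => // s /fM; rewrite ler_norml => /andP[].
Qed.

Lemma FTC_interior (G g : R -> R) : cont_on seg G -> cont_on seg g ->
  (forall s : R, 0 < s < 1 -> is_derive s (1 : R) G (g s)) -> I g = G 1 - G 0.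
Proof.
move=> cG cg dG; have [_ G0 G1] := (continuous_within_itvP _ (@ltr01 R)).1 ((cont_on_itv _ _ _).1 cG).
rewrite /Rintegral (@continuous_FTC2 R g G)//.
- exact/cont_on_itv.
- split => // s; rewrite in_itv /= => /dG dGs; exact: ex_derive.
- by move=> s; rewrite in_itv /= => sI; have dGs := dG s sI; rewrite derive1E derive_val.
Qed.

(* A C^1 approximation from below of the positive part, vanishing near 0. *)
Definition beta (e s : R) : R := (2 * e)^-1 * (pos (s - e) ^+ 2 - pos (s - 2 * e) ^+ 2).
Definition betad (e s : R) : R := e^-1 * (pos (s - e) - pos (s - 2 * e)).

Lemma beta_derive (e s : R) : 0 < e -> is_derive s (1 : R) (beta e) (betad e s).
Proof.
move=> e0.
have sh (k : R) : is_derive s 1 (fun s => pos (s - k) ^+ 2) (2 * pos (s - k)).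
  exact: derShift (derSqpos (s + - k)).
apply: is_derive_eq (derZ (2 * e)^-1 (derB (sh e) (sh (2 * e)))) _.
by rewrite /betad; field; rewrite gt_eqF.
Qed.

Lemma beta_small (e s : R) : 0 < e -> s <= e -> beta e s = 0 /\ betad e s = 0.
Proof.
move=> e0 se; rewrite /beta /betad !pos_eq0; [|lra|lra].
by rewrite !subrr !mulr0.
Qed.

Lemma beta_large (e s : R) : 0 < e -> 2 * e <= s -> betad e s = 1.
Proof.
move=> e0 se; rewrite /betad !pos_id; [|lra|lra].
by field; rewrite gt_eqF.
Qed.

Lemma betad01 (e s : R) : 0 < e -> 0 <= betad e s <= 1.
Proof.
move=> e0; have [s1|s1] := leP s e; first by have [_ ->] := beta_small e0 s1; rewrite lexx ler01.
have [s2|s2] := leP (2 * e) s; first by rewrite beta_large// ler01 lexx.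
rewrite /betad [pos (s - 2 * e)]pos_eq0; last lra.
rewrite pos_id; last lra.
rewrite subr0 mulr_ge0 ?invr_ge0 ?(ltW e0)//=; last lra.
rewrite ler_pdivrMl//; lra.
Qed.

Lemma beta_bounds (e s : R) : 0 < e -> 0 <= s -> 0 <= beta e s <= s.
Proof.
move=> e0 s0; have [s1|s1] := leP s e; first by have [-> _] := beta_small e0 s1; rewrite lexx s0.
have e20 : 0 < 2 * e by lra.
have [s2|s2] := leP (2 * e) s.
  have -> : beta e s = s - 3 / 2 * e.
    rewrite /beta !pos_id; [|lra|lra].
    by field; rewrite gt_eqF.
  by apply/andP; split; lra.
rewrite /beta [pos (s - 2 * e)]pos_eq0; last lra.
rewrite pos_id; last lra.
rewrite expr0n subr0 mulr_ge0 ?sqr_ge0 ?invr_ge0 ?(ltW e20)//=.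
rewrite ler_pdivrMl// expr2.
have : (s - e) * (s - e) <= e * s by apply: ler_pM; lra.
have : 0 <= e * s by rewrite mulr_ge0// ltW.
by lra.
Qed.

Lemma beta_cont (e : R) : cont_on setT (beta e).
Proof.
have cp (k : R) : cont_on setT (fun s => pos (s - k)).
  apply: (cont_on_comp (K := setT)) (@cont_on_pos R) => //.
  by apply: cont_onB; [exact: cont_on_id|exact: cont_on_cst].
apply: cont_onM; first exact: cont_on_cst.
by apply: cont_onB; exact: cont_onM.
Qed.

Lemma betad_cont (e : R) : cont_on setT (betad e).
Proof.
have cp (k : R) : cont_on setT (fun s => pos (s - k)).
  apply: (cont_on_comp (K := setT)) (@cont_on_pos R) => //.
  by apply: cont_onB; [exact: cont_on_id|exact: cont_on_cst].
by apply: cont_onM; [exact: cont_on_cst|exact: cont_onB].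
Qed.

End LineIntegral.

Section Trace.
Variable R : realType.
Local Notation plane := (R * R)%type.
Local Notation mu := (@lebesgue_measure R).
Local Notation mu2 := (@lebesgue_measure R \x @lebesgue_measure R)%E.
Variables (c : R -> R -> plane) (D : R -> set plane).
Variables (u1 u1t u11 u12 u2 u2t u21 u22 : R -> plane -> R).
Hypothesis F : C1_flow c D u1 u1t u11 u12 u2 u2t u21 u22.
Variable p : R -> plane -> R.
Hypothesis P : flow_pressure c D u1 u1t u11 u12 u2 u2t u21 u22 p.
Local Notation B t := (bdry (D t)).
Variable t : R.
Hypothesis t0 : 0 < t.
Local Notation q x := (- material u1 u2 u1t u11 u12 t x).
Let tn : 0 <= t := ltW t0.

(** Inside the open strip the fluid ends at the surface, where phi vanishes; near a wall point below
    the surface the closure fills the strip. So the extension is continuous however often a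
    horizontal line crosses the surface. *)
Lemma extend_zero (phi : plane -> R) : cont_on (closure (D t)) phi ->
  (forall a : R, 0 <= a <= 1 -> phi (c t a) = 0) ->
  cont_on [set x : plane | 0 <= x.1 <= 1 /\ 0 < x.2] (phi \_ (closure (D t))).
Proof.
move=> cphi phi0 z sz e e0.
have strip x : 0 <= x.1 <= 1 /\ 0 < x.2 -> strip_closed (R := R) x by move=> [h1 /ltW].
have good r : 0 < r -> closure (D t) z ->
    (forall x, `|z - x| < r -> 0 <= x.1 <= 1 /\ 0 < x.2 -> closure (D t) x) ->
    exists2 r : R, 0 < r & forall z', 0 <= z'.1 <= 1 /\ 0 < z'.2 -> `|z - z'| < r ->
      `|(phi \_ (closure (D t))) z - (phi \_ (closure (D t))) z'| < e.
  move=> r0 cz H; have [r1 r10 H1] := cphi z cz e e0.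
  exists (Num.min r r1); first by rewrite lt_min r0.
  move=> x sx; rewrite lt_min => /andP[zx zx1]; have cx := H x zx sx.
  by rewrite !patchE !mem_set//; exact: H1.
have [cz|nz] := pselect (closure (D t) z); last first.
  have oC : open (~` closure (D t)) by apply: closed_openC; exact: closed_closure.
  have [r r0 H] := (open_normP _).1 oC z nz; exists r => // x sx zx.
  by rewrite !patchE !memNset ?subrr ?normr0//; exact: H.
have [Dz|nDz] := pselect (D t z).
  have [r r0 H] := (open_normP _).1 (flow_open F tn) z Dz.
  by apply: (good r) => // x zx _; apply: subset_closure; exact: H.
have surf : (exists2 a : R, 0 <= a <= 1 & c t a = z) ->
    exists2 r : R, 0 < r & forall z', 0 <= z'.1 <= 1 /\ 0 < z'.2 -> `|z - z'| < r ->
      `|(phi \_ (closure (D t))) z - (phi \_ (closure (D t))) z'| < e.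
  move=> [a aI az]; have z0 : phi z = 0 by rewrite -az phi0.
  have [r r0 H] := cphi z cz e e0; exists r => // x sx zx.
  rewrite !patchE (mem_set cz) z0; case: ifPn => [/set_mem cx|_]; last by rewrite subrr normr0.
  by have := H x cx zx; rewrite z0.
have : B t z by split => // /interior_subset.
have [c0 c1 _] := flow_surface F tn.
rewrite (flow_bdry F tn) => -[wz|[a /=]]; last first.
  by rewrite in_itv /= => aI az; apply: surf; exists a.
have [z0|z0] := eqVneq z (0, 1); first by apply: surf; exists 0; rewrite ?lexx ?ler01// z0 c0.
have [z1|z1] := eqVneq z (1, 1); first by apply: surf; exists 1; rewrite ?lexx ?ler01// z1 c1.
have [r r0 H] := wall_box F t wz z0 z1.
have HD y : `|z - y| < r -> 0 < y.1 < 1 -> 0 < y.2 -> D t y by apply: H; rewrite tn/=.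
by apply: (good r) => // x zx sx; exact: (strip_closure HD (strip x sx) zx).
Qed.

Lemma surface_point (z : plane) : closure (D t) z -> ~ D t z -> ~ walls z -> p t z = 0.
Proof.
move=> cz nD nw; have : B t z by split => // /interior_subset.
rewrite (flow_bdry F tn) => -[//|[a /=]]; rewrite in_itv /= => aI <-.
exact: (pressure_surface P t0 aI).
Qed.

Section Slices.
Variable e : R.
Hypothesis e0 : 0 < e.
(** The derivative of [x.1 * beta e (p t x)] in x1, as q is that of p. *)
Let f (x : plane) : R := beta e (p t x) + x.1 * (betad e (p t x) * q x).

Lemma slice_cont (phi : plane -> R) (y : R) : cont_on (closure (D t)) phi ->
  (forall a : R, 0 <= a <= 1 -> phi (c t a) = 0) -> 0 < y ->
  cont_on [set s : R | 0 <= s <= 1] (fun s => (phi \_ (closure (D t))) (s, y)).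
Proof.
move=> cphi phi0 y0.
apply: (cont_on_comp (K := [set x : plane | 0 <= x.1 <= 1 /\ 0 < x.2])) (extend_zero cphi phi0) => //.
by apply: cont_on_pair; [exact: cont_on_id|exact: cont_on_cst].
Qed.

Lemma beta_p_cont : cont_on (closure (D t)) (fun x => beta e (p t x)).
Proof. exact: (cont_on_comp (K := setT) _ (pressure_cont P t0) (beta_cont e)). Qed.

Lemma betad_p_cont : cont_on (closure (D t)) (fun x => betad e (p t x)).
Proof. exact: (cont_on_comp (K := setT) _ (pressure_cont P t0) (betad_cont e)). Qed.

Lemma f_cont : cont_on (closure (D t)) f.
Proof.
apply: cont_onD; first exact: beta_p_cont.
apply: cont_onM; first exact: cont_on_fst.
by apply: cont_onM; [exact: betad_p_cont|have [] := grad_slice F t0].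
Qed.

Lemma beta_p0 (x : plane) : p t x = 0 -> beta e (p t x) = 0 /\ f x = 0.
Proof.
move=> px; have [b0 bd0] := @beta_small R e (p t x) e0 (ltac:(by rewrite px ltW)).
by rewrite /f b0 bd0 mul0r mulr0 addr0.
Qed.

(** The truncation [beta e] vanishes where p <= e, hence near the surface, so its extension by zero
    is differentiable along the whole open segment. The fundamental theorem then leaves the wall x1
    = 1 only, the factor x1 removing the other end. *)
Lemma slice_integral (y : R) : 0 < y ->
  (\int[mu]_(s in `[0%R, 1%R]) ((f \_ (closure (D t))) (s, y))%:E =
   ((fun x => beta e (p t x)) \_ (closure (D t)) (1%R, y))%:E)%E.
Proof.
move=> y0; set g := _ \_ _; set b := _ \_ _.
have pz a : 0 <= a <= 1 -> p t (c t a) = 0 by exact: (pressure_surface P t0).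
have cb : cont_on [set s : R | 0 <= s <= 1] (fun s => b (s, y)).
  by apply: slice_cont => //; [exact: beta_p_cont|move=> a /pz/beta_p0[]].
have cg : cont_on [set s : R | 0 <= s <= 1] (fun s => g (s, y)).
  by apply: slice_cont => //; [exact: f_cont|move=> a /pz/beta_p0[]].
have cp := slice_cont (pressure_cont P t0) pz y0.
have csb : cont_on [set s : R | 0 <= s <= 1] (fun s => s * b (s, y)).
  by apply: cont_onM => //; exact: cont_on_id.
have main : \int[mu]_(s in `[0, 1]) g (s, y) = 1 * b (1, y) - 0 * b (0, y).
  apply: (FTC_interior csb cg) => s sI.
  have [Ds|nDs] := pselect (D t (s, y)).
    have [r r0 H] := (open_normP _).1 (flow_open F tn) _ Ds.
    have [dp _] := pressure_grad P t0 Ds.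
    have k := derM (derI s) (chain_rule dp (beta_derive (p t (s, y)) e0)).
    apply: (@near_is_derive _ (fun s => s * beta e (p t (s, y))) _ s _ r) => //.
      move=> s' ss; rewrite /b patchE mem_set//; apply: subset_closure; apply: H.
      by rewrite norm_pair_lt /= ss subrr normr0.
    apply: is_derive_eq k _.
    by rewrite /g patchE mem_set ?mul1r//; exact: subset_closure.
  have nw : ~ walls (s, y).
    move=> [_ _ /= ]; case: (andP sI) => s0 s1 [E|E|E]; move: s0 s1 y0; rewrite E ?ltxx//.
  have ps0 : (p t \_ (closure (D t))) (s, y) = 0.
    by rewrite patchE; case: ifPn => // /set_mem cs; exact: surface_point.
  have sI' : 0 <= s <= 1 by case/andP: sI => s0 s1; rewrite !ltW.
  have [r r0 H] := cp s sI' e e0.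
  have g0 : g (s, y) = 0.
    rewrite /g patchE; case: ifPn => // /set_mem cs.
    by have [] := beta_p0 (surface_point cs nDs nw).
  rewrite g0; apply: (@near_is_derive _ (fun=> 0) _ s _ (Num.min r (Num.min s (1 - s)))).
  - by rewrite !lt_min r0 subr_gt0.
  - move=> s'; rewrite !lt_min => /andP[h1 /andP[h2 h3]].
    have sI2 : 0 <= s' <= 1.
      by move: h2 h3; rewrite !ltr_distl; clear -F P t0 tn e0 f; lra.
    have := H s' sI2 h1; rewrite ps0 sub0r normrN => ps'.
    rewrite /b patchE; case: ifPn => [cs|]; last by rewrite mulr0.
    move: ps'; rewrite patchE cs ltr_norml => /andP[_ /ltW h].
    by have [-> _] := beta_small e0 h; rewrite mulr0.
have fin : (\int[mu]_(s in `[0%R, 1%R]) (g (s, y))%:E)%E \is a fin_num.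
  by apply: integrable_fin_num => //; exact: seg_integrable.
by rewrite -(fineK fin) -[fine _]/(\int[mu]_(s in `[0, 1]) g (s, y)) main mul1r mul0r subr0.
Qed.

(** Fubini over horizontal slices. Both inequalities come from p >= 0: the term [beta e p] is
    nonnegative in the fluid, and it is at most p on the wall. *)
Lemma trace_beta : \int[mu2]_(x in D t) (x.1 * (betad e (p t x) * q x)) <=
  \int[mu]_(y in `[0, 1]) p t (1, y).
Proof.
have [Y Y1 DY] := flow_box1 F tn; have oD := flow_open F tn; have mD := open_plane_measurable oD.
have cc : compact (closure (D t)).
  have [Y2 _ HY2] := domain_height F t.
  apply: subclosed_compact (@closed_closure _ _) (@compact_rect R 0 1 0 Y2) _ => x cx.
  by have [] := HY2 t x (ltac:(by rewrite tn/=)) cx.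
have bcl (g : plane -> R) : cont_on (closure (D t)) g -> bounded_cont (D t) g.
  move=> cg; split; first by apply: cont_onS cg; exact: subset_closure.
  have [M _ HM] := cont_on_bounded cc cg; exists M => x Dx; apply: HM; exact: subset_closure.
have bf := bcl _ f_cont; have bb := bcl _ beta_p_cont.
have p0 x : closure (D t) x -> 0 <= p t x by exact: (pressure_ge0 F P t0).
have bg : bounded_cont (D t) (fun x => x.1 * (betad e (p t x) * q x)).
  apply: bcl; apply: cont_onM; first exact: cont_on_fst.
  by apply: cont_onM; [exact: betad_p_cont|have [] := grad_slice F t0].
apply: (@le_trans _ _ (\int[mu2]_(x in D t) f x)).
  apply: (le_pint oD DY bg bf) => x Dx; rewrite lerDr.
  by have /andP[] := beta_bounds e0 (p0 x (subset_closure Dx)).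
have wall1 (y : R) : 0 <= y <= 1 -> closure (D t) (1, y).
  by move=> yI; apply: (wall_pt_closure F tn); split => //=; [rewrite lexx ler01|constructor 2].
have cp1 : cont_on [set y : R | 0 <= y <= 1] (fun y => p t (1, y)).
  apply: (cont_on_comp (K := closure (D t))) (pressure_cont P t0) => //.
  by apply: cont_on_pair; [exact: cont_on_cst|exact: cont_on_id].
have cb1 : cont_on [set y : R | 0 <= y <= 1] (fun y => beta e (p t (1, y))).
  exact: (cont_on_comp (K := setT) _ cp1 (beta_cont e)).
apply: (@le_trans _ _ (\int[mu]_(y in `[0, 1]) beta e (p t (1, y)))); last first.
  by apply: le_lint => // y yI; have /andP[] := beta_bounds e0 (p0 _ (wall1 y yI)).
pose Phi (y : R) : R := if 0 < y then ((fun x => beta e (p t x)) \_ (closure (D t))) (1, y) else 0.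
have EPhi (y : R) : (\int[mu]_x ((f \_ (D t)) (x, y))%:E = (Phi y)%:E)%E.
  rewrite /Phi; case: ifPn => [y0|]; last first.
    rewrite -leNgt => y0; rewrite (eq_integral (fun=> 0%E)) ?integral0// => x _.
    by rewrite patchE; case: ifPn => // /set_mem/(flow_strip F tn)[_ /=]; rewrite ltNge y0.
  rewrite -slice_integral// (@integral_on R _ _ mu `]0%R, 1%R[%classic); last first.
    move=> x nI; rewrite patchE; case: ifPn => // /set_mem/(flow_strip F tn)[xI _].
    by case: nI; rewrite /= in_itv.
  pose g s := (f \_ (closure (D t))) (s, y).
  have cg : cont_on [set s : R | 0 <= s <= 1] g.
    apply: slice_cont => //; first exact: f_cont.
    by move=> a /(pressure_surface P t0)/beta_p0[].
  have mg : measurable_fun (`[0, 1]%classic : set R) (EFin \o g).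
    by have := seg_integrable cg; exact: measurable_int.
  transitivity (\int[mu]_(s in `]0%R, 1%R[) (g s)%:E)%E.
    apply: eq_integral => s /set_mem /=; rewrite in_itv /= => sI; congr EFin.
    rewrite /g !patchE; case: ifPn => [/set_mem Ds|nD].
      by rewrite mem_set//; exact: subset_closure.
    case: ifPn => // /set_mem cs; apply/esym.
    suff ps : p t (s, y) = 0 by have [] := beta_p0 ps.
    apply: surface_point => //; first by move=> Ds; case/negP: nD; exact: mem_set.
    by move=> [_ _ /= ]; case: (andP sI) => s0 s1 [E|E|E]; move: s0 s1 y0; rewrite E ?ltxx.
  rewrite integral_itv_bndo_bndc; last first.
    by apply: measurable_funS mg => // s /=; rewrite !in_itv /= => /andP[/ltW -> /ltW ->].
  rewrite integral_itv_obnd_cbnd//.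
  by apply: measurable_funS mg => // s /=; rewrite !in_itv /= => /andP[/ltW -> ->].
have -> : \int[mu2]_(x in D t) f x = \int[mu]_(y in `[0, 1]) beta e (p t (1, y)); last exact: lexx.
rewrite /Rintegral (integral_slices1 mD (bounded_cont_integrable oD DY bf) EPhi).
(* Above height 1 the line x1 = 1 meets the closure in surface points only, where the pressure is
   zero. *)
congr fine; rewrite (@integral_on R _ _ mu `]0%R, 1%R]%classic); last first.
  move=> y nI; rewrite /Phi; case: ifPn => // y0; rewrite patchE; case: ifPn => // /set_mem cy.
  suff py : p t (1, y) = 0 by have [] := beta_p0 py.
  apply: surface_point => //; first by move=> /(flow_strip F tn)[/= /andP[_]]; rewrite ltxx.
  by move=> [_ /= /andP[_ y1] _]; apply: nI; rewrite /= in_itv /= y0.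
have mb : measurable_fun (`[0, 1]%classic : set R) (EFin \o (fun y => beta e (p t (1, y)))).
  by have := seg_integrable cb1; exact: measurable_int.
rewrite -integral_itv_obnd_cbnd; last first.
  by apply: measurable_funS mb => // s /=; rewrite !in_itv /= => /andP[/ltW -> ->].
apply: eq_integral => y /set_mem /=; rewrite in_itv /= => /andP[y0 y1].
by rewrite /Phi y0 patchE mem_set//; apply: wall1; rewrite y1 ltW.
Qed.

End Slices.

(** The truncation level tends to zero: [betad] tends to 1 where p > 0, and dominated convergence
    applies. *)
Lemma trace_le : \int[mu2]_(x in D t) (x.1 * q x) <= \int[mu]_(y in `[0, 1]) p t (1, y).
Proof.
have [Y Y1 DY] := flow_box1 F tn; have oD := flow_open F tn; have mD := open_plane_measurable oD.
have [_ cq1 _] : [/\ True, cont_on (D t) (fun x => q x) & True].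
  split => //; have [cq _] := grad_slice F t0; apply: cont_onS cq; exact: subset_closure.
have [[_ c1t c11 c12] _] := flow_u1 F.
have [M HM] : exists M : R, forall x, D t x -> `|q x| <= M.
  have [_ [M HM]] := field_bounded_cont F (material_cont F c1t c11 c12) tn.
  by exists M => x Dx; rewrite normrN; exact: HM.
pose en (n : nat) : R := n.+1%:R^-1.
have en0 n : 0 < en n by rewrite invr_gt0 ltr0n.
pose fn n (x : plane) : R := x.1 * (betad (en n) (p t x) * q x).
pose f (x : plane) : R := x.1 * q x.
have x1 (x : plane) : D t x -> `|x.1| <= 1.
  by move=> /DY[/andP[h1 h2] _]; rewrite ger0_norm.
have cfn n : cont_on (D t) (fn n).
  apply: cont_onM; first exact: cont_on_fst.
  apply: cont_onM => //; apply: cont_onS (betad_p_cont (en n)); exact: subset_closure.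
have cf : cont_on (D t) f by apply: cont_onM => //; exact: cont_on_fst.
have bfn n : bounded_cont (D t) (fn n).
  split => //; exists M => x Dx; rewrite /fn normrM -[M]mul1r ler_pM//; first exact: x1.
  rewrite normrM -[M]mul1r ler_pM//; last exact: HM.
  by have /andP[k0 k1] := betad01 (p t x) (en0 n); rewrite ger0_norm.
have bf : bounded_cont (D t) f.
  by split => //; exists M => x Dx; rewrite /f normrM -[M]mul1r ler_pM//; [exact: x1|exact: HM].
have fi := bounded_cont_integrable oD DY bf.
have lim0 x : D t x -> (fun n => fn n x) @ \oo --> f x.
  move=> Dx; have px : 0 <= p t x by apply: (pressure_ge0 F P t0); exact: subset_closure.
  have [p0|pn0] := eqVneq (p t x) 0.
    (* An interior zero of the nonnegative p is a minimum, so the derivative vanishes and the limit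
       is right there as well. *)
    have q0 : q x = 0.
      have [dp _] := pressure_grad P t0 Dx.
      have [r r0 H] := (open_normP _).1 oD x Dx.
      have pm s : s \in `]x.1 - r, x.1 + r[ -> p t (x.1, x.2) <= p t (s, x.2).
        rewrite in_itv /= -surjective_pairing p0 => sI.
        apply: (pressure_ge0 F P t0); apply: subset_closure; apply: H.
        by rewrite norm_pair_lt /= subrr normr0 r0 andbT ltr_distl; move: sI; clear -F P t0 tn; lra.
      have xI : x.1 \in `]x.1 - r, x.1 + r[ by rewrite in_itv /=; move: r0; clear -F P t0 tn; lra.
      have dd s : s \in `]x.1 - r, x.1 + r[ -> derivable (fun s => p t (s, x.2)) s 1.
        rewrite in_itv /= => sI; have Ds : D t (s, x.2).
          apply: H; rewrite norm_pair_lt /= subrr normr0 r0 andbT ltr_distl.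
          by move: sI; clear -F P t0 tn; lra.
        by have [h _] := pressure_grad P t0 Ds; exact: ex_derive.
      have lt : x.1 - r < x.1 + r by move: r0; clear -F P t0 tn; lra.
      have := derive1_at_min (ltW lt) dd xI pm.
      by move=> h; have := @derive_val _ _ _ _ _ _ _ h; rewrite (derive_val (is_derive := dp)).
    rewrite (_ : (fun n => fn n x) = (fun=> f x)); first exact: cvg_cst.
    by apply/funext => n; rewrite /fn /f q0 !mulr0.
  have p0 : 0 < p t x by rewrite lt_neqAle eq_sym pn0.
  apply/cvgrPdist_lt => e e0; near=> n.
  rewrite /fn beta_large ?mul1r ?subrr ?normr0//.
  rewrite /en -ler_pdivlMr ?invr_gt0 ?ltr0n// invrK -ler_pdivrMl//.
  rewrite (@le_trans _ _ n%:R)// ?ler_nat//.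
  near: n; exact: nbhs_infty_ger.
have ig := bounded_cont_integrable oD DY (bounded_cont_cst (D t) M).
have lim : (fun n => (\int[mu2]_(x in D t) (fn n x)%:E)%E) @ \oo --> (\int[mu2]_(x in D t) (f x)%:E)%E.
  apply: (bounded_cvg (M := M)).
  - exact: mD.
  - by move=> n; exact: open_cont_measurable_fun.
  - exact: open_cont_measurable_fun.
  - exact: lim0.
  - exact: ig.
  - move=> n x Dx; rewrite /fn normrM -[M]mul1r ler_pM//; first exact: x1.
    rewrite normrM -[M]mul1r ler_pM//; last exact: HM.
    by have /andP[k0 k1] := betad01 (p t x) (en0 n); rewrite ger0_norm.
have fin (g : plane -> R) : bounded_cont (D t) g ->
    (\int[mu2]_(x in D t) (g x)%:E = (\int[mu2]_(x in D t) g x)%:E)%E.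
  by move=> bg; rewrite /Rintegral fineK//; apply: integrable_fin_num => //; exact: (bounded_cont_integrable oD DY bg).
rewrite -lee_fin -fin// -(cvg_lim _ lim)//; apply: lime_le; first by apply/cvg_ex; eexists; exact: lim.
by apply: nearW => n /=; rewrite fin// lee_fin; exact: trace_beta.
Unshelve. all: by end_near.
Qed.

End Trace.

(** * The momentum of the right wall *)

Section DerivativeBound.
Variable R : realType.

Lemma derEps (f : R -> R) (x l : R) :
  (forall e : R, 0 < e -> exists2 r : R, 0 < r & forall s : R, `|s - x| < r ->
    `|f s - f x - l * (s - x)| <= e * `|s - x|) -> is_derive x (1 : R) f l.
Proof.
move=> H.
have lim : (fun h : R => h^-1 *: (f (h *: 1 + x) - f x)) @ 0^' --> l.
  apply/cvgrPdist_le => e e0; have [r r0 Hr] := H e e0; near=> h.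
  have h0 : h != 0 by near: h; exact: nbhs_dnbhs_neq.
  have hr : `|h| < r by near: h; apply: dnbhs0_lt.
  have := Hr (h + x); rewrite addrK => /(_ hr).
  rewrite /GRing.scale /= mulr1.
  have -> : l - h^-1 * (f (h + x) - f x) = - (h^-1 * (f (h + x) - f x - l * h)) by field.
  by rewrite normrN normrM normfV ler_pdivrMl ?normr_gt0// [`|h| * e]mulrC.
apply: DeriveDef; first by apply: cvgP lim.
exact: cvg_lim lim.
Unshelve. all: by end_near.
Qed.

Lemma seg_le (f g : R -> R) : cont_on [set s : R | 0 <= s <= 1] f ->
  cont_on [set s : R | 0 <= s <= 1] g -> (forall s : R, 0 < s < 1 -> f s <= g s) ->
  forall s : R, 0 <= s <= 1 -> f s <= g s.
Proof.
move=> cf cg fg s sI; rewrite leNgt; apply/negP => lt.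
have d0 : 0 < (f s - g s) / 2 by rewrite divr_gt0// subr_gt0.
have [r1 r10 H1] := cf s sI _ d0; have [r2 r20 H2] := cg s sI _ d0.
pose k := Num.min (Num.min r1 r2) 1 / 2.
have m0 : 0 < Num.min (Num.min r1 r2) 1 by rewrite !lt_min r10 r20 ltr01.
have k0 : 0 < k by rewrite divr_gt0.
have : k < Num.min (Num.min r1 r2) 1 by rewrite /k; move: m0; lra.
rewrite !lt_min => /andP[/andP[k1 k2] k3].
pose s' := s + k * (2^-1 - s).
have a1 : 0 <= s * (1 - k) by rewrite mulr_ge0; move: sI k3; lra.
have a2 : 0 <= (1 - s) * (1 - k) by rewrite mulr_ge0; move: sI k3; lra.
have s'I : 0 < s' < 1 by rewrite /s'; move: a1 a2 k0; lra.
have ss : `|s - s'| <= k.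
  rewrite /s' opprD addNKr normrN normrM (gtr0_norm k0) ger_pMr// ler_norml; move: sI; lra.
have s'I2 : 0 <= s' <= 1 by case/andP: s'I => h1 h2; rewrite !ltW.
have := H1 s' s'I2 (le_lt_trans ss k1); have := H2 s' s'I2 (le_lt_trans ss k2).
have := fg s' s'I; rewrite !ltr_distl; lra.
Qed.

End DerivativeBound.

Section WallMoment.
Variable R : realType.
Local Notation plane := (R * R)%type.
Local Notation mu := (@lebesgue_measure R).
Local Notation seg := [set s : R | 0 <= s <= 1].
Variables (c : R -> R -> plane) (D : R -> set plane).
Variables (u1 u1t u11 u12 u2 u2t u21 u22 : R -> plane -> R).
Hypothesis F : C1_flow c D u1 u1t u11 u12 u2 u2t u21 u22.
Local Notation K := (spacetime D).

Definition wall_moment (t : R) : R := \int[mu]_(y in `[0, 1]) (y * u2 t (1, y)).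

Lemma right_wall (y : R) : 0 <= y <= 1 -> walls (1 : R, y).
Proof. by move=> yI; split => //=; [rewrite lexx ler01|constructor 2]. Qed.

Lemma wall_slice (f : plane -> R) (t : R) : 0 <= t -> cont_on (closure (D t)) f ->
  cont_on seg (fun y => f (1, y)).
Proof.
move=> t0 cf; apply: (cont_on_comp (K := closure (D t))) cf.
  by move=> y yI; apply: (wall_pt_closure F t0); exact: right_wall.
by apply: cont_on_pair; [exact: cont_on_cst|exact: cont_on_id].
Qed.

Lemma wall_field (f : R -> plane -> R) (t : R) : cont_on K (fun z => f z.1 z.2) -> 0 <= t ->
  cont_on seg (fun y => f t (1, y)).
Proof. by move=> cf t0; exact: (wall_slice t0 (field_slice cf t0)). Qed.

Lemma wall_moment_cont (T : R) : cont_on [set t : R | 0 <= t <= T] wall_moment.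
Proof.
have [[c2 _ _ _] _] := flow_u2 F.
move=> t tI e e0; have e20 : 0 < e / 2 by rewrite divr_gt0.
have [r r0 H] := field_unif F T c2 e20.
exists r => // s sI ts; have /andP[t0 _] := tI; have /andP[s0 _] := sI.
have ct (t' : R) : 0 <= t' -> cont_on seg (fun y => y * u2 t' (1, y)).
  by move=> t0'; apply: cont_onM; [exact: cont_on_id|exact: wall_field].
rewrite /wall_moment -(lintB (ct t t0) (ct s s0)).
apply: (@le_lt_trans _ _ (e / 2)); last by move: e0; clear -F; lra.
apply: norm_lint_le; first by apply: cont_onB; exact: ct.
move=> y yI; have cw t' : 0 <= t' -> closure (D t') (1, y).
  by move=> t'0; apply: (wall_pt_closure F t'0); exact: right_wall.
have := H t s (1, y) (1, y) tI s0 (cw t t0) (cw s s0) ts; rewrite subrr normr0 => /(_ r0) h.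
rewrite -mulrBr normrM -[e / 2]mul1r ler_pM//; last exact: ltW.
by case/andP: yI => y0 y1; rewrite ger0_norm.
Qed.

Lemma wall_time_derive (f ft f1 f2 : R -> plane -> R) (t y : R) : C1_field D f ft f1 f2 -> 0 < t ->
  0 <= y < 1 -> is_derive t (1 : R) (fun s => f s (1, y)) (ft t (1, y)).
Proof.
move=> Cf t0 /andP[y0 y1].
have wz : walls (1 : R, y) by apply: right_wall; rewrite y0 ltW.
have z0 : (1 : R, y) != (0, 1) by rewrite xpair_eqE negb_and (lt_eqF y1) orbT.
have z1 : (1 : R, y) != (1, 1) by rewrite xpair_eqE negb_and (lt_eqF y1) orbT.
apply: derEps => e e0; have [r r0 H] := wall_increment_t F Cf t0 wz z0 z1 e0.
exists r => // s st; apply: H => //; last by rewrite subrr normr0.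
by split => //=; rewrite lexx ler01.
Qed.

Lemma wall_tangent_derive (f f2 : plane -> R) (t y : R) : 0 < t -> cont_on (closure (D t)) f ->
  cont_on (closure (D t)) f2 ->
  (forall x, D t x -> is_derive x.2 (1 : R) (fun s => f (x.1, s)) (f2 x)) ->
  0 < y < 1 -> is_derive y (1 : R) (fun s => f (1, s)) (f2 (1, y)).
Proof.
move=> t0 cf cf2 df /andP[y0 y1]; have tn := ltW t0.
have wz : walls (1 : R, y) by apply: right_wall; rewrite !ltW.
have z0 : (1 : R, y) != (0, 1) by rewrite xpair_eqE negb_and (lt_eqF y1) orbT.
have z1 : (1 : R, y) != (1, 1) by rewrite xpair_eqE negb_and (lt_eqF y1) orbT.
apply: derEps => e e0; have [r r0 H] := wall_increment2 F tn wz z0 z1 cf cf2 df e0.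
exists (Num.min r y); first by rewrite lt_min r0.
move=> s; rewrite lt_min => /andP[sr sy].
have s0 : 0 < s by move: sy; rewrite ltr_distl; clear -F; lra.
have sz (s' : R) : 0 < s' -> strip_closed (1 : R, s') by move=> h; split => /=; rewrite ?lexx ?ler01// ltW.
apply: (H (1, y) (1, s)); rewrite ?subrr ?normr0//; [exact: sz|exact: sz|].
by rewrite norm_pair_lt /= subrr normr0 r0 distrC.
Qed.

Variable p : R -> plane -> R.
Hypothesis P : flow_pressure c D u1 u1t u11 u12 u2 u2t u21 u22 p.
Local Notation I f := (\int[mu]_(y in `[0, 1]) f y).

(* Bernoulli's law along the wall, integrated against y. *)
Lemma wall_acceleration (t : R) : 0 < t ->
  I (fun y => y * u2t t (1, y)) = I (fun y => p t (1, y)) + I (fun y => u2 t (1, y) ^+ 2 / 2).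
Proof.
move=> t0; have tn := ltW t0.
have [_ cq] := grad_slice F t0; have cp := pressure_cont P t0.
have [[c1 _ _ _] _] := flow_u1 F; have [[c2 c2t c21 c22] d2] := flow_u2 F.
pose q y := - material u1 u2 u2t u21 u22 t (1, y).
have kp := wall_slice tn cp; have kq : cont_on seg q := wall_slice tn cq.
have k2 := wall_field c2 tn; have k2t := wall_field c2t tn; have k22 := wall_field c22 tn.
pose b y := p t (1, y) + u2 t (1, y) ^+ 2 / 2.
pose g y := b y + y * (q y + u2 t (1, y) * u22 t (1, y)).
have ksq : cont_on seg (fun y => u2 t (1, y) ^+ 2 / 2).
  by apply: cont_onM; [exact: cont_onM|exact: cont_on_cst].
have kb : cont_on seg b by exact: cont_onD.
have kr : cont_on seg (fun y => y * (q y + u2 t (1, y) * u22 t (1, y))).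
  by apply: cont_onM; [exact: cont_on_id|apply: cont_onD => //; exact: cont_onM].
have kg : cont_on seg g by exact: cont_onD.
have kG : cont_on seg (fun y => y * b y) by apply: cont_onM => //; exact: cont_on_id.
have dG (y : R) : 0 < y < 1 -> is_derive y (1 : R) (fun y => y * b y) (g y).
  move=> yI.
  have dp := wall_tangent_derive t0 cp cq (fun x Dx => (pressure_grad P t0 Dx).2) yI.
  have dd x : D t x -> is_derive x.2 (1 : R) (fun s => u2 t (x.1, s)) (u22 t x).
    by move=> Dx; have [] := d2 t x t0 Dx.
  have du := wall_tangent_derive t0 (field_slice c2 tn) (field_slice c22 tn) dd yI.
  have k := derM (derI y) (derD dp (derZ 2^-1 (derM du du))).
  have E : (fun y => y * b y) = (fun y => y * (p t (1, y) + 2^-1 * (u2 t (1, y) * u2 t (1, y)))).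
    by apply/funext => s; rewrite /b expr2 [_ / 2]mulrC.
  by rewrite E; apply: is_derive_eq k _; rewrite /g /b /q; field.
have [_ c1e _] := flow_surface F tn.
have [_ e1] := flow_endpoints F tn.
(* Pressure and u2 both vanish at the corner, so [y * b y] has no boundary term at y = 1; the factor
   y removes the one at 0. *)
have p1 : p t (1, 1) = 0 by rewrite -c1e (pressure_surface P t0)// ler01 lexx.
have := FTC_interior kG kg dG.
rewrite mul0r mul1r subr0 /b p1 e1 expr0n /= mul0r addr0 /g (lintD kb kr) /b (lintD kp ksq) => Eq.
have E2 : I (fun y => y * u2t t (1, y)) = I (fun y => - 1 * (y * (q y + u2 t (1, y) * u22 t (1, y)))).
  apply: eq_lint => y yI; have [_ u10] := lateral_wall_rest F tn yI.
  by rewrite /q /material u10; ring.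
by rewrite E2 (lintZ _ kr); move: Eq; clear -F; lra.
Qed.

Lemma wall_moment_step (t e : R) : 0 < t -> 0 < e -> exists2 h0 : R, 0 < h0 & forall h : R, 0 < h < h0 ->
  wall_moment t + h * (I (fun y => p t (1, y)) + I (fun y => u2 t (1, y) ^+ 2 / 2)) - e * h
    <= wall_moment (t + h).
Proof.
move=> t0 e0; have tn := ltW t0; have [[c2 c2t _ _] _] := flow_u2 F.
have [r r0 H] := field_unif F t c2t e0; exists r => // h /andP[h0 hr].
have thn : 0 <= t + h by rewrite addr_ge0// ltW.
have k2 (s : R) : 0 <= s -> cont_on seg (fun y => u2 s (1, y)) by exact: wall_field.
have k2t := wall_field c2t tn.
have ky (s : R) : 0 <= s -> cont_on seg (fun y => y * u2 s (1, y)).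
  by move=> s0; apply: cont_onM; [exact: cont_on_id|exact: k2].
have kyt : cont_on seg (fun y => y * u2t t (1, y)).
  by apply: cont_onM => //; exact: cont_on_id.
have khyt : cont_on seg (fun y => h * (y * u2t t (1, y))).
  by apply: cont_onM => //; exact: cont_on_cst.
have ks : cont_on seg (fun y => y * u2 t (1, y) + h * (y * u2t t (1, y))).
  by apply: cont_onD => //; exact: ky.
rewrite -(wall_acceleration t0) -(lintZ h kyt) /wall_moment -(lintD (ky t tn) khyt) -(lint_cst (e * h)).
have ke : cont_on seg (fun=> e * h) by exact: cont_on_cst.
rewrite -(lintB ks ke); apply: le_lint; [exact: cont_onB|exact: ky|].
(* Time derivatives on the wall are available below the corner, for y < 1; the inequality reaches y
   = 1 by continuity. *)
apply: seg_le; [exact: cont_onB|exact: ky|].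
move=> y yI; have yI' : 0 <= y < 1 by case/andP: yI => y0 y1; rewrite ltW.
have yI2 : 0 <= y <= 1 by case/andP: yI => y0 y1; rewrite !ltW.
have nh : `|t + h - t| = h by rewrite [t + h - t]addrC addKr gtr0_norm.
have pos (s : R) : `|s - t| <= h -> `|s - (t + h)| <= h -> t <= s.
  by rewrite !ler_distl; clear -F; lra.
have [s s1 s2|s [s1 s2 Es]] := @mean_value R (fun s => u2 s (1, y)) (fun s => u2t s (1, y)) t (t + h).
  rewrite nh in s1 s2; apply: (wall_time_derive (flow_u2 F)) => //.
  exact: lt_le_trans (pos s s1 s2).
rewrite nh in s1 s2; rewrite [t + h - t]addrC addKr in Es.
have ts := pos s s1 s2; have sn := le_trans tn ts.
have cw t' : 0 <= t' -> closure (D t') (1, y).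
  by move=> t'0; apply: (wall_pt_closure F t'0); exact: right_wall.
have tI : 0 <= t <= t by rewrite tn/=.
have ts' : `|t - s| < r by rewrite distrC; exact: le_lt_trans hr.
have := H t s (1, y) (1, y) tI sn (cw t tn) (cw s sn) ts'; rewrite subrr normr0 => /(_ r0).
rewrite ltr_distl => /andP[_ ub].
have -> : u2 (t + h) (1, y) = u2 t (1, y) + u2t s (1, y) * h by rewrite -Es; ring.
have /andP[y0 y1] := yI2.
have n1 : y * h * u2t t (1, y) <= y * h * (u2t s (1, y) + e).
  by rewrite ler_wpM2l ?mulr_ge0// ltW.
have n2 : y * (h * e) <= 1 * (h * e) by rewrite ler_wpM2r// mulr_ge0// ltW.
by move: n1 n2; clear -F; lra.
Qed.

End WallMoment.

(** * The blow-up argument *)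

Section Blowup.
Variable R : realType.
Local Notation plane := (R * R)%type.
Local Notation mu := (@lebesgue_measure R).
Local Notation mu2 := (@lebesgue_measure R \x @lebesgue_measure R)%E.
Local Notation seg := [set s : R | 0 <= s <= 1].
Variables (c : R -> R -> plane) (D : R -> set plane).
Variables (u1 u1t u11 u12 u2 u2t u21 u22 : R -> plane -> R).
Hypothesis F : C1_flow c D u1 u1t u11 u12 u2 u2t u21 u22.
Variable p : R -> plane -> R.
Hypothesis P : flow_pressure c D u1 u1t u11 u12 u2 u2t u21 u22 p.
Local Notation K := (spacetime D).
Local Notation area t := (\int[mu2]_(x in D t) (1 : R)).
Local Notation I f := (\int[mu]_(y in `[0, 1]) f y).

Lemma constant_field (a : R) : C1_field D (fun _ _ => a) (fun _ _ => 0) (fun _ _ => 0) (fun _ _ => 0).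
Proof.
split; first by split; exact: cont_on_cst.
by move=> t x _ _; split; exact: derC.
Qed.

(** Transport of the constant 1, whose material derivative is zero. The width eps makes the cut-off
    errors, [2 * C' * eps] from the two ends and [C * eps * t] from the transport, add up to at most
    1. *)
Lemma area_growth (t : R) : 0 <= t -> area t <= area 0 + 1.
Proof.
move=> t0; have Cf := constant_field 1.
have [eps0 /andP[eps00 eps01] [C C0 HC]] := transport F t Cf.
pose f (_ : R) (_ : plane) : R := 1.
have cf : cont_on K (fun z => f z.1 z.2) by exact: cont_on_cst.
have [C' C'0 HC'] := Fe_approx F t (f := f) cf.
have den : 0 < 2 * C' + C * t + 1.
  by have := mulr_ge0 (ltW C0) t0; move: C'0; clear -F P; lra.
pose eps := Num.min eps0 ((2 * C' + C * t + 1)^-1).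
have epsp : 0 < eps by rewrite lt_min eps00 invr_gt0.
have epsle : eps <= eps0 by rewrite ge_min lexx.
have epsC : eps * (2 * C' + C * t + 1) <= 1.
  by rewrite -ler_pdivlMr// div1r ge_min lexx orbT.
have epsI : 0 < eps <= eps0 by rewrite epsp.
have epsI1 : 0 < eps <= 1 by rewrite epsp (le_trans epsle).
have mono : C * eps * 0 - Fe D eps f 0 <= C * eps * t - Fe D eps f t.
  apply: (@dini_nondecreasing R (fun s => C * eps * s - Fe D eps f s) 0 t t0).
    have cF := Fe_cont F (T := t) (f := f) cf epsp.
    apply: cont_onB cF.
    by apply: cont_onM; [exact: cont_on_cst|exact: cont_on_id].
  move=> s /andP[s0 st] e e0; have sI : 0 < s <= t by rewrite s0 ltW.
  have [h0 h00 H] := HC eps s e epsI sI e0; exists h0 => // h hI; have := H h hI.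
  have -> : \int[mu2]_(x in D s) material u1 u2 (fun _ _ => 0) (fun _ _ => 0) (fun _ _ => 0) s x = 0.
    rewrite (eq_pint (g := fun=> 0)); first by rewrite /Rintegral integral0.
    by move=> x _; rewrite /material !mulr0 !addr0.
  by rewrite mulr0 subr0 ler_norml => /andP[_]; clear -F P; lra.
have t0I : 0 <= (0 : R) <= t by rewrite lexx.
have tI : 0 <= t <= t by rewrite t0 lexx.
have := HC' eps 0 epsI1 t0I; have := HC' eps t epsI1 tI.
rewrite !ler_norml => /andP[a1 a2] /andP[b1 b2]; rewrite -/f in a1 a2 b1 b2.
by move: a1 a2 b1 b2 mono epsC; clear -F P epsp; lra.
Qed.

Definition momentum (t : R) (x : plane) : R := u1 t x * x.1.

Lemma space_coord : cont_on K (fun z => z.2.1).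
Proof. by move=> z _ e e0; exists e => // z' _ h; apply: le_lt_trans h; exact: (le_trans (norm_fst (z.2 - z'.2)) (norm_snd (z - z'))). Qed.

Lemma momentum_field : C1_field D momentum (fun t x => u1t t x * x.1)
  (fun t x => u11 t x * x.1 + u1 t x) (fun t x => u12 t x * x.1).
Proof.
have [[c0 ct c1 c2] d] := flow_u1 F; have cx := space_coord.
split; first by split; [exact: cont_onM|exact: cont_onM|apply: cont_onD => //; exact: cont_onM|exact: cont_onM].
move=> t x t0 Dx; have [dt d1 d2] := d t x t0 Dx; split.
- by apply: is_derive_eq (derM dt (derC t x.1)) _; rewrite mulr0 addr0.
- by apply: is_derive_eq (derM d1 (derI x.1)) _; rewrite -surjective_pairing mulr1.
- by apply: is_derive_eq (derM d2 (derC x.2 x.1)) _; rewrite mulr0 addr0.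
Qed.

Definition impulse (t : R) : R := (\int[mu2]_(x in D t) momentum t x) + wall_moment u2 t.

Definition energy (t : R) : R :=
  (\int[mu2]_(x in D t) u1 t x ^+ 2) + I (fun y => u2 t (1, y) ^+ 2 / 2).

Lemma bounded_squares (t : R) : 0 <= t ->
  bounded_cont (D t) (u1 t) /\ bounded_cont (D t) (momentum t).
Proof.
move=> t0; have [[c1 _ _ _] _] := flow_u1 F; have [[cm _ _ _] _] := momentum_field.
by split; [exact: (field_bounded_cont F c1 t0)|exact: (field_bounded_cont F (f := momentum) cm t0)].
Qed.

(* The square completion |s u1 - x1|^2 >= 0 replaces Cauchy-Schwarz and keeps the
   resulting differential inequality linear. *)
Lemma energy_ge (t s m : R) : 0 <= t -> area t <= m -> 2 * s * impulse t - (m + 2) <= s ^+ 2 * energy t.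
Proof.
move=> t0 am; have [Y Y1 DY] := flow_box1 F t0; have oD := flow_open F t0.
have [b1 bm] := bounded_squares t0; have b11 := bounded_contM b1 b1.
have bc (a : R) := bounded_cont_cst (D t) a.
have bs := bounded_contM (bc (2 * s)) bm.
have bl := bounded_contB bs (bc 1).
have br := bounded_contM (bc (s ^+ 2)) b11.
have H1 : 2 * s * \int[mu2]_(x in D t) momentum t x - area t <= s ^+ 2 * \int[mu2]_(x in D t) u1 t x ^+ 2.
  rewrite -(pintZ oD DY _ bm) -(pintB oD DY bs (bc 1)).
  have -> : \int[mu2]_(x in D t) u1 t x ^+ 2 = \int[mu2]_(x in D t) (u1 t x * u1 t x).
    by apply: eq_pint => x _; rewrite expr2.
  rewrite -(pintZ oD DY _ b11); apply: (le_pint oD DY bl br) => x /DY[/andP[x0 x1] _].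
  have : x.1 * x.1 <= 1 * 1 by apply: ler_pM.
  have := sqr_ge0 (s * u1 t x - x.1).
  have -> : (s * u1 t x - x.1) ^+ 2 = s ^+ 2 * (u1 t x * u1 t x) - 2 * s * momentum t x + x.1 * x.1.
    by rewrite /momentum; ring.
  by clear -F P; lra.
have [[c2 _ _ _] _] := flow_u2 F; have k2 := wall_field F c2 t0.
have ky : cont_on seg (fun y => y * u2 t (1, y)) by apply: cont_onM => //; exact: cont_on_id.
have ksq : cont_on seg (fun y => u2 t (1, y) ^+ 2 / 2).
  by apply: cont_onM; [exact: cont_onM|exact: cont_on_cst].
have kc (a : R) : cont_on seg (fun=> a) by exact: cont_on_cst.
have H2 : 2 * s * wall_moment u2 t - 2 <= s ^+ 2 * I (fun y => u2 t (1, y) ^+ 2 / 2).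
  have kl := cont_onM (kc (2 * s)) ky.
  rewrite /wall_moment -(lintZ _ ky) -{2}(lint_cst 2) -(lintB kl (kc 2)) -(lintZ _ ksq).
  apply: le_lint; [exact: cont_onB|exact: cont_onM|move=> y /andP[y0 y1]].
  have : y * y <= 1 * 1 by apply: ler_pM.
  (* The weight 2 matches the factor 1/2 in the energy; what is left over, 2 y^2 <= 2, is the
     constant added to m. *)
  have := sqr_ge0 (s * u2 t (1, y) - 2 * y).
  have -> : (s * u2 t (1, y) - 2 * y) ^+ 2 =
    2 * (s ^+ 2 * (u2 t (1, y) ^+ 2 / 2) - 2 * s * (y * u2 t (1, y)) + 2 * (y * y)) by field.
  by clear -F P; lra.
by rewrite /impulse /energy !mulrDr; move: H1 H2 am; clear -F P; lra.
Qed.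

(** The material derivative of x1 u1 is u1^2 plus x1 times the acceleration. The latter is minus the
    pressure gradient, and [trace_le] compensates it by the pressure on the wall. *)
Lemma impulse_production (t : R) : 0 < t -> energy t <=
  \int[mu2]_(x in D t) material u1 u2 (fun t x => u1t t x * x.1) (fun t x => u11 t x * x.1 + u1 t x)
     (fun t x => u12 t x * x.1) t x +
  (I (fun y => p t (1, y)) + I (fun y => u2 t (1, y) ^+ 2 / 2)).
Proof.
move=> t0; have tn := ltW t0; have [Y Y1 DY] := flow_box1 F tn; have oD := flow_open F tn.
have [[c1 c1t c11 c12] _] := flow_u1 F; have [b1 _] := bounded_squares tn.
have b11 := bounded_contM b1 b1.
have bmat := field_bounded_cont F (material_cont F c1t c11 c12) tn.
have bx : bounded_cont (D t) (fun x => x.1 : R).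
  split; first exact: cont_on_fst.
  by exists 1 => x /DY[/andP[h1 h2] _]; rewrite ger0_norm.
have bxq := bounded_contM bx (bounded_contN bmat).
have -> : \int[mu2]_(x in D t) material u1 u2 (fun t x => u1t t x * x.1) (fun t x => u11 t x * x.1 + u1 t x)
     (fun t x => u12 t x * x.1) t x =
  \int[mu2]_(x in D t) u1 t x ^+ 2 - \int[mu2]_(x in D t) (x.1 * - material u1 u2 u1t u11 u12 t x).
  have -> : \int[mu2]_(x in D t) u1 t x ^+ 2 = \int[mu2]_(x in D t) (u1 t x * u1 t x).
    by apply: eq_pint => x _; rewrite expr2.
  rewrite -(pintB oD DY b11 bxq); apply: eq_pint => x _; rewrite /material; ring.
have := trace_le F P t0.
by rewrite /energy; clear -F P; lra.
Qed.

Lemma flow_blowup : 0 < impulse 0 -> False.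
Proof.
move=> A0; pose m := area 0 + 1.
have /andP[ar0 _] : 0 <= area 0 <= (projT1 (cid2 (flow_box1 F (lexx 0)))).
  case: cid2 => Y /= Y1 DY; apply: pint_area DY; first exact: (flow_open F).
  by apply: le_trans Y1.
have m0 : 0 < m by rewrite /m; move: ar0; clear -F P; lra.
(* Twice the time at which the limiting inequality fails; the spare factor absorbs the difference
   between [A 0] and [impulse 0]. *)
pose T := 2 * (m + 3) / impulse 0.
have T0 : 0 < T by rewrite divr_gt0// mulr_gt0// addr_gt0.
have TA : T * impulse 0 = 2 * (m + 3) by rewrite /T divfK// gt_eqF.
have Cf := momentum_field; have [[cf _ _ _] _] := Cf.
have [eps0 /andP[eps00 eps01] [C C0 HC]] := transport F T Cf.
have [C' C'0 HC'] := Fe_approx F T (f := momentum) cf.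
have TT0 : 0 < T * T by rewrite mulr_gt0.
have TC : 0 < T * C by rewrite mulr_gt0.
have TC' : 0 < T * C' by rewrite mulr_gt0.
have TTC : 0 < T * T * C by rewrite mulr_gt0.
(* Replacing the impulse by A costs [2 * (T * C') * eps] and transport costs [T * T * C * eps].
   Together they stay below 1, the unit between m + 2 and m + 3. *)
pose den := 2 * (T * C') + T * T * C + 1.
have den0 : 0 < den by rewrite /den; move: TC' TTC; clear -F P; lra.
pose eps := Num.min eps0 den^-1.
have epsp : 0 < eps by rewrite lt_min eps00 invr_gt0.
have epsle : eps <= eps0 by rewrite ge_min lexx.
have epsC : eps * den <= 1 by rewrite -ler_pdivlMr// div1r ge_min lexx orbT.
have epsI : 0 < eps <= eps0 by rewrite epsp.
have epsI1 : 0 < eps <= 1 by rewrite epsp (le_trans epsle).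
pose A t := Fe D eps momentum t + wall_moment u2 t.
have AA (t : R) : 0 <= t <= T -> `|A t - impulse t| <= C' * eps.
  move=> tI; rewrite /A /impulse opprD addrACA subrr addr0; exact: HC'.
(* The weight vanishes at t = T, where no information on A is needed. *)
pose phi t := (T - t) ^+ 2 * A t + (m + 3) * t.
have mono : phi 0 <= phi T.
  apply: dini_nondecreasing; first exact: ltW.
    have cA : cont_on [set t | 0 <= t <= T] A.
      by apply: cont_onD; [exact: (Fe_cont F (T := T) (f := momentum) cf epsp)|exact: (wall_moment_cont F (T := T))].
    have cT : cont_on [set t | 0 <= t <= T] (fun t => T - t : R).
      by apply: cont_onB; [exact: cont_on_cst|exact: cont_on_id].
    apply: cont_onD; first by apply: cont_onM => //; exact: cont_onM.
    by apply: cont_onM; [exact: cont_on_cst|exact: cont_on_id].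
  move=> t /andP[t0 tT] e e0; have tn := ltW t0.
  have tI : 0 < t <= T by rewrite t0 ltW.
  have tI' : 0 <= t <= T by rewrite tn ltW.
  pose e1 := e / (4 * (T * T)); have e10 : 0 < e1 by rewrite divr_gt0// mulr_gt0.
  have e1E : 4 * (T * T) * e1 = e by rewrite /e1 mulrC divfK// gt_eqF// mulr_gt0.
  have [h1 h10 H1] := HC eps t e1 epsI tI e10.
  have [h2 h20 H2] := wall_moment_step F P t0 e10.
  pose s := T - t; have s0 : 0 < s by rewrite subr_gt0.
  have sT : s <= T by rewrite gerBl.
  (* A lower bound for the forward difference quotients of A, with the cut-off error and the slack
     of both steps. *)
  pose X := energy t - C * eps - 2 * e1.
  pose N := 1 + `|A t| + 2 * s * `|X| + `|X|.
  have sX : 0 <= s * `|X| by rewrite mulr_ge0// ltW.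
  have N0 : 0 < N.
    by rewrite /N; have := normr_ge0 (A t); have := normr_ge0 X; move: sX; clear -F P; lra.
  exists (Num.min (Num.min h1 h2) (Num.min 1 (e / (2 * N)))).
    by rewrite !lt_min h10 h20 ltr01 divr_gt0// mulr_gt0.
  move=> h /andP[hp]; rewrite !lt_min => /andP[/andP[hh1 hh2] /andP[hl1 hN]].
  rewrite ltr_pdivlMr ?mulr_gt0// in hN.
  have hn := ltW hp.
  have := H1 h (ltac:(by rewrite hp hh1)); have := H2 h (ltac:(by rewrite hp hh2)).
  set q1 := \int[mu2]_(x in D t) _; set q2 := I (fun y => p t (1, y)) + _ => E2.
  rewrite ler_norml => /andP[E1 _].
  have q12 : energy t <= q1 + q2 by exact: (impulse_production t0).
  have step : A t + h * X <= A (t + h).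
    have : h * energy t <= h * (q1 + q2) by rewrite ler_pM2l.
    by rewrite /A /X; move: E1 E2; clear -F P; lra.
  have am : area t <= m by exact: (area_growth tn).
  have E3 := energy_ge s tn am.
  have := AA t tI'; rewrite ler_norml => /andP[_ E4].
  have E5 : (s - h) ^+ 2 * (A t + h * X) <= (s - h) ^+ 2 * A (t + h).
    by rewrite ler_wpM2l// sqr_ge0.
  (* The coefficient of h is the discrete derivative of s^2 A; the rest is of order h^2 with a
     factor bounded by N, hence small against e h. *)
  have Esq : (s - h) ^+ 2 * (A t + h * X) =
    s ^+ 2 * A t + h * (s ^+ 2 * X - 2 * s * A t) + h * (h * (A t - 2 * s * X + h * X)) by ring.
  have rem : - (e / 2) <= h * (A t - 2 * s * X + h * X).
    have : `|h * (A t - 2 * s * X + h * X)| <= e / 2.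
      rewrite normrM (gtr0_norm hp).
      have n1 : `|A t - 2 * s * X + h * X| <= N.
        have k1 := ler_normD (A t - 2 * s * X) (h * X).
        have k2 := ler_normB (A t) (2 * s * X).
        have k3 : `|h * X| <= 1 * `|X| by rewrite normrM (gtr0_norm hp) ler_wpM2r// ltW.
        have k4 : `|2 * s * X| = 2 * s * `|X| by rewrite normrM gtr0_norm// mulr_gt0.
        by rewrite /N; move: k1 k2 k3 k4; clear -F P; lra.
      have : h * `|A t - 2 * s * X + h * X| <= h * N by rewrite ler_pM2l.
      by move: hN; clear -F P; lra.
    by rewrite ler_norml => /andP[].
  have ss : s ^+ 2 <= T * T by rewrite expr2 ler_pM// ltW.
  have s2E : s ^+ 2 * X = s ^+ 2 * energy t - s ^+ 2 * (C * eps + 2 * e1) by rewrite /X; ring.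
  have bound1 : s ^+ 2 * (C * eps + 2 * e1) <= T * T * (C * eps + 2 * e1).
    have h1' := mulr_gt0 C0 epsp.
    by rewrite ler_wpM2r//; move: h1' e10; clear -F P; lra.
  have bound2 : 2 * s * (A t - impulse t) <= 2 * (T * (C' * eps)).
    have : s * (A t - impulse t) <= T * (C' * eps).
      apply: (@le_trans _ _ (s * (C' * eps))); first by rewrite ler_pM2l.
      by rewrite ler_wpM2r// ltW// mulr_gt0.
    by clear -F P; lra.
  have key : - (m + 3) - e / 2 <= s ^+ 2 * X - 2 * s * A t.
    have edE : eps * den = 2 * (T * (C' * eps)) + T * T * (C * eps) + eps by rewrite /den; ring.
    have b1E : T * T * (C * eps + 2 * e1) = T * T * (C * eps) + e / 2 by rewrite -e1E; field.
    have b2E : 2 * s * (A t - impulse t) = 2 * s * A t - 2 * s * impulse t by ring.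
    rewrite s2E; rewrite edE in epsC; rewrite b1E in bound1; rewrite b2E in bound2.
    by move: E3 bound1 bound2 epsC epsp; clear -F P; lra.
  have fin : - e - (m + 3) <= s ^+ 2 * X - 2 * s * A t + h * (A t - 2 * s * X + h * X).
    by move: key rem; clear -F P; lra.
  have fin2 : h * (- e - (m + 3)) <= h * (s ^+ 2 * X - 2 * s * A t + h * (A t - 2 * s * X + h * X)).
    by rewrite ler_pM2l.
  rewrite /phi -/s (_ : T - (t + h) = s - h); last by rewrite /s opprD addrA.
  by move: fin2 E5; rewrite Esq; clear -F P; lra.
have := AA 0; rewrite lexx (ltW T0) => /(_ isT); rewrite ler_norml => /andP[E0 _].
move: mono; rewrite /phi subrr expr0n mul0r add0r subr0 mulr0 addr0 => mono.
have t1 : T ^+ 2 * (impulse 0 - C' * eps) <= T ^+ 2 * A 0.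
  by rewrite ler_pM2l ?exprn_gt0//; move: E0; clear -F P; lra.
have t2 : T ^+ 2 * (impulse 0 - C' * eps) = T * (2 * (m + 3) - T * C' * eps) by rewrite -TA; ring.
have : T * (2 * (m + 3) - T * C' * eps) <= T * (m + 3).
  by rewrite -t2 [T * (m + 3)]mulrC; exact: (le_trans t1 mono).
rewrite ler_pM2l//.
have : 0 < T * T * C * eps by rewrite mulr_gt0.
have edE : eps * den = 2 * (T * C' * eps) + T * T * C * eps + eps by rewrite /den; ring.
rewrite edE in epsC; have := mulr_gt0 TC' epsp.
by move: epsC m0 epsp; clear -F P; lra.
Qed.

End Blowup.

(** * From the solution record to the flow *)

Section FromSolution.
Variable R : realType.
Local Notation plane := (R * R)%type.

(** Both difference quotients are the same function of h. This trades directional derivatives in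
    space-time for ordinary derivatives in one variable. *)
Lemma derive_line (V W : normedModType R) (f : V -> R) (g : W -> R) (x v : V) (y w : W) (l : R) :
  (forall h : R, f (h *: v + x) = g (h *: w + y)) -> is_derive x v f l -> is_derive y w g l.
Proof.
move=> fg [df <-].
have fx : f x = g y by have := fg 0; rewrite !scale0r !add0r.
have E : (fun h : R => h^-1 *: ((g \o shift y) (h *: w) - g y)) =
    (fun h : R => h^-1 *: ((f \o shift x) (h *: v) - f x)).
  by apply/funext => h /=; rewrite fg fx.
by apply: DeriveDef; rewrite /derivable /derive /= E.
Qed.

Lemma line1 (h : R) (x : plane) : h *: ((1, 0) : plane) + x = (h *: (1 : R) + x.1, x.2).
Proof. by apply: injective_projections => //=; rewrite scaler0 add0r. Qed.

Lemma line2 (h : R) (x : plane) : h *: ((0, 1) : plane) + x = (x.1, h *: (1 : R) + x.2).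
Proof. by apply: injective_projections => //=; rewrite scaler0 add0r. Qed.

Lemma closure_eq (V : normedModType R) (A : set V) (f g : V -> R) :
  cont_on (closure A) f -> cont_on (closure A) g -> (forall x, A x -> f x = g x) ->
  forall x, closure A x -> f x = g x.
Proof.
move=> cf cg fg x cx; apply/eqP; rewrite -subr_eq0 -normr_le0; apply/ler_addgt0Pl => e e0.
rewrite addr0; have e20 : 0 < e / 2 by rewrite divr_gt0.
have [r1 r10 H1] := cf x cx _ e20; have [r2 r20 H2] := cg x cx _ e20.
have r0 : 0 < Num.min r1 r2 by rewrite lt_min r10.
have [y Ay] := (closure_normP _ _).1 cx _ r0; rewrite lt_min => /andP[xy1 xy2].
have := H1 y (subset_closure Ay) xy1; have := H2 y (subset_closure Ay) xy2; rewrite (fg y Ay).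
have -> : f x - g x = (f x - g y) - (g x - g y) by ring.
by have := ler_normB (f x - g y) (g x - g y); lra.
Qed.

Variables (c : R -> R -> plane) (D : R -> set plane) (u1 u2 p : R -> plane -> R).
Hypothesis S : C1_solution +oo c D u1 u2 p.
Local Notation K := (spacetime D).

Lemma solution_field (f : R -> plane -> R) :
  C1_up_to [set z : R * plane | 0 < z.1 /\ (z.1%:E < +oo)%E /\ D z.1 z.2]
    [set z : R * plane | 0 <= z.1 /\ (z.1%:E < +oo)%E /\ closure (D z.1) z.2] (fun z => f z.1 z.2) ->
  exists ft f1 f2, C1_field D f ft f1 f2 /\
    forall (t : R) (x : plane), 0 < t -> D t x ->
      [/\ derive1 (fun s => f s x) t = ft t x, d1 (f t) x = f1 t x & d2 (f t) x = f2 t x].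
Proof.
set I0 := [set z | _]; set K0 := [set z | _] => -[/within_cont_on cf df].
have KK : K `<=` K0 by move=> z [z0 cz]; split => //; rewrite ltry.
have II (t : R) (x : plane) : 0 < t -> D t x -> I0 (t, x) by move=> t0 Dx; split => //=; rewrite ltry.
have [gt [/within_cont_on cgt dgt]] := df (1, (0, 0)).
have [g1 [/within_cont_on cg1 dg1]] := df (0, (1, 0)).
have [g2 [/within_cont_on cg2 dg2]] := df (0, (0, 1)).
have et (t : R) (x : plane) : 0 < t -> D t x -> is_derive t (1 : R) (fun s => f s x) (gt (t, x)).
  move=> t0 Dx; apply: derive_line (dgt _ (II t x t0 Dx)) => h /=.
  have E : h *: ((0, 0) : plane) = 0 by exact: scaler0.
  by rewrite E add0r.
have e1 (t : R) (x : plane) : 0 < t -> D t x -> is_derive x ((1, 0) : plane) (f t) (g1 (t, x)).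
  move=> t0 Dx; apply: derive_line (dg1 _ (II t x t0 Dx)) => h /=.
  by rewrite scaler0 add0r.
have e2 (t : R) (x : plane) : 0 < t -> D t x -> is_derive x ((0, 1) : plane) (f t) (g2 (t, x)).
  move=> t0 Dx; apply: derive_line (dg2 _ (II t x t0 Dx)) => h /=.
  by rewrite scaler0 add0r.
exists (fun t x => gt (t, x)), (fun t x => g1 (t, x)), (fun t x => g2 (t, x)); split; last first.
  move=> t x t0 Dx; have [_ h0] := et t x t0 Dx.
  have [_ h1] := e1 t x t0 Dx; have [_ h2] := e2 t x t0 Dx.
  by split; [rewrite derive1E; exact: h0|exact: h1|exact: h2].
have ceta (g : R * plane -> R) : cont_on K0 g -> cont_on K (fun z => g (z.1, z.2)).
  by move=> cg; apply: cont_on_eq (cont_onS KK cg) => -[].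
split; first by split; [exact: cont_onS cf|exact: ceta|exact: ceta|exact: ceta].
move=> t x t0 Dx; split; first exact: et.
  by apply: derive_line (e1 t x t0 Dx) => h; rewrite line1.
by apply: derive_line (e2 t x t0 Dx) => h; rewrite line2.
Qed.

Lemma curve_component (f : R * R -> R) :
  C1_up_to [set z : R * R | 0 < z.1 /\ (z.1%:E < +oo)%E /\ 0 < z.2 < 1]
    [set z : R * R | 0 <= z.1 /\ (z.1%:E < +oo)%E /\ 0 <= z.2 <= 1] f ->
  cont_on [set z : R * R | 0 <= z.1 /\ 0 <= z.2 <= 1] f /\
  forall T : R, exists2 L : R, 0 <= L &
    forall t a b : R, 0 <= t <= T -> 0 <= a <= 1 -> 0 <= b <= 1 ->
      `|f (t, a) - f (t, b)| <= L * `|a - b|.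
Proof.
set I0 := [set z | _]; set K0 := [set z | _] => -[/within_cont_on cf0 df].
set K1 := [set z | _].
have KK : K1 `<=` K0 by move=> z [z0 cz]; split => //; rewrite ltry.
have cf : cont_on K1 f by exact: cont_onS cf0.
split => // T; have [g [/within_cont_on cg0 dg]] := df (0, 1).
have cg : cont_on K1 g by exact: cont_onS cg0.
have sub : [set z : R * R | 0 <= z.1 <= T + 1 /\ 0 <= z.2 <= 1] `<=` K1.
  by move=> z [/andP[z0 _] ?].
have [M M0 HM] := cont_on_bounded (@compact_rect R 0 (T + 1) 0 1) (cont_onS sub cg).
exists M; first exact: ltW.
move=> t b a /andP[t0 tT] bI aI.
(* The parameter derivative is given for t > 0 and 0 < s < 1. The segment is contracted towards 1/2
   and shifted to time t + k, and then k tends to 0. *)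
pose sh (a k : R) : R := a + k * (2^-1 - a).
have shI (a' k : R) : 0 <= a' <= 1 -> 0 < k < 1 -> 0 < sh a' k < 1.
  move=> /andP[a0 a1] /andP[k0 k1]; rewrite /sh.
  have h1 : 0 <= (1 - k) * a' by rewrite mulr_ge0// subr_ge0 ltW.
  have h2 : 0 <= (1 - k) * (1 - a') by rewrite mulr_ge0// subr_ge0// ltW.
  by move: h1 h2 k0; clear -S; lra.
have lim (a' : R) : 0 <= a' <= 1 -> tends0 (fun k => f (t + k * 1, sh a' k)) (f (t, a')).
  move=> a'I e e0; have Kz : K1 (t, a') by split.
  have [r r0 H] := cf _ Kz e e0.
  have [r1 r10 H1] := tends0_affine t 1 r0; have [r2 r20 H2] := tends0_affine a' (2^-1 - a') r0.
  exists (Num.min (Num.min r1 r2) 1); first by rewrite !lt_min r10 r20 ltr01.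
  move=> k /andP[k0]; rewrite !lt_min => /andP[/andP[k1 k2] k3].
  rewrite distrC; apply: H.
    split => /=; first by rewrite mulr1 addr_ge0// ltW.
    by have /andP[h1 h2] := shI a' k a'I (ltac:(by rewrite k0)); rewrite !ltW.
  by rewrite norm_pair_lt /= distrC H1 ?k0//= distrC H2 ?k0.
have := @increment_limit R (fun k s => f (t + k * 1, s)) (fun k s => g (t + k * 1, s)) (sh a) (sh b) a b
  (f (t, a)) (f (t, b)) 0 M 1 ltr01 (ltW M0).
rewrite mul0r subr0; apply; [|exact: tends0_affine|exact: tends0_affine|exact: lim|exact: lim].
move=> k s kI sa sb; have /andP[k0 k1] := kI.
have /andP[p1 p2] := shI a k aI kI; have /andP[q1 q2] := shI b k bI kI.
have sI : 0 < s < 1.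
  move: p1 p2 q1 q2 sa sb; rewrite !ler_distl; clear -S.
  by case: (leP (sh a k) (sh b k)) => h; [rewrite ger0_norm ?subr_ge0//|rewrite ltr0_norm ?subr_lt0//]; lra.
have tk : 0 < t + k * 1 by rewrite mulr1 ltr_wpDl.
split.
  have Iz : I0 (t + k * 1, s) by split => //=; rewrite ltry.
  by apply: derive_line (dg _ Iz) => h; rewrite line2.
rewrite subr0; apply: HM; split => /=; first by rewrite (ltW tk)/= mulr1 lerD// ltW.
by case/andP: sI => s0 s1; rewrite !ltW.
Qed.

Lemma solution_flow : exists u1t u11 u12 u2t u21 u22,
  C1_flow c D u1 u1t u11 u12 u2 u2t u21 u22 /\
  flow_pressure c D u1 u1t u11 u12 u2 u2t u21 u22 p.
Proof.
have [/curve_component[cc1 l1] /curve_component[cc2 l2]] := sol_surface_C1 S.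
have [/solution_field[u1t [u11 [u12 [F1 E1]]]] /solution_field[u2t [u21 [u22 [F2 E2]]]]] := sol_velocity_C1 S.
exists u1t, u11, u12, u2t, u21, u22; split; constructor => //.
- by apply: cont_on_eq (cont_on_pair cc1 cc2) => z _; rewrite /= -surjective_pairing.
- move=> T; have [L1 L10 H1] := l1 T; have [L2 L20 H2] := l2 T.
  exists (L1 + L2); first exact: addr_ge0.
  move=> t a b tI aI bI; have h1 := H1 t a b tI aI bI; have h2 := H2 t a b tI aI bI.
  have n0 := normr_ge0 (a - b).
  have k1 := mulr_ge0 L10 n0; have k2 := mulr_ge0 L20 n0.
  rewrite norm_pair_le mulrDl; apply/andP; split.
    by move: h1 k2; rewrite /=; clear -S; lra.
  by move: h2 k1; rewrite /=; clear -S; lra.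
- by move=> t t0; apply: (sol_domain S t0); rewrite ltry.
- by move=> t t0; apply: (sol_surface S t0); rewrite ltry.
- by move=> t t0; apply: (sol_impermeable S t0); rewrite ltry.
- by move=> t t0; apply: (sol_endpoints S t0); rewrite ltry.
- move=> t x t0 Dx; have [h1 h2] := sol_div_curl S (ltW t0) (ltry t) Dx.
  have [_ e1 e2] := E1 t x t0 Dx; have [_ e3 e4] := E2 t x t0 Dx.
  by rewrite -e1 -e4 -e2 -e3; split => //; apply/eqP; rewrite -subr_eq0 h2.
- by move=> t a t0 aI; exact: (sol_kinematic S t0 (ltry t) aI).
- by move=> t t0; have [/within_cont_on] := sol_pressure_regular S t0 (ltry t).
- by move=> t a t0 aI; exact: (sol_dynamic S t0 (ltry t) aI).
- move=> t x t0 Dx; have [_ dp] := sol_pressure_regular S t0 (ltry t).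
  have [p1 p2] := dp x Dx; have [m1 m2] := sol_euler S t0 (ltry t) Dx.
  have [e0 e1 e2] := E1 t x t0 Dx; have [e3 e4 e5] := E2 t x t0 Dx.
  have k1 : d1 (p t) x = - material u1 u2 u1t u11 u12 t x.
    by apply/eqP; rewrite -addr_eq0 addrC -m1 /material_derivative e0 e1 e2.
  have k2 : d2 (p t) x = - material u1 u2 u2t u21 u22 t x.
    by apply/eqP; rewrite -addr_eq0 addrC -m2 /material_derivative e3 e4 e5.
  rewrite -k1 -k2; split.
    by apply: derive_line (derivableP p1) => h; rewrite line1.
  by apply: derive_line (derivableP p2) => h; rewrite line2.
Qed.

End FromSolution.

Theorem theorem1p1 (R : realType)
    (c0 : R -> R * R) (D0 : set (R * R)) (v1 v2 : R * R -> R)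
    (hdata : C1_initial_data c0 D0 v1 v2)
    (hA : 0 < functional_A D0 v1 v2)
    (T : \bar R) (c : R -> R -> R * R) (D : R -> set (R * R))
    (u1 u2 p : R -> R * R -> R)
    (hsol : C1_solution T c D u1 u2 p)
    (hinit : has_initial_data c D u1 u2 c0 D0 v1 v2) :
  (T < +oo)%E.
Proof.
rewrite ltNge leye_eq; apply/negP => /eqP TE; rewrite {}TE in hsol.
have [u1t [u11 [u12 [u2t [u21 [u22 [F P]]]]]]] := solution_flow hsol.
apply: (flow_blowup F P); move: hA; congr (_ < _).
case: hinit => _ DE uv; subst D0.
rewrite /functional_A /impulse; congr (_ + _).
  by apply: eq_pint => x Dx; rewrite /momentum; have [-> _] := uv x Dx.
have [[c2 _ _ _] _] := flow_u2 F.
have [[_ _ _ [/within_cont_on cv2 _]] _] := hdata.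
apply: eq_lint => y yI; congr (_ * _); apply/esym.
(* The initial velocities are identified on the open domain; on the wall they agree as continuous
   extensions. *)
apply: (closure_eq (field_slice c2 (lexx 0)) cv2); first by move=> x /uv[].
exact: (wall_pt_closure F (lexx 0) (right_wall yI)).
Qed.
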